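(* Let $d\ge2$ be fixed. There exist constants $C,C',C''>0$ (independent of $n,p,q$) such that for all $n\ge2$ and $p,q\in(0,1)$ with $$p^2q\ \ge\ C\,\frac{\log n}{n},$$ if $Y$ is drawn from the random corruption model with ground truth $X^\star\in\mathrm{SO}(d)^n$, true-observation ratio $p$ and observation ratio $q$, and $X^0=\mathrm{SpectrIn}(Y)$, then with probability at least $1-C'/n$, $$\operatorname{dist}(X^0,X^\star)\le C''\,\frac{\sqrt{\log n}}{p\sqrt q}\qquad\text{and}\qquad \operatorname{dist}_\infty(X^0,X^\star)\le C''\,\frac{\sqrt{\log n}}{p\sqrt{nq}}.$$
   Context: Notation. $\mathrm{SO}(d)=\{R\in\mathbb{R}^{d\times d}: R^\top R=I,\det R=1\}$. A matrix $X\in\mathbb{R}^{nd\times d}$ is written in $d\times d$ blocks $X=(X_1;\dots;X_n)$; $X\in\mathrm{SO}(d)^n$ means every $X_i\in\mathrm{SO}(d)$. $\mathcal{P}_S$ is the Euclidean (Frobenius) projection onto $S$. Random corruption model (RCM). Fix $X^\star=(X_1^\star;\dots;X_n^\star)\in\mathrm{SO}(d)^n$. Independently for each pair $i<j$: with probability $pq$, $Y_{ij}=X_i^\star X_j^{\star\top}$ (a true observation); with probability $(1-p)q$, $Y_{ij}=O_{ij}$ with $O_{ij}$ uniformly (Haar) distributed on $\mathrm{SO}(d)$, independent of everything else (an outlier); with probability $1-q$, $Y_{ij}=0$ (missing). Set $Y_{ji}=Y_{ij}^\top$ and $Y_{ii}=0$. $Y\in\mathbb{R}^{nd\times nd}$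 has $(i,j)$ block $Y_{ij}$. Distances. For $X,Z\in\mathbb{R}^{nd\times d}$ let $R^\star\in\arg\min_{R\in\mathrm{SO}(d)}\|X-ZR\|_F^2$ (equivalently $R^\star=\mathcal{P}_{\mathrm{SO}(d)}(Z^\top X)$); then $\operatorname{dist}(X,Z)=\|X-ZR^\star\|_F$ and $\operatorname{dist}_\infty(X,Z)=\max_{1\le i\le n}\|X_i-Z_iR^\star\|_F$. SpectrIn. Compute orthonormal eigenvectors $u_1,\dots,u_d$ of $Y$ for its $d$ largest eigenvalues; set $\Phi=\sqrt n[u_1,\dots,u_d]$ and $\Psi=\sqrt n[u_1,\dots,u_{d-1},-u_d]$ in $\mathbb{R}^{nd\times d}$; let $\widetilde\Phi=\mathcal{P}_{\mathrm{SO}(d)^n}(\Phi)$, $\widetilde\Psi=\mathcal{P}_{\mathrm{SO}(d)^n}(\Psi)$ (blockwise projections onto $\mathrm{SO}(d)$). Output $X^0=\widetilde\Phi$ if $\|\widetilde\Phi-\Phi\|_F\le\|\widetilde\Psi-\Psi\|_F$, and $X^0=\widetilde\Psi$ otherwise. *)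

(* Defs.v *)
From mathcomp Require Import all_boot all_order all_algebra.
From mathcomp Require Import all_classical all_reals all_analysis.

Set Implicit Arguments.
Unset Strict Implicit.
Unset Printing Implicit Defensive.

Import Order.TTheory GRing.Theory Num.Theory numFieldNormedType.Exports.

Local Open Scope classical_set_scope.
Local Open Scope ring_scope.

(* The norm MathComp-Analysis puts on matrices is the sup norm. *)
Definition frob (R : realType) (m k : nat) (A : 'M[R]_(m, k)) : R :=
  Num.sqrt (\sum_i \sum_j A i j ^+ 2).

Definition SO (R : realType) (d : nat) : set 'M[R]_d :=
  [set Q | Q^T *m Q = 1%:M /\ \det Q = 1].
Arguments SO : clear implicits.

(* An nd x d matrix in d x d blocks has row dimension \sum_(i < n) d (= n * d),
   the row index type of \mxcol_(i < n) and \mxblock_(i < n, j < n). *)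
Definition block (R : realType) (n d : nat)
    (X : 'M[R]_(\sum_(i < n) d, d)) (i : 'I_n) : 'M[R]_d :=
  submxcol (p_ := fun=> d) X i.

Definition SOn (R : realType) (n d : nat) : set 'M[R]_(\sum_(i < n) d, d) :=
  [set X | forall i, SO R d (block X i)].
Arguments SOn : clear implicits.

(* B is a Euclidean projection of A onto S; it need not be unique. *)
Definition is_proj (R : realType) (m k : nat) (S : set 'M[R]_(m, k))
    (A B : 'M[R]_(m, k)) : Prop :=
  S B /\ forall B', S B' -> frob (A - B) <= frob (A - B').

(* A choice of minimizer; one exists since SO(d) is compact and nonempty,
   so the default value 1%:M is never used. *)
Definition align (R : realType) (n d : nat)
    (X Z : 'M[R]_(\sum_(i < n) d, d)) : 'M[R]_d :=
  xget 1%:M [set Q | SO R d Q /\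
    forall Q', SO R d Q' -> frob (X - Z *m Q) <= frob (X - Z *m Q')].

Definition dist (R : realType) (n d : nat)
    (X Z : 'M[R]_(\sum_(i < n) d, d)) : R :=
  frob (X - Z *m align X Z).

Definition dist_inf (R : realType) (n d : nat)
    (X Z : 'M[R]_(\sum_(i < n) d, d)) : R :=
  \big[Num.max/0]_(i < n) frob (block X i - block Z i *m align X Z).

Definition borel_mx (R : realType) (d : nat) : set (set 'M[R]_d) :=
  <<s [set B : set 'M[R]_d | open B] >>.
Arguments borel_mx : clear implicits.

(* Haar probability on a compact group is its unique left-invariant Borel
   probability measure. *)
Definition haar_distributed (R : realType) (d : nat) (disp : measure_display)
    (T : measurableType disp) (P : probability T R) (O : T -> 'M[R]_d) : Prop :=
  [/\ forall w, SO R d (O w),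
      forall B, borel_mx R d B -> measurable (O @^-1` B)
    & forall Q B, SO R d Q -> borel_mx R d B ->
        P [set w | B (Q *m O w)] = P [set w | B (O w)]].

Inductive label : Type := Inlier | Outlier | Missing.

Definition observation (R : realType) (n d : nat)
    (Xs : 'M[R]_(\sum_(i < n) d, d)) (s : 'I_n -> 'I_n -> label)
    (O : 'I_n -> 'I_n -> 'M[R]_d) (i j : 'I_n) : 'M[R]_d :=
  match s i j with
  | Inlier => block Xs i *m (block Xs j)^T
  | Outlier => O i j
  | Missing => 0
  end.

Definition rcm_matrix (R : realType) (n d : nat)
    (Xs : 'M[R]_(\sum_(i < n) d, d)) (s : 'I_n -> 'I_n -> label)
    (O : 'I_n -> 'I_n -> 'M[R]_d) : 'M[R]_(\sum_(i < n) d) :=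
  \mxblock_(i < n, j < n)
    (if (i < j)%N then observation Xs s O i j
     else if (j < i)%N then (observation Xs s O j i)^T
     else 0).

(* Only the entries s i j and O i j with i < j are used. In the independence
   clause some of the A i j and B i j may be the full set, so the product rule
   also covers every subfamily. *)
Definition is_RCM (R : realType) (n d : nat) (disp : measure_display)
    (T : measurableType disp) (P : probability T R) (p q : R)
    (Xs : 'M[R]_(\sum_(i < n) d, d))
    (Y : T -> 'M[R]_(\sum_(i < n) d)) : Prop :=
  exists (s : 'I_n -> 'I_n -> T -> label) (O : 'I_n -> 'I_n -> T -> 'M[R]_d),
  [/\ forall i j : 'I_n, (i < j)%N ->
        [/\ forall A : set label, measurable (s i j @^-1` A),
            P (s i j @^-1` [set Inlier]) = (p * q)%:E,
            P (s i j @^-1` [set Outlier]) = ((1 - p) * q)%:E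
          & P (s i j @^-1` [set Missing]) = (1 - q)%:E],
      forall i j : 'I_n, (i < j)%N -> haar_distributed P (O i j),
      forall (A : 'I_n -> 'I_n -> set label)
             (B : 'I_n -> 'I_n -> set 'M[R]_d),
        (forall i j, borel_mx R d (B i j)) ->
        P [set w | forall i j : 'I_n, (i < j)%N ->
                     A i j (s i j w) /\ B i j (O i j w)] =
        (\prod_(i < n) \prod_(j < n | (i < j)%N)
           (P (s i j @^-1` A i j) * P (O i j @^-1` B i j)))%E
    & forall w,
        Y w = rcm_matrix Xs (fun i j => s i j w) (fun i j => O i j w)].

(* The columns of U are orthonormal eigenvectors of Y for its k largest
   eigenvalues, counted with multiplicity: they form part of an orthonormal
   eigenbasis V whose other eigenvalues are no larger. *)
Definition top_eigenvectors (R : realType) (N k : nat) (Y : 'M[R]_N)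
    (U : 'M[R]_(N, k)) : Prop :=
  exists (V : 'M[R]_N) (l : 'rV[R]_N) (f : 'I_k -> 'I_N),
  [/\ V^T *m V = 1%:M, Y *m V = V *m diag_mx l, injective f,
      forall a b, b \notin codom f -> l 0 b <= l 0 (f a)
    & U = colsub f V].

Definition flip_last_col (R : realType) (m d : nat) (A : 'M[R]_(m, d)) :
    'M[R]_(m, d) :=
  \matrix_(a, k) (if k.+1 == d then - A a k else A a k).

(* X0 is an output of the algorithm on input Y. Eigenvectors and projections
   need not be unique, hence a relation rather than a function. *)
Definition is_SpectrIn (R : realType) (n d : nat)
    (Y : 'M[R]_(\sum_(i < n) d)) (X0 : 'M[R]_(\sum_(i < n) d, d)) : Prop :=
  exists U Phi_t Psi_t : 'M[R]_(\sum_(i < n) d, d),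
  let Phi := Num.sqrt n%:R *: U in
  let Psi := Num.sqrt n%:R *: flip_last_col U in
  [/\ top_eigenvectors Y U,
      is_proj (SOn R n d) Phi Phi_t,
      is_proj (SOn R n d) Psi Psi_t
    & X0 = if frob (Phi_t - Phi) <= frob (Psi_t - Psi) then Phi_t else Psi_t].

(* Main.v *)
(* The leading part of Y + pq I is pq X X^T, which has rank d and nonzero eigenvalue npq; the rest is
   a centred noise W with independent blocks. With t of order sqrt(n q log n), outside an event of
   probability O(1/n) we have |W x| <= t |x| for all x, and for every i and k < n block i of W v is at
   most t max_j |v_j|, where v = W_i^k X and W_i is W with node i removed, so that v is independent of
   row i. By the leave-one-out recursion every block of W^k X is then at most sqrt(d) (5 t)^k. A top
   eigenvector phi with eigenvalue mu - pq, mu >= npq - t, satisfies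
     phi = sum_(k < n) pq mu^-(k+1) W^k X (X^T phi) + mu^-n W^n phi,
   so each block of Phi is within O(t / npq) of X_i A for one common A. Orthonormality of the
   eigenvectors makes A nearly orthogonal; the sign test of SpectrIn picks the component of O(d)
   containing X_i A, and projecting and aligning cost only constant factors.

   The Haar measure enters only through invariance under diagonal matrices D of signs with
   determinant one: O_ij is distributed as D O_ij, and the uniform average over D is 0. So the
   probability of a measurable event is an average over the O_ij of probabilities on a finite product
   space of labels and signs, where all tail bounds are proved. The operator norm bound there is
   a moment bound for Rademacher sums of symmetric matrices. *)

Require Import Defs.
From mathcomp Require Import all_boot all_order all_algebra.
From mathcomp Require Import all_classical all_reals all_analysis.
From mathcomp Require Import perm measurable_realfun ring lra zify.

Set Implicit Arguments.
Unset Strict Implicit.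
Unset Printing Implicit Defensive.

Import Order.TTheory GRing.Theory Num.Theory numFieldNormedType.Exports.

Local Open Scope classical_set_scope.
Local Open Scope ring_scope.

(** * Frobenius norm *)

(** [X0] is tied to [Y] only by a relation, so events about it need not be measurable, and the law
    of the outliers is accessible only through boxes. Every exceptional event is therefore a set of
    polynomial inequalities in the outlier array: an operator norm gives way to the Frobenius norm
    of a high power, a maximum over blocks to a comparison with each block. The power is $2^r$ with
    $\log n\le 2^r\le 2\log n$: at this order a prefactor polynomial in $n$ costs only a constant in
    the norm, and exponents that are powers of two are reached by repeated Cauchy-Schwarz.

    The noise at a node is governed by the number of observations there, which is itself random.
    Exchanging pairs with an independent copy of the configuration turns the noise into a Rademacher
    sum whose variance is a sum of two such degrees, and a degree has exponential moments on the
    scale $nq$; this is why $q$ enters $t$ under the root. The relative error $t/(npq)$ has square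
    of order $\log n/(np^2q)$, so the assumption on $p^2q$ says that it lies below the threshold at
    which rounding and the sign test succeed. *)

Lemma cauchy_schwarz_sum (R : realType) (I : finType) (a b : I -> R) :
  (\sum_i a i * b i) ^+ 2 <= (\sum_i a i ^+ 2) * (\sum_i b i ^+ 2).
Proof.
set A := \sum_i a i ^+ 2; set B := \sum_i b i ^+ 2; set C := \sum_i a i * b i.
have A0 : 0 <= A by apply: sumr_ge0 => i _; exact: sqr_ge0.
have : 0 <= \sum_i (A * b i - C * a i) ^+ 2.
  by apply: sumr_ge0 => i _; exact: sqr_ge0.
under eq_bigr => i _ do rewrite sqrrB !exprMn.
rewrite big_split/= sumrB -!mulr_sumr.
under [X in _ - X]eq_bigr => i _.
  rewrite (_ : _ *+ 2 = (2 * A * C) * (a i * b i)); first by over.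
  by ring.
rewrite -mulr_sumr -/A -/B -/C => h.
have {}h : 0 <= A * (A * B - C ^+ 2) by apply: le_trans h _; nra.
have [A00|Apos] := eqVneq A 0.
  suff -> : C = 0 by rewrite A00; nra.
  rewrite /C big1// => i _.
  have /eqP := A00; rewrite psumr_eq0; last by move=> *; exact: sqr_ge0.
  by move=> /allP/(_ i (mem_index_enum i))/=; rewrite sqrf_eq0 => /eqP ->; rewrite mul0r.
by move: h; rewrite pmulr_rge0 ?subr_ge0// lt0r Apos.
Qed.

Definition sqn (R : realType) (m k : nat) (A : 'M[R]_(m, k)) : R :=
  \sum_i \sum_j A i j ^+ 2.

Section Frob.
Variable R : realType.

Lemma sqn_ge0 m k (A : 'M[R]_(m, k)) : 0 <= sqn A.
Proof. by apply: sumr_ge0 => i _; apply: sumr_ge0 => j _; exact: sqr_ge0. Qed.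

Lemma frob_ge0 m k (A : 'M[R]_(m, k)) : 0 <= frob A.
Proof. exact: sqrtr_ge0. Qed.

Lemma frob_sqr m k (A : 'M[R]_(m, k)) : frob A ^+ 2 = sqn A.
Proof. by rewrite sqr_sqrtr// sqn_ge0. Qed.

Lemma frobE m k (A : 'M[R]_(m, k)) : frob A = Num.sqrt (sqn A).
Proof. by []. Qed.

Lemma frob_le m k m' k' (A : 'M[R]_(m, k)) (B : 'M[R]_(m', k')) :
  (frob A <= frob B) = (sqn A <= sqn B).
Proof. by rewrite !frobE ler_sqrt// sqn_ge0. Qed.

Lemma frob_le_sqr m k (A : 'M[R]_(m, k)) c : 0 <= c ->
  (frob A <= c) = (sqn A <= c ^+ 2).
Proof. by move=> c0; rewrite -frob_sqr ler_sqr// nnegrE ?frob_ge0. Qed.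

Lemma frob0 m k : frob (0 : 'M[R]_(m, k)) = 0.
Proof.
rewrite frobE /sqn big1 ?sqrtr0// => i _; rewrite big1// => j _.
by rewrite mxE expr0n.
Qed.

Lemma sqn_pair m k (A : 'M[R]_(m, k)) : sqn A = \sum_(x : 'I_m * 'I_k) A x.1 x.2 ^+ 2.
Proof. by rewrite /sqn pair_big. Qed.

Definition ip m k (A B : 'M[R]_(m, k)) := \sum_i \sum_j A i j * B i j.

Lemma ip_pair m k (A B : 'M[R]_(m, k)) :
  ip A B = \sum_(x : 'I_m * 'I_k) A x.1 x.2 * B x.1 x.2.
Proof. by rewrite /ip pair_big. Qed.

Lemma ip_trace m k (A B : 'M[R]_(m, k)) : ip A B = \tr (A^T *m B).
Proof.
rewrite /ip exchange_big; apply: eq_bigr => j _; rewrite mxE.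
by apply: eq_bigr => i _; rewrite mxE.
Qed.

Lemma ipxx m k (A : 'M[R]_(m, k)) : ip A A = sqn A.
Proof. by []. Qed.

Lemma sqn_trace m k (A : 'M[R]_(m, k)) : sqn A = \tr (A^T *m A).
Proof. by rewrite -ip_trace. Qed.

Lemma ipC m k (A B : 'M[R]_(m, k)) : ip A B = ip B A.
Proof. by apply: eq_bigr => i _; apply: eq_bigr => j _; rewrite mulrC. Qed.

Lemma ip_cauchy_sqr m k (A B : 'M[R]_(m, k)) : ip A B ^+ 2 <= sqn A * sqn B.
Proof. by rewrite ip_pair !sqn_pair; exact: cauchy_schwarz_sum. Qed.

Lemma ip_cauchy m k (A B : 'M[R]_(m, k)) : `|ip A B| <= frob A * frob B.
Proof.
rewrite -ler_sqr ?nnegrE ?mulr_ge0 ?frob_ge0//.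
by rewrite real_normK ?num_real// exprMn !frob_sqr ip_cauchy_sqr.
Qed.

Lemma sqnD m k (A B : 'M[R]_(m, k)) : sqn (A + B) = sqn A + ip A B *+ 2 + sqn B.
Proof.
rewrite !sqn_pair ip_pair -sumrMnl -!big_split/=.
by apply: eq_bigr => x _; rewrite mxE sqrrD.
Qed.

Lemma frobD m k (A B : 'M[R]_(m, k)) : frob (A + B) <= frob A + frob B.
Proof.
rewrite frob_le_sqr ?addr_ge0 ?frob_ge0// sqnD sqrrD !frob_sqr.
rewrite lerD2r lerD2l lerMn2r/=; apply: le_trans (ip_cauchy A B).
exact: ler_norm.
Qed.

Lemma frobZ m k c (A : 'M[R]_(m, k)) : frob (c *: A) = `|c| * frob A.
Proof.
apply/eqP; rewrite -(@eqrXn2 _ 2) ?mulr_ge0 ?frob_ge0//.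
rewrite exprMn !frob_sqr !sqn_pair real_normK ?num_real// mulr_sumr.
by apply/eqP/eq_bigr => x _; rewrite mxE exprMn.
Qed.

Lemma frobN m k (A : 'M[R]_(m, k)) : frob (- A) = frob A.
Proof. by rewrite -scaleN1r frobZ normrN1 mul1r. Qed.

Lemma frobB m k (A B : 'M[R]_(m, k)) : frob (A - B) <= frob A + frob B.
Proof. by rewrite -(frobN B); exact: frobD. Qed.

Lemma frob_distC m k (A B : 'M[R]_(m, k)) : frob (A - B) = frob (B - A).
Proof. by rewrite -frobN opprB. Qed.

Lemma frob_sum (I : Type) (r : seq I) (P : pred I) m k (F : I -> 'M[R]_(m, k)) :
  frob (\sum_(i <- r | P i) F i) <= \sum_(i <- r | P i) frob (F i).
Proof.
elim/big_rec2: _ => [|i y1 y2 _ h]; first by rewrite frob0.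
by apply: le_trans (frobD _ _) _; rewrite lerD2l.
Qed.

Lemma sqn_tr m k (A : 'M[R]_(m, k)) : sqn A^T = sqn A.
Proof.
rewrite /sqn exchange_big; apply: eq_bigr => i _.
by apply: eq_bigr => j _; rewrite mxE.
Qed.

Lemma frob_tr m k (A : 'M[R]_(m, k)) : frob A^T = frob A.
Proof. by rewrite !frobE sqn_tr. Qed.

Lemma sqnM m k l (A : 'M[R]_(m, k)) (B : 'M[R]_(k, l)) :
  sqn (A *m B) <= sqn A * sqn B.
Proof.
rewrite -(sqn_tr B) /sqn mulr_suml; apply: ler_sum => i _.
rewrite mulr_sumr; apply: ler_sum => j _; rewrite mxE.
apply: le_trans (cauchy_schwarz_sum _ _) _.
rewrite [X in _ * X](eq_bigr (fun k => B^T j k ^+ 2))// => x _.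
by rewrite mxE.
Qed.

Lemma frobM m k l (A : 'M[R]_(m, k)) (B : 'M[R]_(k, l)) :
  frob (A *m B) <= frob A * frob B.
Proof.
rewrite frob_le_sqr ?mulr_ge0 ?frob_ge0// exprMn !frob_sqr; exact: sqnM.
Qed.

Lemma sqn_orthl m k l (Q : 'M[R]_(m, k)) (A : 'M[R]_(k, l)) :
  Q^T *m Q = 1%:M -> sqn (Q *m A) = sqn A.
Proof. by move=> h; rewrite !sqn_trace trmx_mul mulmxA -(mulmxA _ Q^T) h mulmx1. Qed.

Lemma frob_orthl m k l (Q : 'M[R]_(m, k)) (A : 'M[R]_(k, l)) :
  Q^T *m Q = 1%:M -> frob (Q *m A) = frob A.
Proof. by move=> h; rewrite !frobE sqn_orthl. Qed.

Lemma frob_orthr m k (A : 'M[R]_(m, k)) (Q : 'M[R]_k) :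
  Q^T *m Q = 1%:M -> frob (A *m Q) = frob A.
Proof.
by move=> h; rewrite -frob_tr trmx_mul frob_orthl ?frob_tr// trmxK mulmx1C.
Qed.

Lemma sqn_scalar d (c : R) : sqn (c%:M : 'M[R]_d) = c ^+ 2 * d%:R.
Proof.
rewrite sqn_trace tr_scalar_mx -scalar_mxM mxtrace_scalar.
by rewrite expr2 mulr_natr.
Qed.

Lemma sqn_orth m k (Q : 'M[R]_(m, k)) : Q^T *m Q = 1%:M -> sqn Q = k%:R.
Proof. by move=> h; rewrite sqn_trace h mxtrace_scalar. Qed.

Lemma frob_orth m k (Q : 'M[R]_(m, k)) : Q^T *m Q = 1%:M -> frob Q = Num.sqrt k%:R.
Proof. by move=> h; rewrite frobE sqn_orth. Qed.

Lemma le_entry_frob m k (A : 'M[R]_(m, k)) i j : `|A i j| <= frob A.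
Proof.
rewrite -ler_sqr ?nnegrE ?frob_ge0// frob_sqr real_normK ?num_real//.
rewrite sqn_pair (bigD1 (i, j))//= lerDl.
by apply: sumr_ge0 => x _; exact: sqr_ge0.
Qed.

Lemma sqn_col m k (A : 'M[R]_(m, k)) : sqn A = \sum_j sqn (col j A).
Proof.
rewrite /sqn exchange_big; apply: eq_bigr => j _; apply: eq_bigr => i _.
by rewrite big_ord1 mxE.
Qed.

Lemma sqn_cols_bound m k (A : 'M[R]_(m, k)) c : 0 <= c ->
  (forall j, frob (col j A) <= c) -> sqn A <= k%:R * c ^+ 2.
Proof.
move=> c0 h; rewrite sqn_col.
apply: le_trans (_ : \sum_(j < k) c ^+ 2 <= _).
  by apply: ler_sum => j _; rewrite -frob_le_sqr.
by rewrite sumr_const card_ord mulr_natl.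
Qed.

Lemma frob_eq0 m k (A : 'M[R]_(m, k)) : frob A = 0 -> A = 0.
Proof.
move=> h; apply/matrixP => i j; rewrite mxE.
by have := le_entry_frob A i j; rewrite h normr_le0 => /eqP.
Qed.

Lemma sqn_blocks n d k (X : 'M[R]_(\sum_(i < n) d, k)) :
  sqn X = \sum_i sqn (submxcol (p_ := fun=> d) X i).
Proof.
rewrite /sqn [RHS]sig_big_dep [RHS](reindex _ (@tagnat.sig_bij_on n (fun=> d)))/=.
apply: eq_bigr => i _; apply: eq_bigr => j _.
by rewrite mxE -[tag _]/(tagnat.sig1 i) -[tagged _]/(tagnat.sig2 i) tagnat.sig2K.
Qed.

Lemma frob_blocks_le n d k (X : 'M[R]_(\sum_(i < n) d, k)) c : 0 <= c ->
  (forall i, frob (submxcol (p_ := fun=> d) X i) <= c) ->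
  frob X <= Num.sqrt n%:R * c.
Proof.
move=> c0 h; rewrite frob_le_sqr ?mulr_ge0// exprMn sqr_sqrtr// sqn_blocks.
apply: le_trans (_ : \sum_(j < n) c ^+ 2 <= _).
  by apply: ler_sum => j _; rewrite -frob_le_sqr.
by rewrite sumr_const card_ord mulr_natl.
Qed.

Lemma frob_block_le n d k (X : 'M[R]_(\sum_(i < n) d, k)) i :
  frob (submxcol (p_ := fun=> d) X i) <= frob X.
Proof.
rewrite frob_le [leRHS]sqn_blocks (bigD1 i)//= lerDl.
by apply: sumr_ge0 => j _; exact: sqn_ge0.
Qed.

Lemma submxcol_mulmx n d k (W : 'M[R]_(\sum_(i < n) d))
    (X : 'M[R]_(\sum_(i < n) d, k)) (i : 'I_n) :
  submxcol (p_ := fun=> d) (W *m X) i =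
  \sum_j submxblock (p_ := fun=> d) (q_ := fun=> d) W i j *m submxcol (p_ := fun=> d) X j.
Proof.
by rewrite -{1}(submxblockK W) -{1}(submxcolK X) mul_mxblock_mxrow mxcolK.
Qed.

End Frob.

(** * Moments of Rademacher sums of symmetric matrices *)

Section Moments.
Variables (R : realType) (N : nat).
Implicit Types A B H : 'M[R]_N.

Lemma trmx_exp A k : (A ^+ k)^T = A^T ^+ k.
Proof. by elim: k => [|k IH]; rewrite ?expr0 ?trmx1// exprS exprSr trmx_mul IH. Qed.

Lemma sqn_exp A k : A^T = A -> sqn (A ^+ k) = \tr (A ^+ (2 * k)).
Proof. by move=> sA; rewrite sqn_trace trmx_exp sA mul2n -addnn exprD. Qed.

(** Convexity puts [u i] below the chord from [0] to [i.+1], which is [key]; a descent from [M] then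
    passes the bound from [i.+1] to [i]. *)
Lemma discrete_convex_le (u : nat -> R) (M : nat) (c : R) :
  (forall i, (i.+1 < M)%N -> u i.+1 *+ 2 <= u i + u i.+2) ->
  u 0%N <= c -> u M <= c -> forall i, (i <= M)%N -> u i <= c.
Proof.
move=> cvx u0 uM.
have key i : (i < M)%N -> i.+1%:R * u i <= u 0%N + i%:R * u i.+1.
  elim: i => [|i IH] iM; first by rewrite mul1r mul0r addr0.
  have := IH (ltnW iM); have := cvx _ iM.
  have i0 : 0 <= i%:R :> R by [].
  rewrite -!natr1; nra.
have {key} step i : (i < M)%N -> u i.+1 <= c -> u i <= c.
  move=> iM ui; have := key i iM; have i0 : 0 <= i%:R :> R by [].
  by rewrite -!natr1; nra.
have down k : u (M - k)%N <= c.
  elim: k => [|k IH]; first by rewrite subn0.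
  have [kM|Mk] := ltnP k M; last by rewrite (_ : M - k.+1 = M - k)%N//; lia.
  by apply: step; [lia | rewrite subnSK].
by move=> i iM; rewrite -(subKn iM).
Qed.

Section TraceConvexity.
Variables A B H : 'M[R]_N.
Hypotheses (sA : A^T = A) (sB : B^T = B) (sH : H^T = H).

Let F a b := \tr (H * A ^+ a * H * B ^+ b).

(** Mixed traces are entries of a Gram matrix, so Cauchy-Schwarz applies to them although $A$, $B$
    and $H$ need not commute. *)
Let ipF i j i' j' :
  ip (A ^+ i * H * B ^+ j) (A ^+ i' * H * B ^+ j') = F (i + i') (j + j').
Proof.
rewrite ip_trace /F (addnC j) !exprD.
transitivity (\tr (B ^+ j * (H * A ^+ i * A ^+ i' * H * B ^+ j'))).
  by rewrite !trmx_mul !trmx_exp sA sB sH !mulmxE !mulrA.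
by rewrite [LHS]mxtrace_mulC !mulmxE !mulrA.
Qed.

Let amgm i j i' j' :
  `|F (i + i') (j + j')| *+ 2 <= F (i + i) (j + j) + F (i' + i') (j' + j').
Proof.
rewrite -!ipF !ipxx.
set x := A ^+ i * _ * _; set y := A ^+ i' * _ * _.
have := ip_cauchy x y; rewrite -!frob_sqr.
by have := sqr_ge0 (frob x - frob y); rewrite sqrrB; lra.
Qed.

(* AM-GM makes [i |-> F (2 * i) (2 * (M - i))] convex, so it is largest at an endpoint. *)
Lemma trace_interpolation M a : (a <= 2 * M)%N ->
  `|F a (2 * M - a)| <= sqn (H * A ^+ M) + sqn (H * B ^+ M).
Proof.
set c := _ + _.
pose u i := F (2 * i) (2 * (M - i)).
have u0 : u 0%N <= c.
  rewrite /u muln0 subn0 mul2n -addnn; have := ipF 0 M 0 M.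
  by rewrite expr0 mul1r addn0 => <-; rewrite ipxx /c lerDr sqn_ge0.
have uM : u M <= c.
  rewrite /u subnn muln0 mul2n -addnn; have := ipF M 0 M 0.
  rewrite expr0 mulr1 addn0 => <-; rewrite ipxx -sqn_tr trmx_mul trmx_exp sA sH.
  by rewrite mulmxE /c lerDl sqn_ge0.
have cvx i : (i.+1 < M)%N -> u i.+1 *+ 2 <= u i + u i.+2.
  move=> iM.
  have := amgm i (M - i) i.+2 (M - i.+2).
  rewrite (_ : i + i.+2 = 2 * i.+1)%N; last lia.
  rewrite (_ : M - i + (M - i.+2) = 2 * (M - i.+1))%N; last lia.
  rewrite !addnn -!mul2n -/(u i) -/(u i.+1) -/(u i.+2); apply: le_trans.
  by rewrite lerMn2r/= ler_norm.
have ub := discrete_convex_le cvx u0 uM.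
move=> aM.
(* An even exponent gives some [u i], and AM-GM of that point with itself removes the absolute
   value. An odd exponent lies halfway between [u i] and [u i.+1]. *)
have [i [Ha|[Ha iM]]] : exists i, (a = 2 * i)%N \/ (a = 2 * i + 1 /\ i < M)%N.
- by exists (a %/ 2)%N; lia.
- have := amgm i (M - i) i (M - i); rewrite !addnn -!mul2n mulnBr -Ha.
  rewrite (_ : F a _ = u i); last by rewrite /u mulnBr Ha.
  have : u i <= c by apply: ub; lia.
  by nra.
- have := amgm i (M - i) i.+1 (M - i.+1).
  rewrite (_ : i + i.+1 = a)%N; last lia.
  rewrite (_ : M - i + (M - i.+1) = 2 * M - a)%N; last lia.
  rewrite !addnn -!mul2n -/(u i) -/(u i.+1).
  have : u i <= c by apply: ub; lia.
  have : u i.+1 <= c by apply: ub; lia.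
  by nra.
Qed.

Lemma expr_telescope k :
  A ^+ k - B ^+ k = \sum_(a < k) A ^+ a * (A - B) * B ^+ (k.-1 - a).
Proof.
elim: k => [|k IH]; first by rewrite big_ord0 !expr0 subrr.
rewrite big_ord_recr/= subnn expr0 mulr1 mulrBr.
rewrite (eq_bigr (fun a : 'I_k => (A ^+ a * (A - B) * B ^+ (k.-1 - a)) * B)); last first.
  move=> a _; rewrite -[in RHS]mulrA -exprSr; congr (_ * B ^+ _).
  by have := ltn_ord a; lia.
by rewrite -mulr_suml -IH mulrBl -!exprSr addrC addrA subrK.
Qed.

(** Telescoping leaves $2M+1$ mixed traces, each bounded by [trace_interpolation]. In the
    application $A$ and $B$ are a Rademacher sum before and after the flip of one sign, and [e] is
    that sign. *)
Lemma trace_increment M (e : R) : e ^+ 2 = 1 -> A - B = (2 * e) *: H ->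
  e * \tr (H * (A ^+ (2 * M).+1 - B ^+ (2 * M).+1)) <=
  2 * (2 * M).+1%:R * (sqn (H * A ^+ M) + sqn (H * B ^+ M)).
Proof.
move=> e2 AB; rewrite expr_telescope AB [H * _]mulr_sumr raddf_sum/=.
rewrite mulr_sumr (eq_bigr (fun a : 'I_(2*M).+1 => 2 * F a (2 * M - a))); last first.
  move=> a _; rewrite /F -[in RHS]e2 -!mulmxE -!scalemxAr -!scalemxAl -scalemxAr mxtraceZ.
  by rewrite !mulmxA; ring.
apply: le_trans (_ : \sum_(a < (2 * M).+1) 2 * (sqn (H * A ^+ M) + sqn (H * B ^+ M)) <= _).
  apply: ler_sum => a _; rewrite ler_pM2l//.
  by apply: le_trans (ler_norm _) _; apply: trace_interpolation; rewrite -ltnS.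
by rewrite sumr_const card_ord -[leLHS]mulr_natl mulrCA mulrA.
Qed.

End TraceConvexity.

Definition rademacher_sum (I : finType) (H : I -> 'M[R]_N) (s : {ffun I -> bool}) :=
  \sum_e (-1) ^+ (s e) *: H e.

Definition flip_sign (I : finType) (e : I) (s : {ffun I -> bool}) : {ffun I -> bool} :=
  [ffun e' => if e' == e then ~~ s e' else s e'].

Lemma flip_signK (I : finType) (e : I) : involutive (flip_sign e).
Proof. by move=> s; apply/ffunP => e'; rewrite !ffunE; case: eqP => // _; rewrite negbK. Qed.

Section Rademacher.
Variables (I : finType) (H : I -> 'M[R]_N) (D : R).
Hypothesis sH : forall e, (H e)^T = H e.
Hypothesis D0 : 0 <= D.
Hypothesis HD : forall Z : 'M[R]_N, \sum_e sqn (H e *m Z) <= D * sqn Z.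

Let X := rademacher_sum H.

Lemma rademacher_sum_sym s : (X s)^T = X s.
Proof.
by rewrite /X /rademacher_sum linear_sum/=; apply: eq_bigr => e _; rewrite linearZ/= sH.
Qed.

Lemma rademacher_flip e s : X s - X (flip_sign e s) = (2 * (-1) ^+ (s e)) *: H e.
Proof.
rewrite /X /rademacher_sum -sumrB (bigD1 e)//= big1 => [|e' e'e].
  rewrite addr0 ffunE eqxx -scalerBl; congr (_ *: _).
  by case: (s e) => /=; rewrite ?expr1 ?expr0; ring.
by rewrite ffunE (negbTE e'e) subrr.
Qed.

(** Discrete integration by parts, as in proofs of the noncommutative Khintchine inequality. One
    factor of $X^{2M+2}$ is expanded into signed $H_e$; pairing each sign vector with its flip at
    $e$ leaves a difference of traces for [trace_increment], and [HD] sums the resulting terms over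
    $e$. *)
Lemma moment_step M : \sum_s sqn (X s ^+ M.+1) <=
  2 * (2 * M).+1%:R * D * \sum_s sqn (X s ^+ M).
Proof.
rewrite (eq_bigr (fun s : {ffun I -> bool} => \sum_e (-1) ^+ (s e) * \tr (H e * X s ^+ (2 * M).+1))); last first.
  move=> s _; rewrite sqn_exp ?rademacher_sum_sym//.
  transitivity (\tr (\sum_e ((-1) ^+ (s e) *: H e) *m X s ^+ (2 * M).+1)).
    by rewrite -mulmx_suml mulmxE -[\sum_e _]/(X s) -exprS mulnS.
  by rewrite raddf_sum/=; apply: eq_bigr => e _; rewrite -scalemxAl mxtraceZ.
rewrite exchange_big/=.
apply: le_trans (_ : \sum_e 2 * (2 * M).+1%:R * \sum_s sqn (H e * X s ^+ M) <= _); last first.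
  rewrite -mulr_sumr -[leRHS]mulrA ler_pM2l ?mulr_gt0// exchange_big/= mulr_sumr.
  by apply: ler_sum => s _; exact: HD.
apply: ler_sum => e _.
have bij : bijective (flip_sign e) by exists (flip_sign e); exact: flip_signK.
pose G (s : {ffun I -> bool}) := (-1) ^+ (s e) * \tr (H e * X s ^+ (2 * M).+1).
pose K s := sqn (H e * X s ^+ M).
have GK s : G s + G (flip_sign e s) <= 2 * (2 * M).+1%:R * (K s + K (flip_sign e s)).
  apply: le_trans (trace_increment (rademacher_sum_sym s)
    (rademacher_sum_sym (flip_sign e s)) (sH e) M _ (rademacher_flip e s)); last first.
    by case: (s e); rewrite /= ?expr1 ?expr0 ?sqrrN expr1n.
  rewrite /G mulrBr raddfB/= mulrBr lerD2l// ffunE eqxx.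
  by case: (s e); rewrite /= ?expr1 ?expr0 !(mul1r, mulN1r, opprK).
have sumflip (f : {ffun I -> bool} -> R) : \sum_s f (flip_sign e s) = \sum_s f s.
  by rewrite [RHS](reindex (flip_sign e))//; exact: onW_bij.
have : \sum_s (G s + G (flip_sign e s)) <= \sum_s 2 * (2 * M).+1%:R * (K s + K (flip_sign e s)).
  by apply: ler_sum => s _; exact: GK.
by rewrite -mulr_sumr !big_split/= !sumflip -/(\sum_s G s); nra.
Qed.

(** [moment_step] is iterated from $X^0=1$, whose squared norm $N$, summed over all sign vectors, is
    the last factor. Each $2(2k+1)$ with $k<m$ is at most $4m$. *)
Lemma rademacher_moment m : \sum_s sqn (X s ^+ m) <=
  (4 * m%:R * D) ^+ m * (2 ^+ #|I| * N%:R).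
Proof.
have h k : (k <= m)%N -> \sum_s sqn (X s ^+ k) <= (4 * m%:R * D) ^+ k * (2 ^+ #|I| * N%:R).
  elim: k => [_|k IH km].
    rewrite expr0 mul1r (eq_bigr (fun=> N%:R)); last first.
      by move=> s _; rewrite expr0 sqn_scalar expr1n mul1r.
    by rewrite sumr_const -[leLHS]mulr_natl card_ffun card_bool natrX.
  apply: le_trans (moment_step k) _; rewrite exprS -[leRHS]mulrA.
  apply: ler_pM; rewrite ?mulr_ge0//; first by apply: sumr_ge0 => s _; exact: sqn_ge0.
    apply: ler_wpM2r => //.
    rewrite -(natrM _ 2) -(natrM _ 4) ler_nat; lia.
  exact/IH/ltnW.
exact: h.
Qed.

End Rademacher.
End Moments.

(** * Operator norms from Frobenius norms of powers *)

Section PowerNorm.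
Variable R : realType.

(** For symmetric $M$, $|Mx|^2=\langle x,M^2x\rangle\le|x|\,|M^2x|$, and each use doubles the
    exponent of $M$. Only the last step replaces the operator norm by the Frobenius norm, so the
    loss is damped by a $2^r$-th root. *)
Lemma sqn_mul_pow2 N k (M : 'M[R]_N) (x : 'M[R]_(N, k)) r : M^T = M ->
  sqn (M *m x) ^+ (2 ^ r) <= sqn (M ^+ (2 ^ r)) * sqn x ^+ (2 ^ r).
Proof.
elim: r M => [|r IH] M sM; first by rewrite expn0 !expr1; exact: sqnM.
have sM2 : (M ^+ 2)^T = M ^+ 2 by rewrite trmx_exp sM.
have h : sqn (M *m x) ^+ 2 <= sqn x * sqn (M ^+ 2 *m x).
  have M2 : M ^+ 2 *m x = M *m (M *m x) by rewrite mulmxA mulmxE -expr2.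
  have := ip_cauchy_sqr x (M ^+ 2 *m x).
  by rewrite {1}M2 ip_trace mulmxA -{1}sM -trmx_mul -sqn_trace.
rewrite expnS !exprM.
apply: le_trans (_ : (sqn x * sqn (M ^+ 2 *m x)) ^+ (2 ^ r) <= _).
  by apply: lerXn2r; rewrite // nnegrE ?mulr_ge0 ?exprn_ge0 ?sqn_ge0.
rewrite exprMn [leRHS]mulrC expr2 [in leRHS]exprMn -mulrA ler_wpM2l ?exprn_ge0 ?sqn_ge0//.
by rewrite mulrC; exact: IH.
Qed.

(** Repeated squaring; one squaring is Cauchy-Schwarz for the vectors $\sqrt w$ and $\sqrt w\,x$. *)
Lemma jensen_pow2 (T : finType) (w x : T -> R) r :
  (forall t, 0 <= w t) -> \sum_t w t = 1 ->
  (\sum_t w t * x t) ^+ (2 ^ r) <= \sum_t w t * x t ^+ (2 ^ r).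
Proof.
move=> w0 w1; elim: r x => [|r IH] x.
  by rewrite expn0 expr1 le_eqVlt; apply/orP; left; apply/eqP/eq_bigr => t _; rewrite expr1.
have h : (\sum_t w t * x t) ^+ 2 <= \sum_t w t * x t ^+ 2.
  have := cauchy_schwarz_sum (fun t => Num.sqrt (w t)) (fun t => Num.sqrt (w t) * x t).
  under eq_bigr => t _ do rewrite mulrA -expr2 sqr_sqrtr//.
  under [X in X * _]eq_bigr => t _ do rewrite sqr_sqrtr//.
  rewrite w1 mul1r.
  by under [X in _ <= X -> _]eq_bigr => t _ do rewrite exprMn sqr_sqrtr//.
rewrite expnS exprM; apply: le_trans (_ : (\sum_t w t * x t ^+ 2) ^+ (2 ^ r) <= _).
  apply: lerXn2r; rewrite // nnegrE ?sqr_ge0// sumr_ge0// => t _.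
  by rewrite mulr_ge0// sqr_ge0.
apply: le_trans (IH _) _.
by apply: ler_sum => t _; rewrite exprM.
Qed.

(* Convexity is only used for the scalars [ip y (M t *m x)], with [y] the image of [x]. *)
Lemma frob_mul_average N k (T : finType) (w : T -> R) (M : T -> 'M[R]_N)
    (x : 'M[R]_(N, k)) r (c : R) :
  (forall t, 0 <= w t) -> \sum_t w t = 1 -> (forall t, (M t)^T = M t) -> 0 <= c ->
  \sum_t w t * sqn (M t ^+ (2 ^ r)) <= (c ^+ 2) ^+ (2 ^ r) ->
  frob ((\sum_t w t *: M t) *m x) <= c * frob x.
Proof.
move=> w0 w1 sM c0 hM; set y := _ *m x.
have yE : sqn y = \sum_t w t * ip y (M t *m x).
  rewrite -ipxx {2}/y mulmx_suml ip_trace mulmx_sumr raddf_sum/=.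
  by apply: eq_bigr => t _; rewrite ip_trace -scalemxAl -scalemxAr mxtraceZ.
have [y0|yn0] := eqVneq (sqn y) 0.
  by rewrite frobE y0 sqrtr0 mulr_ge0// frob_ge0.
have ypos : 0 < sqn y by rewrite lt0r yn0 sqn_ge0.
rewrite frob_le_sqr ?mulr_ge0 ?frob_ge0// exprMn frob_sqr.
rewrite -(@ler_pXn2r _ (2 ^ r)%N) ?nnegrE ?expn_gt0 ?mulr_ge0 ?sqn_ge0 ?sqr_ge0//.
rewrite -(@ler_pM2l _ (sqn y ^+ (2 ^ r))) ?exprn_gt0// -exprD addnn -mul2n -expnS.
rewrite {1}yE; apply: le_trans (jensen_pow2 _ _ w0 w1) _.
apply: le_trans (_ : \sum_t w t * (sqn y ^+ (2 ^ r) *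
    (sqn (M t ^+ (2 ^ r)) * sqn x ^+ (2 ^ r))) <= _).
  apply: ler_sum => t _; apply: ler_wpM2l => //.
  rewrite expnS exprM.
  apply: le_trans (_ : (sqn y * sqn (M t *m x)) ^+ (2 ^ r) <= _).
    apply: lerXn2r; rewrite ?nnegrE ?sqr_ge0 ?mulr_ge0 ?sqn_ge0//.
    exact: ip_cauchy_sqr.
  by rewrite exprMn ler_wpM2l ?exprn_ge0 ?sqn_ge0// sqn_mul_pow2.
rewrite (eq_bigr (fun t => (sqn y ^+ (2 ^ r) * sqn x ^+ (2 ^ r)) *
   (w t * sqn (M t ^+ (2 ^ r))))); last by move=> t _; ring.
rewrite -mulr_sumr exprMn [X in _ <= _ * X]mulrC mulrA ler_wpM2l//.
by rewrite mulr_ge0// exprn_ge0// sqn_ge0.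
Qed.

End PowerNorm.

(** * Finite product probability spaces *)

Section ProductWeight.
Variables (R : realType) (I T : finType) (wt : I -> T -> R).
Hypothesis wt0 : forall e x, 0 <= wt e x.
Hypothesis wt1 : forall e, \sum_x wt e x = 1.

Definition pw (w : {ffun I -> T}) : R := \prod_e wt e (w e).

Lemma pw_ge0 w : 0 <= pw w.
Proof. by apply: prodr_ge0 => e _. Qed.

Lemma sum_pw_prod (f : I -> T -> R) :
  \sum_w pw w * \prod_e f e (w e) = \prod_e \sum_x wt e x * f e x.
Proof.
rewrite bigA_distr_bigA/=; apply: eq_bigr => w _.
by rewrite /pw -big_split.
Qed.

Lemma sum_pw : \sum_w pw w = 1.
Proof.
transitivity (\sum_w pw w * \prod_(e : I) 1).
  by apply: eq_bigr => w _; rewrite big1 ?mulr1.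
rewrite (sum_pw_prod (fun _ _ => 1)) big1// => e _.
by rewrite (eq_bigr (wt e)) => [|x _]; rewrite ?mulr1.
Qed.

Definition mix (A : {set I}) (w w' : {ffun I -> T}) : {ffun I -> T} :=
  [ffun e => if e \in A then w' e else w e].

(** Exchanging the coordinates in [A] between two independent copies is a weight-preserving
    involution. Averaged over all [A] it symmetrises the noise; with [A] the pairs at one node it
    gives the leave-one-out independence. *)
Lemma sum_pw_mix (A : {set I}) (G : {ffun I -> T} -> {ffun I -> T} -> R) :
  \sum_w pw w * \sum_w' pw w' * G (mix A w w') (mix A w' w) =
  \sum_w pw w * \sum_w' pw w' * G w w'.
Proof.
under eq_bigr => w _ do rewrite mulr_sumr.
under [RHS]eq_bigr => w _ do rewrite mulr_sumr.
rewrite !pair_big/=.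
pose f (u : {ffun I -> T} * {ffun I -> T}) := (mix A u.1 u.2, mix A u.2 u.1).
have fK : involutive f.
  move=> [w w']; rewrite /f/=; congr (_, _); apply/ffunP => e; rewrite !ffunE;
  by case: (e \in A).
rewrite [RHS](reindex f)/=; last by apply: onW_bij; exists f.
apply: eq_bigr => -[w w'] _ /=; rewrite !mulrA; congr (_ * _).
rewrite /pw -!big_split/=; apply: eq_bigr => e _.
by rewrite !ffunE; case: ifP => // _; rewrite mulrC.
Qed.

Lemma sum_pw_resample (A : {set I}) (F : {ffun I -> T} -> R) :
  \sum_w pw w * F w = \sum_w pw w * \sum_w' pw w' * F (mix A w w').
Proof.
rewrite (sum_pw_mix A (fun w _ => F w)).
by apply: eq_bigr => w _; rewrite -mulr_suml sum_pw mul1r.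
Qed.

Lemma sum_pw_exp (g : I -> T -> R) (c : I -> R) :
  (forall e, \sum_x wt e x * expR (g e x) <= expR (c e)) ->
  \sum_w pw w * expR (\sum_e g e (w e)) <= expR (\sum_e c e).
Proof.
move=> h; under eq_bigr => w _ do rewrite expR_sum.
rewrite (sum_pw_prod (fun e x => expR (g e x))) expR_sum.
apply: ler_prod => e _; rewrite h andbT.
by apply: sumr_ge0 => x _; rewrite mulr_ge0// expR_ge0.
Qed.

Lemma sum_pw_markov (F : {ffun I -> T} -> R) (c : R) : 0 < c -> (forall w, 0 <= F w) ->
  \sum_w pw w * (c < F w)%R%:R <= (\sum_w pw w * F w) / c.
Proof.
move=> c0 F0; rewrite ler_pdivlMr// mulr_suml; apply: ler_sum => w _.
rewrite -mulrA ler_wpM2l ?pw_ge0//.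
by case: (boolP (c < F w)) => h; rewrite ?mul1r ?mul0r// ltW.
Qed.

End ProductWeight.

Section Exponential.
Variable R : realType.

(** Multiply by $1-x>0$: $e^x(1-x)\le e^xe^{-x}=1\le(1+x+2x^2)(1-x)$. Since it covers all negative
    $x$, the Chernoff bound asks only for an upper bound on the summands. *)
Lemma expR_le_quad (x : R) : x <= 2^-1 -> expR x <= 1 + x + 2 * x ^+ 2.
Proof.
move=> hx; have x1 : 0 < 1 - x by lra.
have h2 : expR x * expR (- x) = 1 by rewrite -expRD subrr expR0.
have := expR_ge1Dx (- x); have := expR_gt0 x.
move=> e0 h1.
have h3 : expR x * (1 - x) <= 1 by rewrite -[leRHS]h2 ler_pM2l.
have h4 : 1 <= (1 + x + 2 * x ^+ 2) * (1 - x).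
  have -> : (1 + x + 2 * x ^+ 2) * (1 - x) = 1 + x ^+ 2 * (1 - 2 * x) by ring.
  by rewrite lerDl mulr_ge0 ?sqr_ge0//; lra.
by rewrite -(ler_pM2r x1); apply: le_trans h3 h4.
Qed.

(** The $m$-th power of $y\le e^y$ at $y=\theta x/m$. It trades moments of degrees for exponential
    moments, which factor over pairs. *)
Lemma power_le_exp (m : nat) (theta x : R) : 0 < theta -> 0 <= x ->
  x ^+ m <= (m%:R / theta) ^+ m * expR (theta * x).
Proof.
move=> t0 x0; case: m => [|m]; first by rewrite !expr0 mul1r -expR0 ler_expR mulr_ge0// ltW.
have m0 : 0 < m.+1%:R :> R by rewrite ltr0n.
have -> : theta * x = m.+1%:R * (theta * x / m.+1%:R) by rewrite mulrCA divff ?mulr1// gt_eqF.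
rewrite expRM_natl -exprMn; apply: lerXn2r; rewrite ?nnegrE//.
  by rewrite mulr_ge0 ?expR_ge0// divr_ge0// ltW.
have : theta * x / m.+1%:R <= expR (theta * x / m.+1%:R).
  by apply: le_trans (expR_ge1Dx _); rewrite lerDr.
move=> h; apply: le_trans (_ : m.+1%:R / theta * (theta * x / m.+1%:R) <= _).
  have -> // : m.+1%:R / theta * (theta * x / m.+1%:R) = x.
  by field; rewrite nat1r !gt_eqF.
by rewrite ler_pM2l// divr_gt0.
Qed.

(** A Chernoff bound of Bernstein type: the variance, not the range, enters the exponent. The
    parameter [theta] stays free and is tuned in the union bound. *)
Lemma sum_pw_tail (I T : finType) (wt : I -> T -> R) (xi : I -> T -> R) (v : I -> R)
    (theta tau : R) :
  (forall e x, 0 <= wt e x) -> (forall e, \sum_x wt e x = 1) ->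
  (forall e, \sum_x wt e x * xi e x = 0) ->
  (forall e, \sum_x wt e x * xi e x ^+ 2 <= v e) ->
  0 < theta -> (forall e x, theta * xi e x <= 2^-1) ->
  \sum_w pw wt w * (tau < \sum_e xi e (w e))%R%:R <=
  expR (2 * theta ^+ 2 * (\sum_e v e) - theta * tau).
Proof.
move=> wt0 wt1 m0 m2 t0 tx.
apply: le_trans (_ : \sum_w pw wt w * (expR (theta * tau) < expR (\sum_e theta * xi e (w e)))%R%:R <= _).
  apply: ler_sum => w _; rewrite ler_wpM2l ?pw_ge0//.
  by rewrite ltr_expR -mulr_sumr ltr_pM2l.
apply: le_trans (sum_pw_markov wt0 (expR_gt0 _) (fun w => expR_ge0 _)) _.
rewrite expRB ler_pM2r ?invr_gt0 ?expR_gt0//.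
apply: le_trans (sum_pw_exp wt0 (g := fun e x => theta * xi e x)
  (c := fun e => 2 * theta ^+ 2 * v e) _) _; last by rewrite mulr_sumr.
move=> e; apply: le_trans (expR_ge1Dx _).
apply: le_trans (_ : \sum_x wt e x * (1 + theta * xi e x + 2 * (theta * xi e x) ^+ 2) <= _).
  by apply: ler_sum => x _; rewrite ler_wpM2l// expR_le_quad.
rewrite (eq_bigr (fun x => wt e x + (theta * (wt e x * xi e x) +
  2 * theta ^+ 2 * (wt e x * xi e x ^+ 2)))); last by move=> x _; ring.
rewrite !big_split/= wt1 -!mulr_sumr m0 mulr0 add0r lerD2l ler_wpM2l//.
by rewrite mulr_ge0// sqr_ge0.
Qed.

End Exponential.

(** * Diagonal sign matrices of determinant one *)

Section SignMatrix.
Variables (R : realType) (d : nat).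
Implicit Types s t : {ffun 'I_d -> bool}.

(* Multiplying cyclically adjacent signs makes the determinant a square. *)
Definition sign_mx s : 'M[R]_d :=
  diag_mx (\row_a ((-1) ^+ s a * (-1) ^+ s (ordS a))).

Lemma sign_mx_SO s : SO R d (sign_mx s).
Proof.
split.
  rewrite /sign_mx tr_diag_mx mulmx_diag; apply/matrixP => i j; rewrite !mxE.
  congr (_ *+ _); rewrite mulrACA -!expr2.
  by rewrite -!exprM ![(_ * 2)%N]mulnC !exprM !sqrrN !expr1n mulr1.
rewrite det_diag; under eq_bigr => i _ do rewrite mxE.
rewrite big_split/= -[X in _ * X](reindex (@ordS d) (P := xpredT) (F := fun a => (-1) ^+ s a)).
  by rewrite -big_split/= big1// => i _; rewrite -expr2 -exprM mulnC exprM sqrrN !expr1n.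
exact/onW_bij/ordS_bij.
Qed.

Lemma sign_mx_mul s t :
  sign_mx [ffun a => s a (+) t a] = sign_mx s *m sign_mx t.
Proof.
rewrite /sign_mx mulmx_diag; congr diag_mx; apply/rowP => a; rewrite !mxE !ffunE.
by rewrite !signr_addb mulrACA.
Qed.

(** Flipping the sign at [i] negates the diagonal entry at [i], because the cyclic neighbour
    [ordS i] differs from [i] once $d\ge2$. *)
Lemma sum_sign_mx : (2 <= d)%N -> \sum_s sign_mx s = 0.
Proof.
move=> d2; apply/matrixP => i j; rewrite summxE mxE.
have [<-|ij] := eqVneq i j; last first.
  by rewrite big1// => s _; rewrite !mxE (negbTE ij) mulr0n.
have Si : ordS i != i.
  rewrite -val_eqE/=; have := ltn_ord i.
  case: d i {j} d2 => // -[|m]// i _ _.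
  have := ltn_ord i; rewrite leq_eqVlt => /orP[/eqP [->]|h]; first by rewrite modnn.
  by rewrite modn_small// gtn_eqF.
set S := \sum_s _; suff : S = - S by move=> h; apply/eqP; move: h; lra.
rewrite {1}/S (reindex (flip_sign i))/=; last first.
  by apply: onW_bij; exists (flip_sign i); exact: flip_signK.
rewrite -sumrN; apply: eq_bigr => s _.
rewrite !mxE !ffunE !eqxx (negbTE Si) !mulr1n.
by case: (s i); rewrite /= ?expr0 ?expr1 ?mulN1r ?mul1r ?opprK.
Qed.

End SignMatrix.

Lemma SO_orth (R : realType) d (Q : 'M[R]_d) : SO R d Q -> Q^T *m Q = 1%:M.
Proof. by case. Qed.

Lemma SO_mul (R : realType) d (A B : 'M[R]_d) : SO R d A -> SO R d B -> SO R d (A *m B).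
Proof.
move=> [A1 A2] [B1 B2]; split; last by rewrite det_mulmx A2 B2 mulr1.
by rewrite trmx_mul mulmxA -(mulmxA _ A^T) A1 mulmx1.
Qed.

Lemma SO_tr (R : realType) d (A : 'M[R]_d) : SO R d A -> SO R d A^T.
Proof. by move=> [A1 A2]; split; rewrite ?det_tr// trmxK mulmx1C. Qed.

Lemma sqn_SO (R : realType) d (Q : 'M[R]_d) : SO R d Q -> sqn Q = d%:R.
Proof. by move=> /SO_orth; exact: sqn_orth. Qed.

(** * The random corruption model with finitely many outcomes *)

(** [option bool] presents the three labels as a finite type, so that configurations can be summed
    over. *)
Definition label_of (o : option bool) : label :=
  match o with Some true => Inlier | Some false => Outlier | None => Missing end.

Section Model.
Variables (R : realType) (n d : nat) (p q : R).
Variable Xs : 'M[R]_(\sum_(i < n) d, d).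
Hypothesis d2 : (2 <= d)%N.
Hypotheses (p01 : 0 < p < 1) (q01 : 0 < q < 1).
Hypothesis SXs : SOn R n d Xs.

Local Notation N := (\sum_(i < n) d)%N.
Local Notation bl := (submxblock (p_ := fun=> d) (q_ := fun=> d)).
Local Notation pair := ('I_n * 'I_n)%type.
(** A label and a sign vector: the signs are the randomness left to an outlier once the array [O] is
    frozen. *)
Definition outcome := (option bool * {ffun 'I_d -> bool})%type.
Local Notation config := {ffun pair -> outcome}.
Implicit Types (O : 'I_n -> 'I_n -> 'M[R]_d) (e : pair) (x : outcome) (w : config).

Let q0 : 0 <= q. Proof. by case/andP: q01 => /ltW. Qed.
Let q1 : q <= 1. Proof. by case/andP: q01 => _ /ltW. Qed.
Let p0 : 0 <= p. Proof. by case/andP: p01 => /ltW. Qed.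
Let p1 : p <= 1. Proof. by case/andP: p01 => _ /ltW. Qed.

Definition label_weight (o : option bool) : R :=
  match o with Some true => p * q | Some false => (1 - p) * q | None => 1 - q end.

(* Pairs [(i, j)] with [j <= i] carry no randomness. *)
Definition outcome_weight e x : R :=
  if (e.1 < e.2)%N then label_weight x.1 / (2 ^ d)%:R
  else (x == (None, [ffun=> false]))%:R.

Let w2d : 0 < (2 ^ d)%:R :> R. Proof. by rewrite ltr0n expn_gt0. Qed.

Lemma label_weight_ge0 o : 0 <= label_weight o.
Proof. by case: o => [[]|] /=; rewrite ?mulr_ge0 ?subr_ge0. Qed.

Lemma outcome_weight_ge0 e x : 0 <= outcome_weight e x.
Proof.
rewrite /outcome_weight; case: ifP => // _.
by rewrite mulr_ge0 ?label_weight_ge0// invr_ge0 ltW.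
Qed.

Lemma sum_option_bool (V : nmodType) (F : option bool -> V) :
  \sum_o F o = F None + F (Some true) + F (Some false).
Proof.
rewrite (bigD1 None)//= -addrA; congr (_ + _).
rewrite (bigD1 (Some true))//= (bigD1 (Some false))//= big1 ?addr0//.
by case=> [[]|].
Qed.

Lemma sum_outcome (V : nmodType) (F : outcome -> V) :
  \sum_x F x = \sum_(s : {ffun 'I_d -> bool}) (F (None, s) + F (Some true, s) + F (Some false, s)).
Proof.
transitivity (\sum_(x : outcome) F (x.1, x.2)); first by apply: eq_bigr => -[].
rewrite -(pair_bigA _ (fun o s => F (o, s)))/= exchange_big/=.
by apply: eq_bigr => s _; rewrite sum_option_bool.
Qed.

Lemma sum_outcome_weight e : \sum_x outcome_weight e x = 1.
Proof.
rewrite /outcome_weight; case: (e.1 < e.2)%N; last first.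
  by rewrite (bigD1 (None, [ffun=> false]))//= eqxx big1 ?addr0// => x /negbTE ->.
rewrite sum_outcome /= sumr_const card_ffun card_bool card_ord -[LHS]mulr_natl.
by field; rewrite gt_eqF.
Qed.

Definition noisy_matrix (l : pair -> option bool) O : 'M[R]_N :=
  rcm_matrix Xs (fun i j => label_of (l (i, j))) O.

Definition twist (s : pair -> {ffun 'I_d -> bool}) O (i j : 'I_n) : 'M[R]_d :=
  sign_mx R (s (i, j)) *m O i j.

Definition config_matrix O w : 'M[R]_N :=
  noisy_matrix (fun e => (w e).1) (twist (fun e => (w e).2) O).

Definition pair_block O e x : 'M[R]_d :=
  match x.1 with
  | None => 0
  | Some true => block Xs e.1 *m (block Xs e.2)^T
  | Some false => sign_mx R x.2 *m O e.1 e.2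
  end.

Definition sig_block (i j : 'I_n) : 'M[R]_d := block Xs i *m (block Xs j)^T.

Lemma config_block O w i j : bl (config_matrix O w) i j =
  if (i < j)%N then pair_block O (i, j) (w (i, j))
  else if (j < i)%N then (pair_block O (j, i) (w (j, i)))^T else 0.
Proof.
rewrite /config_matrix /noisy_matrix /rcm_matrix mxblockK /observation /pair_block /twist /=.
by case: ifP => _; [|case: ifP => _ //]; case: (w _) => [[[]|]].
Qed.

Definition observed x : R := (x.1 != None)%:R.

Lemma sig_block_SO i j : SO R d (sig_block i j).
Proof. by apply: SO_mul; [|apply: SO_tr]; exact: SXs. Qed.

Lemma sig_block_diag i : sig_block i i = 1%:M.
Proof. by apply: mulmx1C; case: (SXs i). Qed.

Lemma sqn_pair_block O e x : (forall i j, SO R d (O i j)) ->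
  sqn (pair_block O e x) = d%:R * observed x.
Proof.
move=> SO_O; rewrite /pair_block /observed; case: x => [[[]|] s] /=.
- by rewrite mulr1 (sqn_SO (sig_block_SO e.1 e.2)).
- by rewrite mulr1 sqn_SO//; apply: SO_mul; [exact: sign_mx_SO|].
- by rewrite mulr0 -frob_sqr frob0 expr0n.
Qed.

Lemma mean_observed e : (e.1 < e.2)%N -> \sum_x outcome_weight e x * observed x = q.
Proof.
move=> he; rewrite sum_outcome /outcome_weight /observed he/= sumr_const.
by rewrite card_ffun card_bool card_ord -[LHS]mulr_natl; field; rewrite gt_eqF.
Qed.

(** For every fixed array [O] the signs alone average the outliers to zero, so the mean is the one
    that Haar measure would give. *)
Lemma mean_pair_block O e : (e.1 < e.2)%N ->
  \sum_x outcome_weight e x *: pair_block O e x = (p * q) *: sig_block e.1 e.2.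
Proof.
move=> he; rewrite sum_outcome /outcome_weight /pair_block he/=.
rewrite !big_split/=; under [X in _ + X]eq_bigr => s _ do rewrite scalemxAl.
have h c : \sum_s c *: sign_mx R s = 0 :> 'M[R]_d by rewrite -scaler_sumr sum_sign_mx// scaler0.
rewrite -mulmx_suml h mul0mx addr0.
rewrite big1 ?add0r; last by move=> s _; rewrite scaler0.
rewrite sumr_const card_ffun card_bool card_ord -scaler_nat scalerA.
by congr (_ *: _); field; rewrite gt_eqF.
Qed.

End Model.

(** * Pairs meeting a given node *)

Section Incidence.
Variable n : nat.
Implicit Types (i j : 'I_n) (e : 'I_n * 'I_n).

Definition incident i e := (e.1 < e.2)%N && ((e.1 == i) || (e.2 == i)).
Definition other_end i e := if e.1 == i then e.2 else e.1.

Lemma sum_incident (V : nmodType) i (F : 'I_n * 'I_n -> V) :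
  \sum_(e | incident i e) F e = \sum_(j | j != i) F (if (i < j)%N then (i, j) else (j, i)).
Proof.
rewrite (reindex_onto (fun j => if (i < j)%N then (i, j) else (j, i)) (other_end i)).
  apply: eq_bigl => j; rewrite /incident /other_end.
  have [ij|ji|/val_inj ->] := ltngtP i j; rewrite /= ?eqxx ?orbT ?andbT /=.
  - by rewrite ij; apply/esym; rewrite -val_eqE/= gtn_eqF.
  - by rewrite ji; have /negbTE -> /= : j != i; [rewrite -val_eqE/= ltn_eqF | rewrite eqxx].
  - by rewrite ltnn.
move=> -[a b]; rewrite /incident /other_end /= => /andP[ab /orP[/eqP <-|/eqP <-]].
  by rewrite eqxx ab.
have /negbTE -> : a != b by rewrite -val_eqE/= ltn_eqF.
by rewrite ltnNge (ltnW ab).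
Qed.

Lemma sum_incident_const (R : realType) i (c : R) : 0 <= c ->
  \sum_(e | incident i e) c <= n%:R * c.
Proof.
move=> c0; rewrite sum_incident.
apply: le_trans (_ : \sum_(j < n) c <= _); last by rewrite sumr_const card_ord mulr_natl.
by rewrite [leRHS](bigD1 i)//= lerDr.
Qed.

Lemma sum_ends (V : nmodType) e (f : 'I_n -> V) : (e.1 < e.2)%N ->
  \sum_(i | incident i e) f i = f e.1 + f e.2.
Proof.
move=> he; have ne : e.2 != e.1 by rewrite -val_eqE/= gtn_eqF.
rewrite (bigD1 e.1) /incident ?he ?eqxx//=; congr (_ + _).
rewrite (bigD1 e.2) ?he ?eqxx ?orbT//= big1 ?addr0// => i.
by case/andP=> /andP[/orP[]/eqP ->]; rewrite ?eqxx.
Qed.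

End Incidence.

(** * Centred noise and concentration of its rows *)

Section Centering.
Variables (R : realType) (n d : nat) (p q : R).
Variable Xs : 'M[R]_(\sum_(i < n) d, d).
Hypothesis d2 : (2 <= d)%N.
Hypotheses (p01 : 0 < p < 1) (q01 : 0 < q < 1).
Hypothesis SXs : SOn R n d Xs.

Local Notation N := (\sum_(i < n) d)%N.
Local Notation bl := (submxblock (p_ := fun=> d) (q_ := fun=> d)).
Local Notation cb := (submxcol (p_ := fun=> d)).
Local Notation pair := ('I_n * 'I_n)%type.
Local Notation outcome := (outcome d).
Local Notation config := {ffun pair -> outcome}.
Local Notation wgt := (@outcome_weight R n d p q).
Implicit Types (O : 'I_n -> 'I_n -> 'M[R]_d) (e : pair) (x : outcome) (w : config).

Let wgt0 e x : 0 <= wgt e x. Proof. exact: outcome_weight_ge0. Qed.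
Let wgt1 e : \sum_x wgt e x = 1. Proof. exact: sum_outcome_weight. Qed.
Let q0 : 0 <= q. Proof. by case/andP: q01 => /ltW. Qed.
Let q1 : q <= 1. Proof. by case/andP: q01 => _ /ltW. Qed.
Let p0 : 0 <= p. Proof. by case/andP: p01 => /ltW. Qed.
Let p1 : p <= 1. Proof. by case/andP: p01 => _ /ltW. Qed.

Lemma outer_block i j : bl (Xs *m Xs^T) i j = sig_block Xs i j.
Proof.
rewrite /sig_block /block submxblockEh -mul_submxrow -submxcol_mul.
by rewrite tr_submxcol.
Qed.

Lemma scalar_block i j : bl (1%:M : 'M[R]_N) i j = if i == j then 1%:M else 0.
Proof.
rewrite -(@mxdiagZ _ n (fun=> d) 1) /mxdiag mxblockK.
by rewrite conform_mx_id.
Qed.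

(* [Y + p q I = p q X X^T + noise_matrix Y], where [noise_matrix Y] has mean zero and vanishing
   diagonal blocks. *)
Definition noise_matrix (Y : 'M[R]_N) : 'M[R]_N := Y - (p * q) *: (Xs *m Xs^T - 1%:M).

Definition centered_block O e x : 'M[R]_d :=
  pair_block Xs O e x - (p * q) *: sig_block Xs e.1 e.2.

Lemma noise_config_block O w i j : bl (noise_matrix (config_matrix Xs O w)) i j =
  if (i < j)%N then centered_block O (i, j) (w (i, j))
  else if (j < i)%N then (centered_block O (j, i) (w (j, i)))^T else 0.
Proof.
rewrite /noise_matrix submxblockB config_block.
have -> : bl ((p * q) *: (Xs *m Xs^T - 1%:M)) i j =
    (p * q) *: (sig_block Xs i j - if i == j then 1%:M else 0).
  by rewrite -outer_block -scalar_block; apply/matrixP => a b; rewrite !mxE.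
rewrite /centered_block /=.
have [ij|ji|/val_inj ->] := ltngtP i j.
- by rewrite -val_eqE/= ltn_eqF// subr0.
- rewrite -val_eqE/= gtn_eqF// subr0 [in RHS]raddfB/= [(_ *: _)^T]linearZ/=.
  by rewrite /sig_block trmx_mul trmxK.
- by rewrite eqxx sig_block_diag// subrr scaler0 subr0.
Qed.

Lemma mean_centered_block O e : (e.1 < e.2)%N ->
  \sum_x wgt e x *: centered_block O e x = 0.
Proof.
move=> he; under eq_bigr => x _ do rewrite scalerBr.
by rewrite sumrB mean_pair_block// -scaler_suml wgt1 scale1r subrr.
Qed.

Section Orthogonal.
Variable O : 'I_n -> 'I_n -> 'M[R]_d.
Hypothesis SO_O : forall i j, SO R d (O i j).

Lemma frob_pair_block e x : frob (pair_block Xs O e x) <= Num.sqrt d%:R.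
Proof.
rewrite frobE sqn_pair_block// ler_sqrt// /observed.
by case: (_ != _); rewrite ?mulr1 ?mulr0.
Qed.

Lemma frob_signal e : frob ((p * q) *: sig_block Xs e.1 e.2) <= Num.sqrt d%:R.
Proof.
rewrite frobZ frobE (sqn_SO (sig_block_SO SXs _ _)) ger0_norm ?mulr_ge0//.
by rewrite ler_piMl// mulr_ile1.
Qed.

Lemma frob_centered_block e x : frob (centered_block O e x) <= 2 * Num.sqrt d%:R.
Proof.
apply: le_trans (frobB _ _) _.
have := frob_pair_block e x; have := frob_signal e; lra.
Qed.

(** Keeping the indicator [observed] makes the variance of order $q$ instead of constant order; the
    subtracted signal contributes $(pq)^2d\le qd$. *)
Lemma sqn_centered_block e x :
  sqn (centered_block O e x) <= 2 * d%:R * observed R x + 2 * q * d%:R.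
Proof.
rewrite -frob_sqr; apply: le_trans (_ : (frob (pair_block Xs O e x) +
    frob ((p * q) *: sig_block Xs e.1 e.2)) ^+ 2 <= _).
  by rewrite ler_sqr ?nnegrE ?addr_ge0 ?frob_ge0// frobB.
set a := frob _; set b := frob _.
have ha : a ^+ 2 = d%:R * observed R x by rewrite frob_sqr sqn_pair_block.
have hb : b ^+ 2 <= q * d%:R.
  rewrite frob_sqr -frob_sqr frobZ exprMn real_normK ?num_real// frob_sqr.
  rewrite (sqn_SO (sig_block_SO SXs _ _)) ler_wpM2r// exprMn.
  apply: le_trans (_ : 1 * q <= _); last by rewrite mul1r.
  by apply: ler_pM; rewrite ?sqr_ge0// ?expr_le1// expr2 ler_piMl.
have := sqr_ge0 (a - b); nra.
Qed.

Lemma mean_sqn_centered_block e : (e.1 < e.2)%N ->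
  \sum_x wgt e x * sqn (centered_block O e x) <= 4 * q * d%:R.
Proof.
move=> he; apply: le_trans (_ : \sum_x wgt e x * (2 * d%:R * observed R x + 2 * q * d%:R) <= _).
  by apply: ler_sum => x _; rewrite ler_wpM2l// sqn_centered_block.
under eq_bigr => x _ do rewrite mulrDr mulrCA.
rewrite big_split/= -mulr_sumr mean_observed// -mulr_suml wgt1.
by have : 0 <= d%:R :> R by []; nra.
Qed.

Section Row.
Variables (v : 'M[R]_(N, d)) (i : 'I_n) (a b : 'I_d).

Definition row_term e x : 'M[R]_d :=
  (if e.1 == i then centered_block O e x else (centered_block O e x)^T)
    *m cb v (other_end i e).

Lemma row_sum w : cb (noise_matrix (config_matrix Xs O w) *m v) i =
  \sum_(e | incident i e) row_term e (w e).
Proof.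
rewrite submxcol_mulmx sum_incident (bigD1 i)//= noise_config_block ltnn mul0mx add0r.
apply: eq_bigr => j ji; rewrite noise_config_block /row_term /other_end.
have [ij|ji'|/val_inj ijE] := ltngtP i j; rewrite ?eqxx//=.
- by rewrite (negbTE ji).
- by rewrite ijE eqxx in ji.
Qed.

Lemma row_term_entry e x M : 0 <= M -> (forall j, frob (cb v j) <= M) ->
  (row_term e x a b) ^+ 2 <= sqn (centered_block O e x) * M ^+ 2.
Proof.
move=> M0 hM; apply: le_trans (_ : sqn (row_term e x) <= _).
  by rewrite -frob_sqr -real_normK ?num_real// ler_sqr ?nnegrE ?frob_ge0// le_entry_frob.
apply: le_trans (sqnM _ _) _; apply: ler_pM; rewrite ?sqn_ge0//.
  by case: ifP; rewrite // sqn_tr.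
by rewrite -frob_le_sqr.
Qed.

(** An entry of block $i$ of $Wv$ is a sum of independent centred terms over the pairs at $i$, each
    of variance at most $4qdM^2$. Extending the terms by zero to all pairs puts it in the form of
    [sum_pw_tail]. *)
Lemma row_tail M theta tau : 0 < M -> (forall j, frob (cb v j) <= M) ->
  0 < theta -> theta * (2 * Num.sqrt d%:R * M) <= 2^-1 ->
  \sum_w pw wgt w * (tau < (cb (noise_matrix (config_matrix Xs O w) *m v) i) a b)%R%:R <=
  expR (2 * theta ^+ 2 * (n%:R * (4 * q * d%:R * M ^+ 2)) - theta * tau).
Proof.
move=> M0 hM t0 ht.
pose xi e x := if incident i e then row_term e x a b else 0.
have -> : \sum_w pw wgt w * (tau < (cb (noise_matrix (config_matrix Xs O w) *m v) i) a b)%R%:R =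
    \sum_w pw wgt w * (tau < \sum_e xi e (w e))%R%:R.
  by apply: eq_bigr => w _; rewrite row_sum summxE big_mkcond.
pose c e := if incident i e then 4 * q * d%:R * M ^+ 2 else 0.
have c0 : 0 <= 4 * q * d%:R * M ^+ 2 by rewrite mulr_ge0 ?sqr_ge0 ?mulr_ge0.
apply: le_trans (sum_pw_tail (wt := wgt) (xi := xi) (v := c) tau wgt0 wgt1 _ _ t0 _) _.
- move=> e; rewrite /xi; have [he|_] := boolP (incident i e); last first.
    by rewrite big1// => x _; rewrite mulr0.
  have /andP[le _] := he.
  transitivity ((\sum_x wgt e x *: row_term e x) a b).
    by rewrite summxE; apply: eq_bigr => x _; rewrite [RHS]mxE.
  rewrite /row_term; under eq_bigr => x _ do rewrite scalemxAl.
  rewrite -mulmx_suml; case: (e.1 == i); first by rewrite mean_centered_block// mul0mx mxE.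
  under eq_bigr => x _ do rewrite -linearZ/=.
  by rewrite -raddf_sum/= mean_centered_block// raddf0 mul0mx mxE.
- move=> e; rewrite /xi /c; have [he|_] := boolP (incident i e); last first.
    by rewrite big1// => x _; rewrite expr0n mulr0.
  have /andP[le _] := he.
  apply: le_trans (_ : \sum_x wgt e x * (sqn (centered_block O e x) * M ^+ 2) <= _).
    by apply: ler_sum => x _; rewrite ler_wpM2l// row_term_entry// ltW.
  under eq_bigr => x _ do rewrite mulrA.
  by rewrite -mulr_suml ler_wpM2r ?sqr_ge0// mean_sqn_centered_block.
- move=> e x; rewrite /xi; case: ifP => _; last by rewrite mulr0.
  apply: le_trans ht; rewrite ler_pM2l//.
  have D0 : 0 <= 2 * Num.sqrt d%:R * M by rewrite !mulr_ge0// ltW.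
  apply: le_trans (ler_norm _) _.
  rewrite -ler_sqr ?nnegrE// real_normK ?num_real//.
  apply: le_trans (row_term_entry _ _ (ltW M0) hM) _.
  rewrite exprMn ler_wpM2r ?sqr_ge0// -frob_le_sqr ?mulr_ge0//.
  exact: frob_centered_block.
rewrite ler_expR lerD2r ler_wpM2l//; first by rewrite mulr_ge0// sqr_ge0.
by rewrite /c -big_mkcond; exact: sum_incident_const.
Qed.

End Row.

(* Thresholding against the largest block of [v] makes the bound scale free. *)
Lemma row_tail_max (v : 'M[R]_(N, d)) i a b s tau : 0 < s -> 0 <= tau ->
  s * (2 * Num.sqrt d%:R) <= 2^-1 ->
  \sum_w pw wgt w * [forall j, tau ^+ 2 * sqn (cb v j) <
     ((cb (noise_matrix (config_matrix Xs O w) *m v) i) a b) ^+ 2]%:R <=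
  2 * expR (8 * n%:R * q * d%:R * s ^+ 2 - s * tau).
Proof.
move=> s0 tau0 hs.
pose m := [arg max_(j > i) frob (cb v j)]%O.
have hm j : frob (cb v j) <= frob (cb v m) by rewrite /m; case: arg_maxP => // k _ h; exact: h.
(* If all blocks of [v] vanish, the event demands $0<0$ and is empty; otherwise the largest block is
   a positive scale. *)
have [m0|mn0] := eqVneq (frob (cb v m)) 0.
  rewrite big1 ?mulr_ge0 ?expR_ge0// => w _.
  case: forallP => [/(_ m)|_]; last by rewrite mulr0.
  have v0 : v = 0.
    apply/mxcolP => j; rewrite submxcol0; apply: frob_eq0; apply/eqP.
    by rewrite eq_le frob_ge0 andbT -m0 hm.
  by rewrite {2}v0 mulmx0 submxcol0 mxE -frob_sqr m0 expr0n mulr0 ltxx.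
set M := frob (cb v m) in mn0 hm.
have M0 : 0 < M by rewrite lt0r mn0 frob_ge0.
(* The one-sided tail is used for [v] and for [- v], whence the factor 2; dividing the parameter by
   [M] removes the scale. *)
have bound (v' : 'M[R]_(N, d)) : (forall j, frob (cb v' j) <= M) ->
  \sum_w pw wgt w * (tau * M < (cb (noise_matrix (config_matrix Xs O w) *m v') i) a b)%R%:R <=
  expR (8 * n%:R * q * d%:R * s ^+ 2 - s * tau).
  move=> hM; apply: le_trans (row_tail i a b (theta := s / M) _ M0 hM _ _) _.
  - exact: divr_gt0.
  - by rewrite (_ : s / M * _ = s * (2 * Num.sqrt d%:R))//; field.
  - rewrite ler_expR le_eqVlt; apply/orP; left; apply/eqP; field.
    by [].
have hN j : frob (cb (- v) j) <= M by rewrite submxcolN frobN.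
rewrite mulr_natl mulr2n; apply: le_trans (lerD (bound v hm) (bound (- v) hN)).
rewrite -big_split/=; apply: ler_sum => w _; rewrite -mulrDr ler_wpM2l ?pw_ge0//.
case: forallP => [/(_ m) h|_]; last by rewrite addr_ge0.
set y := (cb _ i) a b in h *.
have -> : (cb (noise_matrix (config_matrix Xs O w) *m - v) i) a b = - y.
  by rewrite mulmxN submxcolN mxE.
have : tau * M < `|y|.
  rewrite -ltr_sqr ?nnegrE ?mulr_ge0 ?frob_ge0// real_normK ?num_real//.
  by rewrite exprMn frob_sqr.
by case: ger0P => _ ->; rewrite ?lerDl ?lerDr.
Qed.

End Orthogonal.
End Centering.

Lemma bigmax_exp_le (R : realType) (I : finType) (f : I -> R) m : (0 < m)%N ->
  (forall i, 0 <= f i) -> (\big[Num.max/0]_i f i) ^+ m <= \sum_i f i ^+ m.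
Proof.
move=> m0 f0.
have : 0 <= \big[Num.max/0]_i f i /\ (\big[Num.max/0]_i f i) ^+ m <= \sum_i f i ^+ m.
  elim/big_rec2: _ => [|i y1 y2 _ [y2_0 IH]]; first by rewrite expr0n gtn_eqF.
  split; first by rewrite le_max f0.
  have [_|_] := leP (f i) y2; last first.
    by rewrite lerDl; apply: le_trans IH; rewrite exprn_ge0.
  by apply: le_trans IH _; rewrite lerDr exprn_ge0.
by case.
Qed.

Lemma sqnB_le (R : realType) m k (A B : 'M[R]_(m, k)) :
  sqn (A - B) <= 2 * (sqn A + sqn B).
Proof.
rewrite -!frob_sqr; have := frobB A B.
have := frob_ge0 A; have := frob_ge0 B; have := frob_ge0 (A - B).
set a := frob A; set b := frob B; set c := frob (A - B) => c0 b0 a0 h.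
have := sqr_ge0 (a - b); nra.
Qed.

(** * Power iterates with one node removed *)

Section LeaveOneOut.
Variables (R : realType) (n d : nat) (Xs : 'M[R]_(\sum_(i < n) d, d)).
Local Notation bl := (submxblock (p_ := fun=> d) (q_ := fun=> d)).

Definition drop_node (i : 'I_n) (W : 'M[R]_(\sum_(i < n) d)) : 'M[R]_(\sum_(i < n) d) :=
  \mxblock_(j < n, k < n) (if (j == i) || (k == i) then 0 else bl W j k).

Definition power_iterate k (W : 'M[R]_(\sum_(i < n) d)) :=
  iter k (mulmx W) Xs.

Definition loo_iterate i k (W : 'M[R]_(\sum_(i < n) d)) :=
  power_iterate k (drop_node i W).

End LeaveOneOut.

(** * Rows and moments of the noise on the space of configurations *)

Section FiniteBounds.
Variables (R : realType) (n d : nat) (p q : R).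
Variable Xs : 'M[R]_(\sum_(i < n) d, d).
Hypothesis d2 : (2 <= d)%N.
Hypotheses (p01 : 0 < p < 1) (q01 : 0 < q < 1).
Hypothesis SXs : SOn R n d Xs.
Variable O : 'I_n -> 'I_n -> 'M[R]_d.
Hypothesis SO_O : forall i j, SO R d (O i j).

Local Notation N := (\sum_(i < n) d)%N.
Local Notation cb := (submxcol (p_ := fun=> d)).
Local Notation pair := ('I_n * 'I_n)%type.
Local Notation outcome := (outcome d).
Local Notation config := {ffun pair -> outcome}.
Local Notation wgt := (@outcome_weight R n d p q).
Local Notation noise w := (noise_matrix p q Xs (config_matrix Xs O w)).
Implicit Types (e : pair) (x : outcome) (w : config).

Let wgt0 e x : 0 <= wgt e x. Proof. exact: outcome_weight_ge0. Qed.
Let wgt1 e : \sum_x wgt e x = 1. Proof. exact: sum_outcome_weight. Qed.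
Let q0 : 0 <= q. Proof. by case/andP: q01 => /ltW. Qed.

Let row_set i : {set pair} := [set e | incident i e].

Lemma drop_node_resample i w w' :
  drop_node i (noise (mix (row_set i) w w')) = drop_node i (noise w).
Proof.
apply/eq_mxblockP => j l; rewrite !noise_config_block// !ffunE !inE /incident/=.
by case: (j == i); case: (l == i); rewrite ?andbF.
Qed.

Lemma loo_iterate_resample i k w w' :
  loo_iterate Xs i k (noise (mix (row_set i) w w')) = loo_iterate Xs i k (noise w).
Proof. by rewrite /loo_iterate drop_node_resample. Qed.

Lemma row_resample i (v : 'M[R]_(N, d)) w w' :
  cb (noise (mix (row_set i) w w') *m v) i = cb (noise w' *m v) i.
Proof.
rewrite !submxcol_mulmx; apply: eq_bigr => j _.
rewrite !noise_config_block// !ffunE !inE /incident/= eqxx.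
by have [|//|//] := ltngtP i j; rewrite ?orbT.
Qed.

(** Resampling the pairs at [i] redraws row [i] and leaves [loo_iterate] unchanged. For each frozen
    [w] the iterate is then a fixed vector, and [row_tail_max] applies to the new row. *)
Lemma row_event_bound i k a b s tau : 0 < s -> 0 <= tau ->
  s * (2 * Num.sqrt d%:R) <= 2^-1 ->
  \sum_w pw wgt w * [forall j, tau ^+ 2 * sqn (cb (loo_iterate Xs i k (noise w)) j) <
     ((cb (noise w *m loo_iterate Xs i k (noise w)) i) a b) ^+ 2]%:R <=
  2 * expR (8 * n%:R * q * d%:R * s ^+ 2 - s * tau).
Proof.
move=> s0 tau0 hs; rewrite (sum_pw_resample wgt1 (row_set i)).
set B := 2 * _.
apply: le_trans (_ : \sum_w pw wgt w * B <= _); last by rewrite -mulr_suml sum_pw// mul1r.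
apply: ler_sum => w _; rewrite ler_wpM2l ?pw_ge0//.
under eq_bigr => w' _ do rewrite loo_iterate_resample row_resample.
exact: row_tail_max.
Qed.

Definition pair_mx e (Z : 'M[R]_d) : 'M[R]_N :=
  \mxblock_(i < n, j < n) (if (i, j) == e then Z else if (j, i) == e then Z^T else 0).

Lemma pair_mx_sym e Z : (e.1 < e.2)%N -> (pair_mx e Z)^T = pair_mx e Z.
Proof.
case: e => a b /= ab; rewrite tr_mxblock; apply/eq_mxblockP => i j.
rewrite !xpair_eqE; have [->|ia] := eqVneq i a; have [->|jb] := eqVneq j b; rewrite ?andbF ?andbT /=.
- by rewrite -val_eqE/= (gtn_eqF ab)/= ?andbF trmxK.
- by case: ifP => [/andP[_ /eqP aE]|_]; [rewrite aE ltnn in ab | rewrite trmx0].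
- by case: ifP => [/andP[/eqP aE _]|_]; [rewrite aE ltnn in ab | rewrite trmx0].
- by case: ifP => _; rewrite ?trmxK ?trmx0//; case: ifP; rewrite ?trmx0.
Qed.

Lemma pair_mx_block e Z k (V : 'M[R]_(N, k)) i : (e.1 < e.2)%N ->
  cb (pair_mx e Z *m V) i =
  if i == e.1 then Z *m cb V e.2 else if i == e.2 then Z^T *m cb V e.1 else 0.
Proof.
case: e => a b /= ab; have ba : b != a by rewrite -val_eqE/= gtn_eqF.
rewrite submxcol_mulmx; under eq_bigr => j _ do rewrite mxblockK !xpair_eqE.
have [->|ia] := eqVneq i a.
  rewrite (bigD1 b)//= eqxx big1 ?addr0// => j /negbTE jb.
  by rewrite jb/= (eq_sym a) (negbTE ba) andbF mul0mx.
have [_|ib] := eqVneq i b.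
  rewrite (bigD1 a)//= eqxx big1 ?addr0// => j /negbTE ja.
  by rewrite ja mul0mx.
by rewrite big1// => j _; rewrite andbF mul0mx.
Qed.

Lemma sqn_pair_mx e Z k (V : 'M[R]_(N, k)) : (e.1 < e.2)%N ->
  sqn (pair_mx e Z *m V) <= \sum_(i | incident i e) sqn Z * sqn (cb V i).
Proof.
move=> he; have ba : e.2 != e.1 by rewrite -val_eqE/= gtn_eqF.
rewrite sum_ends// sqn_blocks; under eq_bigr => i _ do rewrite pair_mx_block//.
rewrite (bigD1 e.1)//= eqxx (bigD1 e.2)//= (negbTE ba) eqxx big1 ?addr0; last first.
  by move=> i /andP[/negbTE -> /negbTE ->]; rewrite -frob_sqr frob0 expr0n.
rewrite addrC; apply: lerD; last exact: sqnM.
by rewrite -(sqn_tr Z); exact: sqnM.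
Qed.

Definition degree i w : R := \sum_(e | incident i e) observed R (w e).

Lemma degree_ge0 i w : 0 <= degree i w.
Proof. by apply: sumr_ge0. Qed.

Let diff_block w w' e : 'M[R]_d :=
  if (e.1 < e.2)%N then pair_block Xs O e (w e) - pair_block Xs O e (w' e) else 0.

Let diff w w' := config_matrix Xs O w - config_matrix Xs O w'.

Let pmx0 e : pair_mx e 0 = 0.
Proof.
rewrite -(mxblock0 (p_ := fun=> d) (q_ := fun=> d)); apply/eq_mxblockP => i j.
by case: ifP => //; case: ifP; rewrite ?trmx0.
Qed.

Let diff_pair w w' : diff w w' = \sum_e pair_mx e (diff_block w w' e).
Proof.
apply/mxblockP => i j; rewrite submxblock_sum /diff submxblockB !config_block.
under eq_bigr => e _ do rewrite mxblockK.
have [ij|ji|/val_inj ->] := ltngtP i j.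
- rewrite (bigD1 (i, j))//= eqxx big1 ?addr0 /diff_block/= ?ij// => e /negbTE.
  rewrite eq_sym => ->; case: ifP => // /eqP <- /=.
  by rewrite ltnNge (ltnW ij)/= trmx0.
- rewrite (bigD1 (j, i))//= eqxx big1 ?addr0 /diff_block/=.
    by rewrite xpair_eqE -val_eqE/= gtn_eqF//= ji linearB.
  move=> e /negbTE ej; rewrite [(j, i) == e]eq_sym ej; case: ifP => // /eqP <- /=.
  by rewrite ltnNge (ltnW ji)/=.
- rewrite subr0 big1// => e _; rewrite /diff_block; case: ifP => [/eqP <-|_].
    by rewrite ltnn.
  by case: ifP => // /eqP <-; rewrite ltnn trmx0.
Qed.

(** Swapping the outcome of a pair between the two copies negates exactly the block of that pair in
    their difference. *)
Let diff_mix (s : {ffun pair -> bool}) w w' :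
  diff (mix [set e | s e] w w') (mix [set e | s e] w' w) =
  rademacher_sum (fun e => pair_mx e (diff_block w w' e)) s.
Proof.
rewrite diff_pair /rademacher_sum; apply: eq_bigr => e _; rewrite /diff_block !ffunE inE.
case: (s e); rewrite /= ?expr0 ?expr1 ?scale1r//.
rewrite scaleN1r; case: (e.1 < e.2)%N; last by rewrite pmx0 oppr0.
rewrite -mxblockN; apply/eq_mxblockP => i j.
case: ifP => _; first by rewrite opprB.
by case: ifP => _; rewrite ?oppr0// -raddfN opprB.
Qed.

Definition max_degree w w' : R := \big[Num.max/0]_i (degree i w + degree i w').

(** A pair acts on two blocks of [V] only. Collecting by block, the pairs at $i$ contribute $2d$
    times the sum of the two degrees of $i$. *)
Let diff_variance w w' (V : 'M[R]_N) :
  \sum_e sqn (pair_mx e (diff_block w w' e) *m V) <= 2 * d%:R * max_degree w w' * sqn V.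
Proof.
apply: le_trans (_ : \sum_e \sum_(i | incident i e)
    2 * d%:R * (observed R (w e) + observed R (w' e)) * sqn (cb V i) <= _).
  apply: ler_sum => e _; rewrite /diff_block; case: ifP => he; last first.
    rewrite pmx0 mul0mx -frob_sqr frob0 expr0n/=; apply: sumr_ge0 => i _.
    by rewrite !mulr_ge0 ?addr_ge0 ?sqn_ge0.
  apply: le_trans (sqn_pair_mx _ _ he) _; apply: ler_sum => i _.
  rewrite ler_wpM2r ?sqn_ge0//; apply: le_trans (sqnB_le _ _) _.
  by rewrite !sqn_pair_block// -mulrDr mulrA.
rewrite (exchange_big_dep xpredT)//= [leRHS]mulrC (sqn_blocks V) mulr_suml; apply: ler_sum => i _.
rewrite -mulr_suml [leLHS]mulrC ler_wpM2l ?sqn_ge0//.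
rewrite -mulr_sumr ler_wpM2l ?mulr_ge0//.
rewrite big_split/=; exact: le_bigmax.
Qed.

(** For $\theta\le1/2$, $e^\theta\le1+2\theta$, so each pair at the node contributes a factor of at
    most $1+2\theta q\le e^{2\theta q}$. *)
Lemma degree_mgf i theta : 0 <= theta <= 2^-1 ->
  \sum_w pw wgt w * expR (theta * degree i w) <= expR (2 * theta * q * n%:R).
Proof.
move=> /andP[t0 t1].
pose g e x := if incident i e then theta * observed R x else 0.
pose c e : R := if incident i e then 2 * theta * q else 0.
have tq : 0 <= 2 * theta * q by rewrite !mulr_ge0.
apply: le_trans (_ : expR (\sum_e c e) <= _); last first.
  by rewrite ler_expR [leRHS]mulrC /c -big_mkcond sum_incident_const.
under eq_bigr => w _ do rewrite /degree mulr_sumr big_mkcond.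
apply: (sum_pw_exp wgt0 (g := g)) => e; rewrite /g /c.
have [he|_] := boolP (incident i e); last first.
  by under eq_bigr => x _ do rewrite expR0 mulr1; rewrite wgt1 expR0.
have /andP[le _] := he.
apply: le_trans (expR_ge1Dx _).
apply: le_trans (_ : \sum_x wgt e x * (1 + 2 * theta * observed R x) <= _).
  apply: ler_sum => x _; rewrite ler_wpM2l// /observed; case: (x.1 != None).
    by rewrite !mulr1; apply: le_trans (expR_le_quad t1) _; nra.
  by rewrite !mulr0 expR0 addr0.
under eq_bigr => x _ do rewrite mulrDr mulr1 mulrCA.
by rewrite big_split/= wgt1 -mulr_sumr mean_observed.
Qed.

(** Replacing the maximum by a sum over nodes costs a factor $n$, harmless when $m$ is of order
    $\log n$. Two independent copies square the exponential moment, which doubles the 2 of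
    [degree_mgf] to 4. *)
Lemma max_degree_moment m theta : (0 < m)%N -> 0 < theta <= 2^-1 ->
  \sum_w pw wgt w * \sum_w' pw wgt w' * max_degree w w' ^+ m <=
  n%:R * ((m%:R / theta) ^+ m * expR (4 * theta * q * n%:R)).
Proof.
move=> m0 /andP[t0 t1].
have K0 : 0 <= (m%:R / theta) ^+ m by rewrite exprn_ge0// divr_ge0// ltW.
apply: le_trans (_ : \sum_i \sum_w pw wgt w * \sum_w' pw wgt w' *
   ((m%:R / theta) ^+ m * (expR (theta * degree i w) * expR (theta * degree i w'))) <= _).
  rewrite exchange_big/=; apply: ler_sum => w _.
  rewrite -mulr_sumr ler_wpM2l ?pw_ge0// exchange_big/=; apply: ler_sum => w' _.
  rewrite -mulr_sumr ler_wpM2l ?pw_ge0//.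
  apply: le_trans (bigmax_exp_le m0 _) _; first by move=> i; rewrite addr_ge0 ?degree_ge0.
  apply: ler_sum => i _; rewrite -expRD -mulrDr.
  by apply: power_le_exp; rewrite ?addr_ge0 ?degree_ge0.
apply: le_trans (_ : \sum_(i < n) (m%:R / theta) ^+ m * expR (4 * theta * q * n%:R) <= _); last first.
  by rewrite sumr_const card_ord -[leLHS]mulr_natl.
apply: ler_sum => i _.
set E := \sum_w pw wgt w * expR (theta * degree i w).
have -> : \sum_w pw wgt w * \sum_w' pw wgt w' *
   ((m%:R / theta) ^+ m * (expR (theta * degree i w) * expR (theta * degree i w'))) =
   (m%:R / theta) ^+ m * (E * E).
  rewrite {1}/E mulr_suml mulr_sumr; apply: eq_bigr => w _.
  rewrite /E mulrA mulr_sumr mulr_sumr mulr_sumr; apply: eq_bigr => w' _; ring.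
have hE : E <= expR (2 * theta * q * n%:R) by apply: degree_mgf; rewrite ltW.
have E0 : 0 <= E by apply: sumr_ge0 => w _; rewrite mulr_ge0 ?pw_ge0 ?expR_ge0.
rewrite ler_wpM2l//; apply: le_trans (ler_pM E0 E0 hE hE) _.
by rewrite -expRD ler_expR; lra.
Qed.

(** Swaps preserve the joint law of the two copies, so the moment equals its average over all sign
    vectors. Given [w] and [w'], [rademacher_moment] applies with $D=2d$ times [max_degree], which
    explains $8dm$; the moment of [max_degree] is taken afterwards. *)
Lemma norm_moment m theta : (0 < m)%N -> 0 < theta <= 2^-1 ->
  \sum_w pw wgt w * \sum_w' pw wgt w' *
     sqn ((config_matrix Xs O w - config_matrix Xs O w') ^+ m) <=
  N%:R * n%:R * ((8 * d%:R * m%:R * (m%:R / theta)) ^+ m * expR (4 * theta * q * n%:R)).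
Proof.
move=> m0 ht; set L := \sum_w _.
pose I2 : R := 2 ^+ #|{: pair}|.
have I20 : 0 < I2 by rewrite exprn_gt0.
have card_signs : \sum_(s : {ffun pair -> bool}) 1 = I2.
  by rewrite sumr_const card_ffun card_bool natrX.
rewrite -(@ler_pM2l _ I2)//.
have -> : I2 * L = \sum_w pw wgt w * \sum_w' pw wgt w' *
    \sum_s sqn (rademacher_sum (fun e => pair_mx e (diff_block w w' e)) s ^+ m).
  rewrite -card_signs mulr_suml.
  under [RHS]eq_bigr => w _.
    under eq_bigr => w' _ do rewrite mulr_sumr.
    rewrite exchange_big/= mulr_sumr; over.
  rewrite [RHS]exchange_big/=; apply: eq_bigr => s _; rewrite mul1r.
  apply: etrans (esym (sum_pw_mix wgt [set e | s e] (fun w w' => sqn (diff w w' ^+ m)))) _.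
  by apply: eq_bigr => w _; congr (_ * _); apply: eq_bigr => w' _; rewrite diff_mix.
apply: le_trans (_ : \sum_w pw wgt w * \sum_w' pw wgt w' *
   ((8 * d%:R * m%:R) ^+ m * (I2 * N%:R) * max_degree w w' ^+ m) <= _).
  apply: ler_sum => w _; rewrite ler_wpM2l ?pw_ge0//.
  apply: ler_sum => w' _; rewrite ler_wpM2l ?pw_ge0//.
  apply: le_trans (rademacher_moment _ _ (diff_variance w w') m) _.
  - move=> e; rewrite /diff_block; case: ifP => he; first exact: pair_mx_sym.
    by rewrite pmx0 trmx0.
  - rewrite !mulr_ge0//; exact: bigmax_ge_id.
  - rewrite (_ : 4 * m%:R * (2 * d%:R * max_degree w w') =
       (8 * d%:R * m%:R) * max_degree w w'); last by ring.
    by rewrite exprMn le_eqVlt; apply/orP; left; apply/eqP; rewrite /I2; ring.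
have -> : \sum_w pw wgt w * \sum_w' pw wgt w' *
   ((8 * d%:R * m%:R) ^+ m * (I2 * N%:R) * max_degree w w' ^+ m) =
   (8 * d%:R * m%:R) ^+ m * (I2 * N%:R) *
   \sum_w pw wgt w * \sum_w' pw wgt w' * max_degree w w' ^+ m.
  rewrite mulr_sumr; apply: eq_bigr => w _; rewrite [RHS]mulrCA; congr (_ * _).
  by rewrite [RHS]mulr_sumr; apply: eq_bigr => w' _; rewrite [RHS]mulrCA.
have A0 : 0 <= (8 * d%:R * m%:R) ^+ m * (I2 * N%:R) :> R.
  by rewrite mulr_ge0 ?exprn_ge0 ?mulr_ge0// ltW.
apply: le_trans (ler_wpM2l A0 (max_degree_moment m0 ht)) _.
by rewrite [in leRHS]exprMn le_eqVlt; apply/orP; left; apply/eqP; ring.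
Qed.

End FiniteBounds.

(** * From the probability space to finitely many outcomes *)

Section BorelMatrices.
Variables (R : realType) (d : nat).

Lemma continuous_mx (T : topologicalType) m k (f : T -> 'M[R]_(m, k)) :
  (forall i j, continuous (fun x => f x i j)) -> continuous f.
Proof.
move=> cf x A [P hP sPA].
have : \forall y \near x, forall e : 'I_m * 'I_k, P e.1 e.2 (f y e.1 e.2).
  by apply: filter_forall => -[i j]; exact: (cf i j x _ (hP i j)).
by apply: filterS => y h; apply: sPA => i j; exact: (h (i, j)).
Qed.

Lemma continuous_sum (T : topologicalType) (I : finType) (f : I -> T -> R) :
  (forall i, continuous (f i)) -> continuous (fun x => \sum_i f i x).
Proof.
move=> cf; rewrite (_ : (fun x => _) = \sum_i f i); last first.
  by apply/funext => x; rewrite fct_sumE.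
elim/big_ind: _ => [x|g h cg ch x|i _]; [exact: cst_continuous | | exact: cf].
by apply: continuousD; [exact: cg | exact: ch].
Qed.

Lemma mulmx_continuous m k l (Q : 'M[R]_(m, k)) : continuous (fun M : 'M[R]_(k, l) => Q *m M).
Proof.
apply: continuous_mx => i j.
rewrite (_ : (fun x => _) = (fun M : 'M[R]_(k, l) => \sum_a Q i a * M a j)); last first.
  by apply/funext => M; rewrite mxE.
apply: continuous_sum => a M.
by apply: continuousM; [exact: cst_continuous | exact: coord_continuous].
Qed.

Lemma borel_mx_preimage (f : 'M[R]_d -> 'M[R]_d) : continuous f ->
  forall B, borel_mx R d B -> borel_mx R d (f @^-1` B).
Proof.
move=> /continuousP cf B mB.
pose S := g_sigma_algebraType [set B : set 'M[R]_d | open B].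
have mf : measurable_fun setT (f : S -> S).
  apply: (@measurability _ _ S S setT f [set B : set 'M[R]_d | open B]) => // _ [A oA <-].
  by rewrite setTI; apply: sub_sigma_algebra; exact: cf.
by have := mf measurableT B mB; rewrite setTI.
Qed.

Lemma borel_mx_entry (a b : 'I_d) (E : set R) : measurable E ->
  borel_mx R d [set M : 'M[R]_d | E (M a b)].
Proof.
move=> mE.
pose S := g_sigma_algebraType [set B : set 'M[R]_d | open B].
have mf : measurable_fun setT (fun M : S => (M : 'M[R]_d) a b).
  apply: (measurability (@RGenOInfty.G R)); first exact: RGenOInfty.measurableE.
  move=> _ [_ [x ->] <-]; rewrite setTI; apply: sub_sigma_algebra.
  by apply: (continuousP _).1 => //; exact: coord_continuous.
by have := mf measurableT E mE; rewrite setTI.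
Qed.

Lemma borel_mxT : borel_mx R d setT.
Proof. exact: (@measurableT _ (g_sigma_algebraType [set B : set 'M[R]_d | open B])). Qed.

Lemma borel_mxI A B : borel_mx R d A -> borel_mx R d B -> borel_mx R d (A `&` B).
Proof. exact: (@measurableI _ (g_sigma_algebraType [set B : set 'M[R]_d | open B])). Qed.

End BorelMatrices.

Section Boxes.
Variables (R : realType) (n d : nat).
Local Notation arrays := ('I_n -> 'I_n -> 'M[R]_d).

Definition box (B : 'I_n -> 'I_n -> set 'M[R]_d) : set arrays :=
  [set O | forall i j : 'I_n, (i < j)%N -> B i j (O i j)].

Definition boxes : set (set arrays) :=
  [set A | exists2 B, (forall i j, borel_mx R d (B i j)) & A = box B].

(** The independence clause speaks of boxes above the diagonal. They form a $\pi$-system, so finite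
    measures that agree on boxes agree on this $\sigma$-algebra. *)
Definition array_space := g_sigma_algebraType boxes.

Lemma boxes_setI : setI_closed boxes.
Proof.
move=> X Y [B mB ->] [B' mB' ->]; exists (fun i j => B i j `&` B' i j).
  by move=> i j; exact: borel_mxI.
apply/seteqP; split=> [M [h h'] i j ij|M h]; first by split; [exact: h|exact: h'].
by split=> i j ij; have [] := h i j ij.
Qed.

Lemma boxes_setT : boxes setT.
Proof.
exists (fun _ _ => setT); first by move=> i j; exact: borel_mxT.
by apply/seteqP; split.
Qed.

Lemma measurable_array_entry (i j : 'I_n) (a b : 'I_d) : (i < j)%N ->
  measurable_fun setT (fun O : array_space => (O : arrays) i j a b).
Proof.
move=> ij _ E mE; rewrite setTI; apply: sub_sigma_algebra.
exists (fun k l => if (k, l) == (i, j) then [set M : 'M[R]_d | E (M a b)] else setT).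
  by move=> k l; case: ifP => _; [exact: borel_mx_entry | exact: borel_mxT].
apply/seteqP; split=> [M EM k l kl|M /(_ i j ij)]; last by rewrite eqxx.
by case: eqP => [[-> ->]|].
Qed.

End Boxes.

Lemma measurable_forall (disp : measure_display) (T : measurableType disp) (I : finType)
    (Q : I -> set T) :
  (forall i, measurable (Q i)) -> measurable [set x | forall i, Q i x].
Proof.
move=> mQ; rewrite (_ : [set x | _] = \bigcap_(i in setT) Q i); last first.
  by apply/seteqP; split=> x h i; [move=> _|]; apply: h.
exact: fin_bigcap_measurable.
Qed.

(** The pointwise bound is integrated. With [i] ranging over configurations this exchanges the
    finite average with the original probability. *)
Lemma sum_probability_le (R : realType) (disp : measure_display) (T : measurableType disp)
    (P : probability T R) (I : finType) (c : I -> R) (E : I -> set T) (delta : R) :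
  (forall i, 0 <= c i) -> (forall i, measurable (E i)) ->
  (forall x, \sum_i c i * \1_(E i) x <= delta) ->
  (\sum_i (c i)%:E * P (E i) <= delta%:E)%E.
Proof.
move=> c0 mE h.
have mI i : measurable_fun setT (fun x => ((c i)%:E * (\1_(E i) x)%:E)%E).
  apply: measurable_funeM; apply/measurable_EFinP; exact: measurable_indic.
have -> : (\sum_i (c i)%:E * P (E i) = \int[P]_x \sum_i ((c i)%:E * (\1_(E i) x)%:E))%E.
  rewrite ge0_integral_sum//; last first.
    by move=> i x _; rewrite mule_ge0// lee_fin.
  apply: eq_bigr => i _; rewrite ge0_integralZl//.
  - by rewrite integral_indic// setIT.
  - by apply/measurable_EFinP; exact: measurable_indic.
  - by rewrite lee_fin.
apply: le_trans (_ : (\int[P]_x (cst delta%:E x) <= _)%E); last first.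
  by rewrite integral_cst// [X in (_ * X)%E](_ : _ = 1%E) ?mule1//; exact: probability_setT.
apply: ge0_le_integral => //.
- by move=> x _; apply: sume_ge0 => i _; rewrite mule_ge0// lee_fin.
- exact: emeasurable_sum.
- move=> x _; rewrite (eq_bigr (fun i => (c i * \1_(E i) x)%:E)); last by move=> i _; rewrite EFinM.
  by rewrite sumEFin lee_fin h.
Qed.

Definition option_of_label (x : label) : option bool :=
  match x with Inlier => Some true | Outlier => Some false | Missing => None end.

Lemma option_of_labelK : cancel option_of_label label_of. Proof. by case. Qed.
Lemma label_ofK : cancel label_of option_of_label. Proof. by case=> [[]|]. Qed.

Section Transfer.
Variables (R : realType) (n d : nat) (p q : R).
Variables (disp : measure_display) (T : measurableType disp) (P : probability T R).
Variables (s : 'I_n -> 'I_n -> T -> label) (O : 'I_n -> 'I_n -> T -> 'M[R]_d).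
Hypotheses (p01 : 0 < p < 1) (q01 : 0 < q < 1).

Hypothesis label_law : forall i j : 'I_n, (i < j)%N ->
  [/\ forall A : set label, measurable (s i j @^-1` A),
      P (s i j @^-1` [set Inlier]) = (p * q)%:E,
      P (s i j @^-1` [set Outlier]) = ((1 - p) * q)%:E
    & P (s i j @^-1` [set Missing]) = (1 - q)%:E].
Hypothesis haar_law : forall i j : 'I_n, (i < j)%N -> haar_distributed P (O i j).
Hypothesis independence : forall (A : 'I_n -> 'I_n -> set label)
    (B : 'I_n -> 'I_n -> set 'M[R]_d),
  (forall i j, borel_mx R d (B i j)) ->
  P [set w | forall i j : 'I_n, (i < j)%N -> A i j (s i j w) /\ B i j (O i j w)] =
  (\prod_(i < n) \prod_(j < n | (i < j)%N)
     (P (s i j @^-1` A i j) * P (O i j @^-1` B i j)))%E.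

Local Notation pair := ('I_n * 'I_n)%type.
Local Notation outcome := (outcome d).
Local Notation signs := {ffun 'I_d -> bool}.
Local Notation config := {ffun pair -> outcome}.
Local Notation wgt := (@outcome_weight R n d p q).

(** The default [None] is the label on which [outcome_weight] is concentrated for pairs not above
    the diagonal. *)
Definition seen_labels (x : T) : {ffun pair -> option bool} :=
  [ffun e : pair => if (e.1 < e.2)%N then option_of_label (s e.1 e.2 x) else None].

(** The default [1%:M] keeps all entries in $\mathrm{SO}(d)$, as the finite bounds ask for every [i]
    and [j]. *)
Definition seen_array (x : T) (i j : 'I_n) : 'M[R]_d :=
  if (i < j)%N then O i j x else 1%:M.

Lemma seen_array_SO x i j : SO R d (seen_array x i j).
Proof.
rewrite /seen_array; case: ifP => ij; first by have [] := haar_law ij.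
by split; rewrite ?det1// trmx1 mulmx1.
Qed.

Lemma measurable_seen_labels l : measurable [set x | seen_labels x = l].
Proof.
rewrite (_ : [set x | _] = [set x | forall e : pair, seen_labels x e = l e]); last first.
  by apply/seteqP; split=> [x /= -> //|x /= h]; apply/ffunP.
apply: measurable_forall => e; case he : (e.1 < e.2)%N; last first.
  rewrite [X in measurable X](_ : _ = if None == l e then setT else set0).
    by case: ifP.
  apply/seteqP; split=> x /=; rewrite ffunE he; first by move=> <-.
  by case: eqP.
have [mS _ _ _] := label_law he.
rewrite [X in measurable X](_ : _ = s e.1 e.2 @^-1` [set y | option_of_label y = l e]); first exact: mS.
by apply/seteqP; split=> x /=; rewrite ffunE he.
Qed.

Lemma measurable_twisted_array (sg : pair -> signs) :
  measurable_fun setT (fun x => twist sg (seen_array x) : array_space R n d).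
Proof.
apply: (@measurability _ _ T (array_space R n d) setT _ (@boxes R n d)) => // _ [_ [B mB ->] <-].
rewrite setTI (_ : _ @^-1` _ = [set x | forall e : pair, (e.1 < e.2)%N ->
    B e.1 e.2 (sign_mx R (sg e) *m O e.1 e.2 x)]); last first.
  apply/seteqP; split=> x /= h.
    by move=> [i j] /= ij; have := h i j ij; rewrite /twist /seen_array ij.
  by move=> i j ij; have := h (i, j) ij; rewrite /twist /seen_array ij.
apply: measurable_forall => e; case he : (e.1 < e.2)%N; last first.
  by rewrite [X in measurable X](_ : _ = setT)//; apply/seteqP; split.
have [_ mO _] := haar_law he.
rewrite [X in measurable X](_ : _ = O e.1 e.2 @^-1` [set M | B e.1 e.2 (sign_mx R (sg e) *m M)]).
  apply: mO; apply: (borel_mx_preimage (f := fun M => sign_mx R (sg e) *m M)) => //.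
  exact: mulmx_continuous.
by apply/seteqP; split=> x /=; [apply|].
Qed.

Lemma measurable_seen_array :
  measurable_fun setT (fun x => seen_array x : array_space R n d).
Proof.
rewrite (_ : (fun x => _) = (fun x => twist (fun=> [ffun=> false]) (seen_array x)
  : array_space R n d)); first exact: measurable_twisted_array.
apply/funext => x; apply/funext => i; apply/funext => j.
rewrite /twist (_ : sign_mx _ _ = 1%:M) ?mul1mx//.
rewrite /sign_mx -diag_const_mx; congr diag_mx; apply/rowP => a.
by rewrite !mxE !ffunE !expr0 mulr1.
Qed.

Let lw (e : pair) (o : option bool) : R :=
  if (e.1 < e.2)%N then label_weight p q o else (o == None)%:R.
Let sw (e : pair) (t : signs) : R :=
  if (e.1 < e.2)%N then (2 ^ d)%:R^-1 else (t == [ffun=> false])%:R.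

Let outcome_weightE e x : wgt e x = lw e x.1 * sw e x.2.
Proof.
rewrite /outcome_weight /lw /sw; case: ifP => // _.
by case: x => o t; rewrite xpair_eqE -natrM mulnb.
Qed.

Let lw_ge0 e o : 0 <= lw e o.
Proof. by rewrite /lw; case: ifP => // _; exact: label_weight_ge0. Qed.

Let sw_ge0 e t : 0 <= sw e t.
Proof. by rewrite /sw; case: ifP => // _; rewrite invr_ge0. Qed.

Let sum_sw e : \sum_t sw e t = 1.
Proof.
rewrite /sw; case: (e.1 < e.2)%N.
  by rewrite sumr_const card_ffun card_bool card_ord -[LHS]mulr_natl divff.
by rewrite (bigD1 [ffun=> false])//= eqxx big1 ?addr0// => t /negbTE ->.
Qed.

Let prob_label (i j : 'I_n) o : (i < j)%N ->
  P (s i j @^-1` [set label_of o]) = (lw (i, j) o)%:E.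
Proof.
by move=> ij; have [_ hi ho hm] := label_law ij; rewrite /lw /= ij; case: o => [[]|].
Qed.

Let prod_lw (l : {ffun pair -> option bool}) :
  (forall e : pair, ~~ (e.1 < e.2)%N -> l e = None) ->
  \prod_e lw e (l e) = \prod_(i < n) \prod_(j < n | (i < j)%N) lw (i, j) (l (i, j)).
Proof.
move=> hl; transitivity (\prod_i \prod_j lw (i, j) (l (i, j))).
  by rewrite pair_big/=; apply: eq_bigr => -[].
apply: eq_bigr => i _; rewrite [RHS]big_mkcond; apply: eq_bigr => j _.
by case: ifP => // ij; rewrite /lw/= ij hl ?ij.
Qed.

(** On a box both sides factor over pairs by independence. The label factors give [lw], and left
    invariance under the rotation [sign_mx] inserts the twist into each outlier factor. *)
Lemma seen_box (l : {ffun pair -> option bool}) (sg : pair -> signs) (B : set (array_space R n d)) :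
  boxes B ->
  P [set x | seen_labels x = l /\ B (seen_array x)] =
  ((\prod_e lw e (l e))%:E * P [set x | B (twist sg (seen_array x))])%E.
Proof.
move=> [B' mB' ->].
(* Labels other than [None] off the upper triangle are never seen and have weight zero, so both
   sides vanish. *)
have [hl|] := pselect (forall e : pair, ~~ (e.1 < e.2)%N -> l e = None); last first.
  move=> /existsNP[e /not_implyP[he hle]].
  rewrite (_ : [set x | _] = set0); last first.
    apply/seteqP; split=> // x [] /= hx _; apply: hle; rewrite -hx ffunE.
    by rewrite (negbTE he).
  rewrite measure0 (bigD1 e)//= {1}/lw (negbTE he).
  by case: eqP hle => // _ _; rewrite mul0r mul0e.
rewrite prod_lw//.
rewrite (_ : [set x | _] = [set x | forall i j : 'I_n, (i < j)%N ->
    [set label_of (l (i, j))] (s i j x) /\ B' i j (O i j x)]); last first.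
  apply/seteqP; split=> x /=.
    move=> [hx hB] i j ij; split; last by have := hB i j ij; rewrite /seen_array ij.
    by rewrite -hx ffunE /= ij option_of_labelK.
  move=> h; split; last by move=> i j ij; rewrite /seen_array ij; have [] := h i j ij.
  apply/ffunP => -[i j]; rewrite ffunE /=; case: ifP => ij; last by rewrite hl //= ij.
  by have [-> _] := h i j ij; rewrite label_ofK.
rewrite (independence (fun i j => [set label_of (l (i, j))]))//.
pose Bt (i j : 'I_n) := [set M | B' i j (sign_mx R (sg (i, j)) *m M)].
have mBt i j : borel_mx R d (Bt i j).
  apply: (borel_mx_preimage (f := fun M => sign_mx R (sg (i, j)) *m M)) => //.
  exact: mulmx_continuous.
have -> : P [set x | box B' (twist sg (seen_array x))] =
  (\prod_(i < n) \prod_(j < n | (i < j)%N)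
     (P (s i j @^-1` setT) * P (O i j @^-1` Bt i j)))%E.
  apply: etrans (independence (fun _ _ => setT) mBt); congr (P _).
  apply/seteqP; split=> x /= h i j ij; have := h i j ij; rewrite /twist /seen_array ij.
    by split.
  by case.
rewrite -prodEFin -big_split/=; apply: eq_bigr => i _.
rewrite -prodEFin -big_split/=; apply: eq_bigr => j ij.
rewrite prob_label//; congr (_ * _)%E.
rewrite preimage_setT [X in (X * _)%E](_ : _ = 1%E) ?mul1e; last exact: probability_setT.
have [_ _ hQ] := haar_law ij.
by rewrite -[LHS](hQ _ _ (sign_mx_SO R (sg (i, j))) (mB' i j)).
Qed.

(** As functions of [B] both sides are finite measures; [seen_box] and uniqueness on a $\pi$-system
    identify them. *)
Lemma seen_measure (l : {ffun pair -> option bool}) (sg : pair -> signs)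
    (B : set (array_space R n d)) : measurable B ->
  P [set x | seen_labels x = l /\ B (seen_array x)] =
  ((\prod_e lw e (l e))%:E * P [set x | B (twist sg (seen_array x))])%E.
Proof.
move=> mB.
have c0 : 0 <= \prod_e lw e (l e) by apply: prodr_ge0 => e _; exact: lw_ge0.
pose m1 := measure_function_pushforward__canonical__measure_function_Measure
  (mrestr P (measurable_seen_labels l)) measurable_seen_array.
pose m2 := mscale (NngNum c0)
  (measure_function_pushforward__canonical__measure_function_Measure P (measurable_twisted_array sg)).
have m1E A : m1 A = P [set x | seen_labels x = l /\ A (seen_array x)].
  by rewrite /= /pushforward /mrestr; congr (P _); apply/seteqP; split=> x /= [].
have m2E A : m2 A = ((\prod_e lw e (l e))%:E * P [set x | A (twist sg (seen_array x))])%E.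
  by [].
apply: etrans (esym (m1E B)) _; apply: etrans (m2E B).
apply: (@measure_unique _ R (array_space R n d) (@boxes R n d) (fun=> setT)) => //.
- exact: boxes_setI.
- by move=> _; exact: boxes_setT.
- by apply/seteqP; split=> // x _; exists 0%N.
- move=> A hA; apply: etrans (m1E A) _; exact: etrans (seen_box l sg hA) (esym (m2E A)).
- move=> _; rewrite (m1E setT); apply: le_lt_trans (probability_le1 P _) _; last by rewrite ltry.
  by apply: measurableI; [exact: measurable_seen_labels | exact: measurableT].
Qed.

(** Splitting by labels and averaging [seen_measure] over signs writes the probability as a sum over
    configurations [w] of [pw wgt w] times the probability of the event at the array twisted by [w].
    Exchanging the two averages reduces it to the hypothesis at each realised array. *)
Lemma finite_transfer (bad : {ffun pair -> option bool} -> set (array_space R n d)) (delta : R) :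
  (forall l, measurable (bad l)) ->
  (forall O' : 'I_n -> 'I_n -> 'M[R]_d, (forall i j, SO R d (O' i j)) ->
     \sum_(w : config) pw wgt w *
        (`[< bad [ffun e => (w e).1] (twist (fun e => (w e).2) O') >])%:R <= delta) ->
  measurable [set x | bad (seen_labels x) (seen_array x)] /\
  (P [set x | bad (seen_labels x) (seen_array x)] <= delta%:E)%E.
Proof.
move=> mbad hbad.
have mtw (w : config) : measurable [set x | bad [ffun e => (w e).1]
    (twist (fun e => (w e).2) (seen_array x))].
  by have := measurable_twisted_array (fun e => (w e).2) measurableT (mbad [ffun e => (w e).1]); rewrite setTI.
pose F l := [set x | seen_labels x = l /\ bad l (seen_array x)].
have mF l : measurable (F l).
  apply: measurableI; first exact: measurable_seen_labels.
  by have := measurable_seen_array measurableT (mbad l); rewrite setTI.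
have bigF : [set x | bad (seen_labels x) (seen_array x)] = \big[setU/set0]_l F l.
  rewrite -bigcup_seq/=; apply/seteqP; split=> x /=.
    by move=> hx; exists (seen_labels x) => //=; rewrite mem_index_enum.
  by move=> [l _ [<-]].
split; first by rewrite bigF; apply: bigsetU_measurable.
apply: le_trans (_ : (\sum_l P (F l) <= _)%E).
  rewrite bigF.
  have : measurable (\big[setU/set0]_l F l) /\ (P (\big[setU/set0]_l F l) <= \sum_l P (F l))%E.
    elim/big_rec2: _ => [|l X x _ [mX IH]]; first by rewrite measure0.
    split; first exact: measurableU.
    by apply: le_trans (measureU2 P (mF l) mX) _; rewrite leeD2l.
  by case.
have step : (\sum_l P (F l) = \sum_(w : config) (pw wgt w)%:E *
    P [set x | bad [ffun e => (w e).1] (twist (fun e => (w e).2) (seen_array x))])%E.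
  pose lof (w : config) : {ffun pair -> option bool} := [ffun e => (w e).1].
  pose ps (w : config) := \prod_e sw e (w e).2.
  rewrite (eq_bigr (fun w => ((ps w)%:E * P (F (lof w)))%E)); last first.
    move=> w _; rewrite /F (seen_measure (lof w) (fun e => (w e).2))//.
    rewrite muleA -EFinM; congr (_%:E * _)%E; rewrite /pw /ps mulrC -big_split/=.
    by apply: eq_bigr => e _; rewrite outcome_weightE ffunE.
  (* Configurations with equal labels differ only in their signs, whose weights sum to 1 within each
     class. *)
  rewrite (partition_big lof xpredT)//=; apply: eq_bigr => l _.
  rewrite (eq_bigr (fun w => ((ps w)%:E * P (F l))%E)); last by move=> w /eqP ->.
  rewrite -ge0_sume_distrl; last first.
    by move=> w _; rewrite lee_fin; apply: prodr_ge0 => e _; exact: sw_ge0.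
  rewrite sumEFin [X in (X%:E * _)%E](_ : _ = 1) ?mul1e// big_mkcond/=.
  transitivity (\sum_(w : config) \prod_e (sw e (w e).2 * ((w e).1 == l e)%:R)).
    apply: eq_bigr => w _; rewrite big_split/=; case: eqVneq => [<-|wl].
      by rewrite [X in _ * X]big1 ?mulr1// => e _; rewrite ffunE eqxx.
    have [e hel] : exists e, lof w e != l e.
      apply/existsP; rewrite -negb_forall; apply: contra wl => /forallP h.
      by apply/eqP/ffunP => e; apply/eqP.
    by rewrite [X in _ * X](bigD1 e)//= ffunE in hel *; rewrite (negbTE hel) mul0r mulr0.
  rewrite -(bigA_distr_bigA (fun e (x : outcome) => sw e x.2 * (x.1 == l e)%:R))/=.
  rewrite big1// => e _.
  transitivity (\sum_o \sum_t sw e t * (o == l e)%:R); first by rewrite pair_big.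
  rewrite (bigD1 (l e))//= [X in _ + X]big1 ?addr0; last first.
    by move=> o /negbTE ol; rewrite ol big1// => t _; rewrite mulr0.
  by rewrite -[RHS](sum_sw e); apply: eq_bigr => t _; rewrite eqxx mulr1.
rewrite step; apply: sum_probability_le => //.
  by move=> w; apply: pw_ge0 => e x; exact: outcome_weight_ge0.
move=> x; apply: le_trans (hbad _ (seen_array_SO x)).
apply: ler_sum => w _; rewrite indicE.
case: (boolP (x \in _)) => [/set_mem h|_]; first by rewrite asboolT.
by rewrite mulr0 mulr_ge0// pw_ge0// => e y; exact: outcome_weight_ge0.
Qed.

End Transfer.

(** * Exceptional events, their measurability and probability *)

Section BadEvents.
Variables (R : realType) (n d : nat) (p q : R).
Variable Xs : 'M[R]_(\sum_(i < n) d, d).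
Local Notation N := (\sum_(i < n) d)%N.
Local Notation cb := (submxcol (p_ := fun=> d)).
Local Notation pair := ('I_n * 'I_n)%type.
Local Notation arrays := ('I_n -> 'I_n -> 'M[R]_d).
Local Notation labels := {ffun pair -> option bool}.
Local Notation config := {ffun pair -> outcome d}.
Local Notation wgt := (@outcome_weight R n d p q).
Implicit Types (l : labels) (O : arrays) (w : config).

Definition label_noise l O : 'M[R]_N := noise_matrix p q Xs (noisy_matrix Xs l O).

(* Jensen over the resampled configuration bounds the noise by this moment, which unlike an
   operator norm is a polynomial in the array, hence measurable. *)
Definition deviation_moment r l O : R :=
  \sum_(w : config) pw wgt w * sqn ((noisy_matrix Xs l O - config_matrix Xs O w) ^+ (2 ^ r)).

Definition bad_norm r (c : R) l : set (array_space R n d) :=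
  [set O | (c ^+ 2) ^+ (2 ^ r) < deviation_moment r l O].

(** Comparing squares for every [j] says that the entry exceeds [tau] times the largest block, using
    finitely many polynomial inequalities. *)
Definition bad_row (tau : R) (i : 'I_n) (k : nat) (a b : 'I_d) l : set (array_space R n d) :=
  [set O | forall j, tau ^+ 2 * sqn (cb (loo_iterate Xs i k (label_noise l O)) j) <
     ((cb (label_noise l O *m loo_iterate Xs i k (label_noise l O)) i) a b) ^+ 2].

Section Measurability.
Local Notation mfun := (fun f : array_space R n d -> R => measurable_fun setT f).

Definition mx_measurable m k (F : array_space R n d -> 'M[R]_(m, k)) :=
  forall i j, mfun (fun O => F O i j).

Lemma mx_measurable_cst m k (A : 'M[R]_(m, k)) : mx_measurable (fun=> A).
Proof. by move=> i j; exact: measurable_cst. Qed.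

Lemma mx_measurableB m k (F G : array_space R n d -> 'M[R]_(m, k)) :
  mx_measurable F -> mx_measurable G -> mx_measurable (fun O => F O - G O).
Proof.
move=> mF mG i j; rewrite (_ : (fun O => _) = (fun O => F O i j) \- (fun O => G O i j)).
  exact: measurable_funB.
by apply/funext => O; rewrite !mxE.
Qed.

Lemma mx_measurableM m k h (F : array_space R n d -> 'M[R]_(m, k))
    (G : array_space R n d -> 'M[R]_(k, h)) :
  mx_measurable F -> mx_measurable G -> mx_measurable (fun O => F O *m G O).
Proof.
move=> mF mG i j; rewrite (_ : (fun O => _) = (fun O => \sum_a F O i a * G O a j)).
  by apply: measurable_sum => a; exact: measurable_funM.
by apply/funext => O; rewrite mxE.
Qed.

Lemma mx_measurable_exp m (F : array_space R n d -> 'M[R]_m) k :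
  mx_measurable F -> mx_measurable (fun O => F O ^+ k).
Proof.
move=> mF; elim: k => [|k IH]; first exact: mx_measurable_cst.
rewrite (_ : (fun O => _) = (fun O => F O *m F O ^+ k)); first exact: mx_measurableM.
by apply/funext => O; rewrite exprS.
Qed.

Lemma mx_measurable_sqn m k (F : array_space R n d -> 'M[R]_(m, k)) :
  mx_measurable F -> mfun (fun O => sqn (F O)).
Proof.
move=> mF; apply: measurable_sum => i; apply: measurable_sum => j.
exact: measurable_funX.
Qed.

Lemma mx_measurable_sub m k m' k' (f : 'I_m' -> 'I_m) (g : 'I_k' -> 'I_k)
    (F : array_space R n d -> 'M[R]_(m, k)) :
  mx_measurable F -> mx_measurable (fun O => mxsub f g (F O)).
Proof.
move=> mF i j; rewrite (_ : (fun O => _) = (fun O => F O (f i) (g j))); first exact: mF.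
by apply/funext => O; rewrite mxE.
Qed.

Lemma mx_measurable_noisy l (F : array_space R n d -> arrays) :
  (forall i j : 'I_n, (i < j)%N -> mx_measurable (fun O => F O i j)) ->
  mx_measurable (fun O => noisy_matrix Xs l (F O)).
Proof.
move=> mF.
have mobs (i j : 'I_n) : (i < j)%N ->
    mx_measurable (fun O => observation Xs (fun i j => label_of (l (i, j))) (F O) i j).
  move=> ij; rewrite /observation; case: (label_of _).
  - exact: mx_measurable_cst.
  - exact: mF.
  - exact: mx_measurable_cst.
move=> a b; set i := tagnat.sig1 a; set j := tagnat.sig1 b.
rewrite (_ : (fun O => _) = (fun O => (if (i < j)%N
    then observation Xs (fun i j => label_of (l (i, j))) (F O) i j
    else if (j < i)%N then (observation Xs (fun i j => label_of (l (i, j))) (F O) j i)^T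
    else 0) (tagnat.sig2 a) (tagnat.sig2 b))); last first.
  by apply/funext => O; rewrite /noisy_matrix /rcm_matrix mxE.
case ij : (i < j)%N; first exact: mobs.
case ji : (j < i)%N; last exact: measurable_cst.
rewrite (_ : (fun O => _) = (fun O => observation Xs (fun i j => label_of (l (i, j)))
  (F O) j i (tagnat.sig2 b) (tagnat.sig2 a))); first exact: mobs.
by apply/funext => O; rewrite mxE.
Qed.

Lemma mx_measurable_entry (i j : 'I_n) : (i < j)%N ->
  mx_measurable (fun O : array_space R n d => (O : arrays) i j).
Proof. by move=> ij a b; exact: measurable_array_entry. Qed.

Lemma mx_measurable_noise l : mx_measurable (fun O => label_noise l O).
Proof.
apply: mx_measurableB; last exact: mx_measurable_cst.
by apply: (mx_measurable_noisy _ (F := id)) => i j; exact: mx_measurable_entry.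
Qed.

Lemma mx_measurable_drop i (F : array_space R n d -> 'M[R]_N) :
  mx_measurable F -> mx_measurable (fun O => drop_node i (F O)).
Proof.
move=> mF a b.
rewrite (_ : (fun O => _) = (fun O => if (tagnat.sig1 a == i) || (tagnat.sig1 b == i) then 0
  else F O a b)); first by case: (_ || _); [exact: measurable_cst | exact: mF].
apply/funext => O; rewrite mxE; case: ifP => _; first by rewrite mxE.
by rewrite mxE !tagnat.sig2K.
Qed.

Lemma mx_measurable_loo l i k : mx_measurable (fun O => loo_iterate Xs i k (label_noise l O)).
Proof.
rewrite /loo_iterate /power_iterate; elim: k => [|k IH] /=; first exact: mx_measurable_cst.
by apply: mx_measurableM => //; apply: mx_measurable_drop; exact: mx_measurable_noise.
Qed.

Lemma measurable_lt (f g : array_space R n d -> R) : mfun f -> mfun g ->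
  measurable [set O | f O < g O].
Proof.
move=> mf mg; rewrite (_ : [set O | _] = setT `&` (fun O => f O < g O) @^-1` [set true]).
  by apply: measurable_fun_ltr.
by rewrite setTI; apply/seteqP; split.
Qed.

Lemma measurable_bad_norm r c l : measurable (bad_norm r c l).
Proof.
apply: measurable_lt; first exact: measurable_cst.
apply: measurable_sum => w; apply: measurable_funM; first exact: measurable_cst.
apply: mx_measurable_sqn; apply: mx_measurable_exp; apply: mx_measurableB.
  by apply: (mx_measurable_noisy _ (F := id)) => i j; exact: mx_measurable_entry.
rewrite (_ : (fun O => _) = (fun O => noisy_matrix Xs [ffun e => (w e).1]
  (twist (fun e => (w e).2) O))).
  apply: mx_measurable_noisy => i j ij; apply: mx_measurableM; first exact: mx_measurable_cst.
  exact: mx_measurable_entry.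
apply/funext => O; rewrite /config_matrix; congr noisy_matrix.
by apply/funext => e; rewrite ffunE.
Qed.

Lemma measurable_bad_row tau i k a b l : measurable (bad_row tau i k a b l).
Proof.
apply: measurable_forall => j; apply: measurable_lt.
  apply: measurable_funM; first exact: measurable_cst.
  by apply: mx_measurable_sqn; apply: mx_measurable_sub; exact: mx_measurable_loo.
have mW : mx_measurable (fun O => label_noise l O *m loo_iterate Xs i k (label_noise l O)).
  by apply: mx_measurableM; [exact: mx_measurable_noise | exact: mx_measurable_loo].
by apply: measurable_funX; exact: (mx_measurable_sub _ _ mW).
Qed.

End Measurability.

Section Probability.
Hypothesis d2 : (2 <= d)%N.
Hypotheses (p01 : 0 < p < 1) (q01 : 0 < q < 1).
Hypothesis SXs : SOn R n d Xs.
Variable O : arrays.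
Hypothesis SO_O : forall i j, SO R d (O i j).

Let wgt0 e x : 0 <= wgt e x. Proof. exact: outcome_weight_ge0. Qed.

Let tw w : arrays := twist (fun e => (w e).2) O.
Let lb w : labels := [ffun e => (w e).1].

Let noisy_config w : noisy_matrix Xs (lb w) (tw w) = config_matrix Xs O w.
Proof. by rewrite /config_matrix; congr noisy_matrix; apply/funext => e; rewrite ffunE. Qed.

(** Twisting by [w] and then by [w'] adds the sign vectors, by [sign_mx_mul]. Signs are uniform, so
    this change of configuration preserves weights. *)
Let shift (w w' : config) : config :=
  [ffun e : pair => if (e.1 < e.2)%N then ((w' e).1, [ffun a => (w' e).2 a (+) (w e).2 a]) else w' e].

Let shiftK w : involutive (shift w).
Proof.
move=> w'; apply/ffunP => e; rewrite !ffunE; case he: (e.1 < e.2)%N => //.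
case: (w' e) => o t /=; congr (_, _); apply/ffunP => a.
by rewrite !ffunE -addbA addbb addbF.
Qed.

Let pw_shift w w' : pw wgt (shift w w') = pw wgt w'.
Proof.
apply: eq_bigr => e _; rewrite ffunE; case: ifP => // he.
by rewrite /outcome_weight he.
Qed.

Let config_shift w w' : config_matrix Xs (tw w) w' = config_matrix Xs O (shift w w').
Proof.
apply/eq_mxblockP => i j; rewrite /observation /twist /tw /twist.
case: ifP => ij; rewrite ?ffunE/= ?ij/=.
  by case: (label_of _) => //; rewrite sign_mx_mul mulmxA.
case: ifP => ji; rewrite ?ffunE/= ?ji//=.
by case: (label_of _) => //; rewrite sign_mx_mul mulmxA.
Qed.

(** The moment is built from the array it receives, here already twisted by [w], so its reference
    copies carry both twists. Reindexing by [shift w] restores an independent copy over [O]. *)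
Lemma deviation_moment_config r w : deviation_moment r (lb w) (tw w) =
  \sum_w' pw wgt w' * sqn ((config_matrix Xs O w - config_matrix Xs O w') ^+ (2 ^ r)).
Proof.
rewrite /deviation_moment noisy_config (reindex (shift w))/=; last first.
  by apply: onW_bij; exists (shift w); exact: shiftK.
by apply: eq_bigr => w' _; rewrite pw_shift config_shift shiftK.
Qed.

Lemma prob_bad_norm r (c theta : R) : 0 < c -> 0 < theta <= 2^-1 ->
  \sum_w pw wgt w * (`[< bad_norm r c (lb w) (tw w) >])%:R <=
  N%:R * n%:R * ((8 * d%:R * (2 ^ r)%:R * ((2 ^ r)%:R / theta)) ^+ (2 ^ r)
     * expR (4 * theta * q * n%:R)) / (c ^+ 2) ^+ (2 ^ r).
Proof.
move=> c0 ht; have cc0 : 0 < (c ^+ 2) ^+ (2 ^ r) by rewrite !exprn_gt0.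
apply: le_trans (_ : \sum_w pw wgt w * ((c ^+ 2) ^+ (2 ^ r) < deviation_moment r (lb w) (tw w))%R%:R <= _).
  apply: ler_sum => w _; rewrite ler_wpM2l ?pw_ge0//.
  by case: asboolP => // h; rewrite /bad_norm /= in h; rewrite h.
apply: le_trans (sum_pw_markov wgt0 cc0 _) _.
  by move=> w; apply: sumr_ge0 => w' _; rewrite mulr_ge0 ?pw_ge0 ?sqn_ge0.
rewrite ler_pM2r ?invr_gt0//.
under eq_bigr => w _ do rewrite deviation_moment_config.
by apply: norm_moment => //; rewrite expn_gt0.
Qed.

Lemma prob_bad_row i k a b s tau : 0 < s -> 0 <= tau ->
  s * (2 * Num.sqrt d%:R) <= 2^-1 ->
  \sum_w pw wgt w * (`[< bad_row tau i k a b (lb w) (tw w) >])%:R <=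
  2 * expR (8 * n%:R * q * d%:R * s ^+ 2 - s * tau).
Proof.
move=> s0 tau0 hs; apply: le_trans (row_event_bound d2 p01 q01 SXs SO_O i k a b s0 tau0 hs).
apply: ler_sum => w _; rewrite ler_wpM2l ?pw_ge0//.
case: asboolP => // h; rewrite /bad_row /= /label_noise noisy_config in h.
by rewrite (introT forallP h).
Qed.

End Probability.
End BadEvents.

(** * Operator norm of the noise outside the exceptional event *)

Section NoiseNorm.
Variables (R : realType) (n d : nat) (p q : R).
Variable Xs : 'M[R]_(\sum_(i < n) d, d).
Hypothesis d2 : (2 <= d)%N.
Hypotheses (p01 : 0 < p < 1) (q01 : 0 < q < 1).
Hypothesis SXs : SOn R n d Xs.
Local Notation N := (\sum_(i < n) d)%N.
Local Notation bl := (submxblock (p_ := fun=> d) (q_ := fun=> d)).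
Local Notation pair := ('I_n * 'I_n)%type.
Local Notation config := {ffun pair -> outcome d}.
Local Notation wgt := (@outcome_weight R n d p q).

Let wgt0 e x : 0 <= wgt e x. Proof. exact: outcome_weight_ge0. Qed.
Let wgt1 e : \sum_x wgt e x = 1. Proof. exact: sum_outcome_weight. Qed.

Lemma sum_pw_marginal (e : pair) m k (f : outcome d -> 'M[R]_(m, k)) :
  \sum_(w : config) pw wgt w *: f (w e) = \sum_x wgt e x *: f x.
Proof.
apply/matrixP => a b; rewrite !summxE.
under eq_bigr => w _ do rewrite mxE.
under [RHS]eq_bigr => x _ do rewrite mxE.
transitivity (\sum_(w : config) pw wgt w * \prod_e' (if e' == e then f (w e') a b else 1)).
  by apply: eq_bigr => w _; rewrite -big_mkcond/= big_pred1_eq.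
rewrite (sum_pw_prod wgt (fun e' x => if e' == e then f x a b else 1)).
rewrite (bigD1 e)//= eqxx [X in _ * X]big1 ?mulr1// => e' /negbTE ->.
by under eq_bigr => x _ do rewrite mulr1; exact: wgt1.
Qed.

Lemma noisy_matrix_sym l O : (noisy_matrix Xs l O)^T = noisy_matrix Xs l O.
Proof.
rewrite /noisy_matrix /rcm_matrix tr_mxblock; apply/eq_mxblockP => i j.
by have [ij|ji|_] := ltngtP i j; rewrite ?trmxK ?trmx0.
Qed.

Lemma mean_config_matrix O : (forall i j, SO R d (O i j)) ->
  \sum_(w : config) pw wgt w *: config_matrix Xs O w = (p * q) *: (Xs *m Xs^T - 1%:M).
Proof.
move=> SO_O; apply/eqP; rewrite -subr_eq0; apply/eqP.
transitivity (\sum_(w : config) pw wgt w *: noise_matrix p q Xs (config_matrix Xs O w)).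
  under [RHS]eq_bigr => w _ do rewrite scalerBr.
  by rewrite sumrB -scaler_suml sum_pw// scale1r.
apply/mxblockP => i j; rewrite submxblock_sum submxblock0.
rewrite (eq_bigr (fun w : config => pw wgt w *: bl (noise_matrix p q Xs (config_matrix Xs O w)) i j)); last first.
  by move=> w _; apply/matrixP => a b; rewrite !mxE.
under eq_bigr => w _ do rewrite noise_config_block//.
have [ij|ji|_] := ltngtP i j.
- rewrite (sum_pw_marginal (i, j) (centered_block p q Xs O (i, j))).
  exact: mean_centered_block.
- rewrite (sum_pw_marginal (j, i) (fun x => (centered_block p q Xs O (j, i) x)^T)).
  under eq_bigr => x _ do rewrite -linearZ/=.
  by rewrite -raddf_sum/= mean_centered_block ?raddf0.
- by rewrite big1// => w _; rewrite scaler0.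
Qed.

(** By [mean_config_matrix] the noise is the average of its differences with the reference copies,
    so [frob_mul_average] turns the moment bound into an operator bound. *)
Lemma label_noise_norm l O r (c : R) k (x : 'M[R]_(N, k)) : (forall i j, SO R d (O i j)) ->
  0 <= c -> ~ bad_norm p q Xs r c l O -> frob (label_noise p q Xs l O *m x) <= c * frob x.
Proof.
move=> SO_O c0 /negP; rewrite -leNgt => hF.
pose M (w : config) := noisy_matrix Xs l O - config_matrix Xs O w.
have -> : label_noise p q Xs l O = \sum_(w : config) pw wgt w *: M w.
  under [RHS]eq_bigr => w _ do rewrite /M scalerBr.
  by rewrite sumrB -scaler_suml sum_pw// scale1r mean_config_matrix.
apply: (@frob_mul_average _ _ _ _ _ _ _ r) => //.
- by move=> w; exact: pw_ge0.
- exact: sum_pw.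
- by move=> w; rewrite /M raddfB/= !noisy_matrix_sym.
Qed.

End NoiseNorm.

(** * Leave-one-out analysis of the power iterates *)

Section LeaveOneOutBound.
Variables (R : realType) (n d : nat) (Xs : 'M[R]_(\sum_(i < n) d, d)).
Hypothesis SXs : SOn R n d Xs.
Local Notation N := (\sum_(i < n) d)%N.
Local Notation bl := (submxblock (p_ := fun=> d) (q_ := fun=> d)).
Local Notation cb := (submxcol (p_ := fun=> d)).
Variables (W : 'M[R]_N) (t : R) (K : nat).
Hypothesis t0 : 0 <= t.
Hypothesis opW : forall k (x : 'M[R]_(N, k)), frob (W *m x) <= t * frob x.
Hypothesis rowW : forall i k M, (k < K)%N -> 0 <= M ->
  (forall j, frob (cb (loo_iterate Xs i k W) j) <= M) ->
  frob (cb (W *m loo_iterate Xs i k W) i) <= t * M.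

Definition only_block (i : 'I_n) k (v : 'M[R]_(N, k)) : 'M[R]_(N, k) :=
  \mxcol_(j < n) (if j == i then cb v j else 0).

Lemma cb_only i k (v : 'M[R]_(N, k)) j :
  cb (only_block i v) j = if j == i then cb v j else 0.
Proof. by rewrite /only_block mxcolK. Qed.

Lemma frob_only i k (v : 'M[R]_(N, k)) : frob (only_block i v) = frob (cb v i).
Proof.
rewrite !frobE sqn_blocks (bigD1 i)//= cb_only eqxx big1 ?addr0// => j /negbTE ji.
by rewrite cb_only ji -frob_sqr frob0 expr0n.
Qed.

(** The removed part is row $i$ and column $i$. The first term is the whole row; the subtraction in
    the second keeps block $(i,i)$ from being counted twice. *)
Lemma drop_node_mul i k (v : 'M[R]_(N, k)) :
  W *m v - drop_node i W *m v =
  only_block i (W *m v) + (W *m only_block i v - only_block i (W *m only_block i v)).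
Proof.
apply/mxcolP => j; rewrite !(submxcolB, submxcolD, submxcolN) !cb_only !submxcol_mulmx.
have dropE l : bl (drop_node i W) j l = if (j == i) || (l == i) then 0 else bl W j l.
  by rewrite mxblockK.
have [->|ji] := eqVneq j i.
  rewrite subrr addr0 [X in _ - X]big1 ?subr0// => l _.
  by rewrite mxblockK eqxx mul0mx.
rewrite subr0 add0r (bigD1 i)//= [X in _ - X](bigD1 i)//= [RHS](bigD1 i)//=.
rewrite cb_only eqxx dropE eqxx orbT mul0mx add0r.
rewrite [X in _ = _ + X]big1 ?addr0; last by move=> l /negbTE li; rewrite cb_only li mulmx0.
rewrite [X in _ - X](eq_bigr (fun l => bl W j l *m cb v l)) ?addrK// => l /negbTE li.
by rewrite dropE (negbTE ji) li.
Qed.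

Lemma frob_sub_only i k (v : 'M[R]_(N, k)) : frob (v - only_block i v) <= frob v.
Proof.
rewrite frob_le !sqn_blocks; apply: ler_sum => j _; rewrite submxcolB cb_only.
by case: ifP => _; rewrite ?subr0// subrr -frob_sqr frob0 expr0n sqn_ge0.
Qed.

(** Let $A$ be the bound at step $k$. Blocks of the leave-one-out iterate are at most $2A$, so
    [rowW] gives $2tA$ for its row $i$. A new block is at most $2tA+tA$; the new difference is at
    most $tA$ propagated, $2tA$ from row $i$ and $2tA$ from column $i$. Their sum is the 5. *)
Lemma loo_bounds k : (k <= K)%N ->
  (forall i, frob (cb (power_iterate Xs k W) i) <= Num.sqrt d%:R * (5 * t) ^+ k) /\
  (forall i, frob (power_iterate Xs k W - loo_iterate Xs i k W) <= Num.sqrt d%:R * (5 * t) ^+ k).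
Proof.
elim: k => [_|k IH kK].
  split=> i; rewrite expr0 mulr1.
    by rewrite (frob_orth (SO_orth (SXs i))).
  by rewrite /loo_iterate /power_iterate /= subrr frob0.
have {IH} [ha hb] := IH (ltnW kK).
set A := _ * _ ^+ k in ha hb.
have A0 : 0 <= A by rewrite mulr_ge0// exprn_ge0// mulr_ge0.
have AS : Num.sqrt d%:R * (5 * t) ^+ k.+1 = 5 * t * A by rewrite exprS mulrCA.
rewrite AS; set v := power_iterate Xs k W in ha hb.
have loo i j : frob (cb (loo_iterate Xs i k W) j) <= 2 * A.
  have -> : loo_iterate Xs i k W = v - (v - loo_iterate Xs i k W) by rewrite subKr.
  rewrite submxcolB; apply: le_trans (frobB _ _) _.
  by have := ha j; have := le_trans (frob_block_le _ j) (hb i); lra.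
have row i : frob (cb (W *m loo_iterate Xs i k W) i) <= t * (2 * A).
  by apply: rowW => //; rewrite mulr_ge0.
split=> i.
  rewrite /power_iterate iterS -/(power_iterate Xs k W) -/v.
  have -> : W *m v = W *m loo_iterate Xs i k W + W *m (v - loo_iterate Xs i k W).
    by rewrite -mulmxDr addrC subrK.
  rewrite submxcolD; apply: le_trans (frobD _ _) _.
  have h1 := le_trans (frob_block_le (W *m (v - loo_iterate Xs i k W)) i) (opW _).
  have h2 : t * frob (v - loo_iterate Xs i k W) <= t * A by rewrite ler_wpM2l.
  have := row i; have : 0 <= t * A by rewrite mulr_ge0.
  by lra.
rewrite /loo_iterate /power_iterate !iterS -/(power_iterate Xs k W) -/v.
rewrite -/(power_iterate Xs k (drop_node i W)) -/(loo_iterate Xs i k W).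
set u := loo_iterate Xs i k W.
have -> : W *m v - drop_node i W *m u = W *m (v - u) + (W *m u - drop_node i W *m u).
  by rewrite mulmxBr addrA subrK.
rewrite drop_node_mul; apply: le_trans (frobD _ _) _.
have h1 : frob (W *m (v - u)) <= t * A.
  by apply: le_trans (opW _) _; apply: ler_wpM2l => //; exact: hb.
have h2 : frob (only_block i (W *m u)) <= t * (2 * A) by rewrite frob_only; exact: row.
have h3 : frob (W *m only_block i u - only_block i (W *m only_block i u)) <= t * (2 * A).
  apply: le_trans (frob_sub_only _ _) _; apply: le_trans (opW _) _.
  by apply: ler_wpM2l => //; rewrite frob_only; exact: loo.
have := frobD (only_block i (W *m u)) (W *m only_block i u - only_block i (W *m only_block i u)).
lra.
Qed.

End LeaveOneOutBound.

(** * Eigenvectors of a perturbed rank-d matrix *)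

Section Spectral.
Variables (R : realType) (n d : nat) (Xs : 'M[R]_(\sum_(i < n) d, d)).
Hypothesis SXs : SOn R n d Xs.
Hypothesis n0 : (0 < n)%N.
Hypothesis d0 : (0 < d)%N.
Local Notation N := (\sum_(i < n) d)%N.
Local Notation cb := (submxcol (p_ := fun=> d)).

Lemma gram_SOn : Xs^T *m Xs = n%:R%:M.
Proof.
rewrite -{1 2}(submxcolK (p_ := fun=> d) Xs) tr_mxcol mul_mxrow_mxcol.
rewrite (eq_bigr (fun=> 1%:M)); last by move=> i _; case: (SXs i).
by rewrite sumr_const card_ord -scaler_nat scalemx1.
Qed.

Lemma sqn_SOn_mul k (y : 'M[R]_(d, k)) : sqn (Xs *m y) = n%:R * sqn y.
Proof.
by rewrite !sqn_trace trmx_mul mulmxA -(mulmxA _ Xs^T) gram_SOn mul_mx_scalar -scalemxAl mxtraceZ.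
Qed.

Lemma frob_SOn_mul k (y : 'M[R]_(d, k)) : frob (Xs *m y) = Num.sqrt n%:R * frob y.
Proof. by rewrite !frobE sqn_SOn_mul sqrtrM. Qed.

Lemma frob_tr_SOn_mul k (y : 'M[R]_(N, k)) : frob (Xs^T *m y) <= Num.sqrt n%:R * frob y.
Proof.
have h : frob (Xs^T *m y) * frob (Xs^T *m y) <= (Num.sqrt n%:R * frob y) * frob (Xs^T *m y).
  rewrite -expr2 frob_sqr -ipxx ip_trace trmx_mul trmxK -mulmxA -ip_trace.
  apply: le_trans (ler_norm _) _; apply: le_trans (ip_cauchy _ _) _.
  by rewrite frob_SOn_mul mulrCA mulrA.
have [->|z] := eqVneq (frob (Xs^T *m y)) 0; first by rewrite mulr_ge0 ?frob_ge0.
by rewrite -(ler_pM2r (_ : 0 < frob (Xs^T *m y)))// lt0r z frob_ge0.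
Qed.

Variables (Y W : 'M[R]_N) (beta t : R).
Hypothesis YE : Y = beta *: (Xs *m Xs^T) + W - beta%:M.
Hypothesis beta0 : 0 < beta.
Hypothesis t0 : 0 <= t.
Hypothesis opW : forall k (x : 'M[R]_(N, k)), frob (W *m x) <= t * frob x.

(** Courant-Fischer on the $d$-dimensional column space of [Xs], where the quadratic form of [Y] is
    at least $n\beta-\beta-t$; [mu] is the eigenvalue with the diagonal shift undone. *)
Lemma top_eigenvectors_lower (U : 'M[R]_(N, d)) : top_eigenvectors Y U ->
  U^T *m U = 1%:M /\ exists2 mu : 'I_d -> R,
    (forall a, Y *m col a U = (mu a - beta) *: col a U) &
    (forall a, n%:R * beta - t <= mu a).
Proof.
move=> [V [l [f [VV YV finj ltop ->]]]].
have UU : (colsub f V)^T *m colsub f V = 1%:M.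
  apply/matrixP => a b.
  have := congr1 (fun M : 'M[R]_N => M (f a) (f b)) VV; rewrite !mxE (inj_eq finj) => <-.
  by apply: eq_bigr => k _; rewrite !mxE.
split=> //; exists (fun a => l 0 (f a) + beta) => a.
  rewrite addrK; have -> : col a (colsub f V) = col (f a) V by apply/colP => i; rewrite !mxE.
  rewrite [in LHS]colE mulmxA YV -[LHS]colE; apply/colP => i.
  rewrite !mxE (bigD1 (f a))//= [X in _ + X]big1 ?addr0 => [|j ja].
    by rewrite !mxE eqxx mulr1n mulrC.
  by rewrite !mxE (negbTE ja) mulr0.
rewrite leNgt; apply/negP => hlt.
(* Some nonzero [Xs *m v^T] is orthogonal to every other top eigenvector; compare Rayleigh quotients. *)
pose D := diag_mx (\row_b (b != a)%:R : 'rV[R]_d).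
have detD : \det (Xs^T *m colsub f V *m D) == 0.
  by rewrite det_mulmx det_diag (bigD1 a)//= mxE eqxx mul0r mulr0.
have /det0P [v vn0 hv] := detD.
pose x := Xs *m v^T.
pose c := V^T *m x.
have cfb b : b != a -> c (f b) 0 = 0.
  move=> ba; have /matrixP/(_ 0 b) := hv.
  rewrite mulmxA mul_mx_diag mxE [(\row_b0 _) 0 b]mxE ba mulr1 [RHS]mxE => <-.
  transitivity ((V^T *m (Xs *m v^T))^T 0 (f b)); first by rewrite [RHS]mxE.
  rewrite !trmx_mul !trmxK -mulmxA [LHS]mxE [RHS]mxE; apply: eq_bigr => i _.
  congr (_ * _); rewrite [LHS]mxE [RHS]mxE; apply: eq_bigr => k _.
  by rewrite [colsub f V k b]mxE.
have sc : sqn c = sqn x by rewrite sqn_orthl// trmxK mulmx1C.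
have xV : x = V *m c by rewrite mulmxA (mulmx1C VV) mul1mx.
have ray : ip x (Y *m x) <= l 0 (f a) * sqn x.
  have -> : Y *m x = V *m (diag_mx l *m c) by rewrite {1}xV mulmxA YV mulmxA.
  have cT : c^T = x^T *m V by rewrite [LHS]trmx_mul trmxK.
  have ipV z : ip x (V *m z) = ip c z by rewrite !ip_trace cT mulmxA.
  rewrite ipV -sc /ip /sqn mulr_sumr; apply: ler_sum => b _; rewrite !big_ord1.
  have -> : (diag_mx l *m c) b ord0 = l 0 b * c b ord0 by rewrite mul_diag_mx mxE.
  rewrite mulrCA -expr2.
  have [cb|cb] := boolP (b \in codom f); last by rewrite ler_wpM2r ?sqr_ge0// ltop.
  have /codomP[b' bE] := cb; rewrite bE.
  have [->//|ba] := eqVneq b' a.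
  by rewrite cfb// expr0n !mulr0.
have xpos : 0 < sqn x.
  rewrite lt0r sqn_ge0 andbT sqn_SOn_mul mulf_neq0 ?pnatr_eq0 -?lt0n//.
  rewrite sqn_tr -frob_sqr sqrf_eq0; apply: contra vn0 => /eqP h.
  by rewrite (frob_eq0 h).
have ipW : - (t * sqn x) <= ip x (W *m x).
  rewrite lerNl; apply: le_trans (_ : `|ip x (W *m x)| <= _).
    by rewrite -normrN ler_norm.
  apply: le_trans (ip_cauchy _ _) _; rewrite -frob_sqr expr2 mulrCA.
  by rewrite ler_wpM2l ?frob_ge0.
have ipY : ip x (Y *m x) = (n%:R * beta - beta) * sqn x + ip x (W *m x).
  rewrite YE !mulmxDl mulNmx mul_scalar_mx -scalemxAl.
  have -> : Xs *m Xs^T *m x = n%:R *: x.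
    by rewrite /x !mulmxA -(mulmxA Xs) gram_SOn mul_mx_scalar scalemxAl.
  rewrite !ip_trace !mulmxDr mulmxN -!scalemxAr !mxtraceD raddfN/= !mxtraceZ -!ip_trace ipxx.
  by ring.
have : (n%:R * beta - beta - t) * sqn x <= l 0 (f a) * sqn x.
  by apply: le_trans ray; rewrite ipY; lra.
by rewrite ler_pM2r//; move: hlt; lra.
Qed.

(** The shift $-\beta$ cancels on both sides of the eigenvalue equation, leaving
    $\phi=(\beta/\mu)Xy+\mu^{-1}W\phi$. Substituting this into its own last term gives a truncated
    Neumann series. *)
Lemma eigenvector_expansion (phi : 'cV[R]_N) mu K : mu != 0 ->
  Y *m phi = (mu - beta) *: phi ->
  phi = \sum_(k < K) (beta / mu ^+ k.+1) *: (power_iterate Xs k W *m (Xs^T *m phi))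
        + (mu ^+ K)^-1 *: iter K (mulmx W) phi.
Proof.
move=> mu0 hphi; set y := Xs^T *m phi.
have fix_phi : phi = (beta / mu) *: (Xs *m y) + mu^-1 *: (W *m phi).
  have : mu *: phi = beta *: (Xs *m y) + W *m phi.
    apply: (addIr (- (beta *: phi))); rewrite -scalerBl -hphi YE.
    by rewrite !mulmxDl mulNmx mul_scalar_mx -scalemxAl mulmxA.
  move=> h; rewrite -[LHS](scalerK mu0) h scalerDr scalerA.
  by rewrite [mu^-1 * _]mulrC.
elim: K => [|K IH]; first by rewrite big_ord0 add0r expr0 invr1 scale1r.
rewrite big_ord_recr/= -addrA {1}IH; congr (_ + _).
have iterW k z : iter k (mulmx W) (Xs *m z) = power_iterate Xs k W *m z :> 'cV[R]_N.
  by elim: k => [//|k IHk]; rewrite iterS IHk mulmxA.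
have iterlin k (a b : R) (u v : 'cV[R]_N) : iter k (mulmx W) (a *: u + b *: v) =
    a *: iter k (mulmx W) u + b *: iter k (mulmx W) v.
  by elim: k => [//|k IHk]; rewrite !iterS IHk mulmxDr -!scalemxAr.
rewrite {1}fix_phi iterlin scalerDr !scalerA iterW -iterSr; congr (_ *: _ + _ *: _).
  by rewrite exprS invfM [LHS]mulrC mulrA.
by rewrite exprS invfM [LHS]mulrC.
Qed.

Hypothesis rho_t : 20 * t <= n%:R * beta.
Hypothesis iterates : forall k i, (k < n)%N ->
  frob (cb (power_iterate Xs k W) i) <= Num.sqrt d%:R * (5 * t) ^+ k.

Lemma geometric_tail (z : R) m : 0 <= z <= 2^-1 -> \sum_(1 <= k < m) z ^+ k <= 2 * z.
Proof.
move=> /andP[z0 z1].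
have h k : \sum_(1 <= k < k.+1) z ^+ k <= 2 * z - 2 * z ^+ k.+1.
  elim: k => [|k IH]; first by rewrite big_nil expr1 subrr.
  rewrite big_nat_recr//=; apply: le_trans (lerD IH (lexx _)) _.
  have : 0 <= z ^+ k.+1 by rewrite exprn_ge0.
  by rewrite (exprS z k.+1); nra.
case: m => [|m]; first by rewrite big_geq// mulr_ge0.
by apply: le_trans (h m) _; rewrite gerBl mulr_ge0// exprn_ge0.
Qed.

Lemma sqrt_le_pow2 m : (0 < m)%N -> Num.sqrt m%:R * (2^-1) ^+ m.-1 <= 1 :> R.
Proof.
move=> m0; have h : m%:R <= (2 ^+ m.-1) ^+ 2 :> R.
  rewrite -exprM -natrX ler_nat; case: m m0 => // m _ /=.
  by elim: m => // m IH; rewrite mulSn expnD; lia.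
rewrite exprVn ler_pdivrMr ?exprn_gt0// mul1r.
by rewrite -(@ler_sqr R) ?nnegrE ?exprn_ge0// sqr_sqrtr.
Qed.

Lemma iter_norm k (phi : 'cV[R]_N) : frob (iter k (mulmx W) phi) <= t ^+ k * frob phi.
Proof.
elim: k => [|k IH]; first by rewrite expr0 mul1r.
rewrite iterS; apply: le_trans (opW _) _.
by rewrite exprS -mulrA ler_wpM2l.
Qed.

(** The term $k=0$ is the approximation itself. The later terms form a geometric series of ratio
    $z=5t/\mu\le10t/(n\beta)$ and give $40=2\cdot2\cdot10$. The remainder is controlled only in
    global norm, which costs $\sqrt n$; after $n$ steps $(t/\mu)^{n-1}\le2^{-(n-1)}$ absorbs that,
    leaving the other 2. *)
Lemma eigenvector_block (phi : 'cV[R]_N) mu i : n%:R * beta - t <= mu ->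
  frob phi = Num.sqrt n%:R -> Y *m phi = (mu - beta) *: phi ->
  frob (cb phi i - cb Xs i *m ((beta / mu) *: (Xs^T *m phi))) <=
  42 * Num.sqrt d%:R * t / (n%:R * beta).
Proof.
move=> hmu nphi hphi.
have n1 : 1 <= n%:R :> R by rewrite ler1n.
have := rho_t; set rho := n%:R * beta in hmu * => hrho.
have rho0 : 0 < rho by rewrite mulr_gt0// ltr0n.
have mupos : 0 < mu by lra.
have murho : rho / 2 <= mu by lra.
have tmu : t * rho <= t * (2 * mu) by rewrite ler_wpM2l//; lra.
set y := Xs^T *m phi.
have ny : frob y <= n%:R.
  by apply: le_trans (frob_tr_SOn_mul _) _; rewrite nphi -expr2 sqr_sqrtr.
have sd : 1 <= Num.sqrt d%:R :> R by rewrite -[leLHS]sqrtr1 ler_sqrt// ler1n.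
pose z := 5 * t / mu.
have z0 : 0 <= z by rewrite divr_ge0 ?mulr_ge0// ltW.
have zrho : z <= 10 * t / rho.
  by rewrite /z ler_pdivrMr// mulrAC ler_pdivlMr//; lra.
have zhalf : z <= 2^-1.
  by rewrite /z ler_pdivrMr//; lra.
rewrite {1}(eigenvector_expansion n.-1.+1 (lt0r_neq0 mupos) hphi).
rewrite big_ord_recl.
have -> : (mu ^+ n.-1.+1)^-1 *: iter n.-1.+1 (mulmx W) phi =
  (mu ^+ n)^-1 *: iter n (mulmx W) phi by rewrite prednK.
rewrite (_ : cb _ i - _ = cb (\sum_(k < n.-1) (beta / mu ^+ (lift ord0 k).+1) *:
     (power_iterate Xs (lift ord0 k) W *m y)) i +
   cb ((mu ^+ n)^-1 *: iter n (mulmx W) phi) i); last first.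
  rewrite !submxcolD -[power_iterate Xs (@ord0 _) W]/Xs expr1 scalemxAr -submxcol_mul.
  by rewrite [LHS]addrC !addrA addNr add0r.
apply: le_trans (frobD _ _) _.
have tail : frob (cb ((mu ^+ n)^-1 *: iter n (mulmx W) phi) i) <= 2 * Num.sqrt d%:R * t / rho.
  apply: le_trans (frob_block_le _ _) _; rewrite frobZ ger0_norm; last by rewrite invr_ge0 exprn_ge0// ltW.
  apply: le_trans (_ : (mu ^+ n)^-1 * (t ^+ n * Num.sqrt n%:R) <= _).
    by rewrite ler_wpM2l ?invr_ge0 ?exprn_ge0 ?(ltW mupos)// -nphi iter_norm.
  rewrite mulrA -exprVn -exprMn -(prednK n0) exprS prednK// -[leLHS]mulrA.
  have tm : mu^-1 * t <= 2 * t / rho.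
    by rewrite mulrC ler_pdivrMr// mulrAC ler_pdivlMr//; lra.
  have tm0 : 0 <= mu^-1 * t by rewrite mulr_ge0// invr_ge0 ltW.
  have tmh : mu^-1 * t <= 2^-1.
    by rewrite mulrC ler_pdivrMr//; lra.
  apply: le_trans (_ : 2 * t / rho * 1 <= _).
    apply: ler_pM => //; first by rewrite mulr_ge0 ?exprn_ge0.
    apply: le_trans (sqrt_le_pow2 n0); rewrite mulrC ler_wpM2l//.
    by apply: lerXn2r; rewrite ?nnegrE.
  by rewrite mulr1 -!mulrA ler_pM2l// ler_peMl// divr_ge0// ltW.
have head : frob (cb (\sum_(k < n.-1) (beta / mu ^+ (lift ord0 k).+1) *:
     (power_iterate Xs (lift ord0 k) W *m y)) i) <= 40 * Num.sqrt d%:R * t / rho.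
  rewrite submxcol_sum; apply: le_trans (frob_sum _ _ _) _.
  apply: le_trans (_ : \sum_(k < n.-1) 2 * Num.sqrt d%:R * z ^+ k.+1 <= _).
    apply: ler_sum => k _.
    have -> : cb ((beta / mu ^+ (lift ord0 k).+1) *: (power_iterate Xs (lift ord0 k) W *m y)) i =
        (beta / mu ^+ k.+2) *: (cb (power_iterate Xs k.+1 W) i *m y).
      by rewrite submxcol_mul; apply/matrixP => a b; rewrite !mxE.
    rewrite frobZ ger0_norm; last by rewrite divr_ge0 ?exprn_ge0// ltW.
    apply: le_trans (_ : beta / mu ^+ k.+2 * (Num.sqrt d%:R * (5 * t) ^+ k.+1 * n%:R) <= _).
      rewrite ler_wpM2l ?divr_ge0 ?exprn_ge0 ?(ltW mupos) ?(ltW beta0)//.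
      apply: le_trans (frobM _ _) _; apply: ler_pM => //; rewrite ?frob_ge0//.
      by apply: iterates; rewrite -ltn_predRL.
    have -> : beta / mu ^+ k.+2 * (Num.sqrt d%:R * (5 * t) ^+ k.+1 * n%:R) =
        (rho / mu) * (Num.sqrt d%:R * z ^+ k.+1).
      rewrite /z expr_div_n (exprS mu k.+1) /rho; field.
      by rewrite expf_neq0 !gt_eqF.
    rewrite -[leRHS]mulrA ler_wpM2r ?mulr_ge0 ?exprn_ge0//.
    by rewrite ler_pdivrMr//; lra.
  rewrite -mulr_sumr -!mulrA (_ : 40 * _ = 2 * (Num.sqrt d%:R * (2 * (10 * t / rho)))); last by field; rewrite gt_eqF.
  rewrite ler_pM2l// ler_wpM2l//.
  have -> : \sum_(k < n.-1) z ^+ k.+1 = \sum_(1 <= k < n) z ^+ k.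
    by rewrite -[in RHS](prednK n0) big_add1/= big_mkord.
  by apply: le_trans (geometric_tail _ _) _; rewrite ?z0// ler_pM2l.
by apply: le_trans (lerD head tail) _; lra.
Qed.

(** The columns are treated one by one, and collecting $d$ of them gives a second $\sqrt d$. *)
Lemma eigenspace_blocks (U : 'M[R]_(N, d)) : top_eigenvectors Y U ->
  U^T *m U = 1%:M /\ exists Q : 'M[R]_d, forall i,
    frob (cb (Num.sqrt n%:R *: U) i - cb Xs i *m Q) <= 42 * d%:R * t / (n%:R * beta).
Proof.
move=> /top_eigenvectors_lower [UU [mu YU hmu]]; split=> //.
pose phi a := Num.sqrt n%:R *: col a U.
exists (\matrix_(i, a) ((beta / mu a) *: (Xs^T *m phi a)) i 0) => i.
set eta := 42 * Num.sqrt d%:R * t / (n%:R * beta).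
have eta0 : 0 <= eta.
  by apply: divr_ge0; [rewrite !mulr_ge0 | rewrite mulr_ge0// ltW].
have -> : 42 * d%:R * t / (n%:R * beta) = Num.sqrt d%:R * eta.
  by rewrite /eta -{1}(@sqr_sqrtr _ d%:R)//; ring.
rewrite frob_le_sqr; last exact: mulr_ge0.
have -> : (Num.sqrt d%:R * eta) ^+ 2 = d%:R * eta ^+ 2.
  by rewrite -[in RHS](@sqr_sqrtr _ d%:R)//; ring.
apply: sqn_cols_bound => // a.
have -> : col a (cb (Num.sqrt n%:R *: U) i - cb Xs i *m
    (\matrix_(i, a) ((beta / mu a) *: (Xs^T *m phi a)) i 0)) =
    cb (phi a) i - cb Xs i *m ((beta / mu a) *: (Xs^T *m phi a)).
  apply/colP => b; rewrite !mxE; congr (_ - _).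
  by apply: eq_bigr => k _; rewrite !mxE.
apply: eigenvector_block => //.
  have ua : sqn (col a U) = 1.
    rewrite sqn_trace [X in \tr X](_ : _ = 1%:M) ?mxtrace1//.
    apply/matrixP => x y; have := congr1 (fun M : 'M[R]_d => M a a) UU.
    rewrite !mxE eqxx !ord1 eqxx => <-; apply: eq_bigr => k _.
    by rewrite !mxE.
  by rewrite frobZ frobE ua sqrtr1 mulr1 ger0_norm.
by rewrite -scalemxAr YU !scalerA mulrC.
Qed.

End Spectral.

(** * Rounding to the rotation group *)

Section NearOrthogonal.
Variable R : realType.

Lemma sqn_col_mx m1 m2 k (A : 'M[R]_(m1, k)) (B : 'M[R]_(m2, k)) :
  sqn (col_mx A B) = sqn A + sqn B.
Proof.
rewrite /sqn big_split_ord; congr (_ + _); apply: eq_bigr => i _; apply: eq_bigr => j _.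
  by rewrite col_mxEu.
by rewrite col_mxEd.
Qed.

Lemma sqn_row_mx m k1 k2 (A : 'M[R]_(m, k1)) (B : 'M[R]_(m, k2)) :
  sqn (row_mx A B) = sqn A + sqn B.
Proof. by rewrite -sqn_tr tr_row_mx sqn_col_mx !sqn_tr. Qed.

Lemma sqn_block_mx m1 m2 k1 k2 (A : 'M[R]_(m1, k1)) (B : 'M[R]_(m1, k2))
    (C : 'M[R]_(m2, k1)) (D : 'M[R]_(m2, k2)) :
  sqn (block_mx A B C D) = sqn A + sqn B + (sqn C + sqn D).
Proof. by rewrite sqn_col_mx !sqn_row_mx. Qed.

Lemma frob_block_mx m1 m2 k1 k2 (A : 'M[R]_(m1, k1)) (B : 'M[R]_(m1, k2))
    (C : 'M[R]_(m2, k1)) (D : 'M[R]_(m2, k2)) :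
  [/\ frob A <= frob (block_mx A B C D), frob B <= frob (block_mx A B C D)
    & frob D <= frob (block_mx A B C D)].
Proof.
have := sqn_ge0 A; have := sqn_ge0 B; have := sqn_ge0 C; have := sqn_ge0 D.
by split; rewrite frob_le sqn_block_mx; lra.
Qed.

Lemma mulmx_col_row m (v w : 'cV[R]_m) : v^T *m w = (ip v w)%:M.
Proof. by rewrite [LHS]mx11_scalar ip_trace /mxtrace big_ord1. Qed.

(** The reflection along $v=r-|r|e$ works because $r$ and $|r|e$ have equal norm, hence $2\langle
    v,r\rangle=|v|^2$. If $v=0$ the identity serves. *)
Lemma householder m (r e : 'cV[R]_m) : sqn e = 1 ->
  exists G : 'M[R]_m, G^T *m G = 1%:M /\ G *m r = frob r *: e.
Proof.
move=> e1; set al := frob r; pose v := r - al *: e.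
have [v0|vn0] := eqVneq (sqn v) 0.
  exists 1%:M; rewrite trmx1 !mul1mx; split=> //.
  have : v = 0 by apply: frob_eq0; rewrite frobE v0 sqrtr0.
  by move=> /eqP; rewrite subr_eq0 => /eqP.
have ipv : 2 * ip v r = sqn v.
  have := sqnD v (al *: e); rewrite /v subrK -/v.
  have := sqnD r (- (al *: e)); rewrite -/v.
  have -> : sqn (- (al *: e)) = sqn r.
    by rewrite -frob_sqr frobN frobZ exprMn (frob_sqr e) e1 mulr1 ger0_norm ?frob_ge0// frob_sqr.
  have -> : ip v r = sqn r + ip r (- (al *: e)).
    by rewrite ipC /v !ip_trace mulmxDr raddfD/= -!ip_trace.
  by move=> -> _; ring.
pose c := 2 / sqn v.
pose G := 1%:M - c *: (v *m v^T).
have GT : G^T = G by rewrite /G raddfB/= trmx1 linearZ/= trmx_mul trmxK.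
exists G; split.
  rewrite GT /G mulmxBl mul1mx mulmxBr mulmx1 -scalemxAl -!scalemxAr scalerA.
  rewrite mulmxA -(mulmxA v) mulmx_col_row ipxx mul_mx_scalar -scalemxAl scalerA.
  rewrite (_ : c * c * sqn v = c + c); last by rewrite /c; field.
  by rewrite scalerDl opprB addrK subrK.
rewrite /G mulmxBl mul1mx -scalemxAl -mulmxA mulmx_col_row mul_mx_scalar scalerA.
rewrite (_ : c * ip v r = 1); last by rewrite /c mulrAC ipv divff.
by rewrite scale1r /v subKr.
Qed.

(* Induction on [d]: a reflection makes the first column a multiple of the first basis vector. *)
Lemma near_orthogonal d : exists2 C : R, 2 <= C &
  forall (A : 'M[R]_d) (delta : R), C * delta <= 1 -> frob (A^T *m A - 1%:M) <= delta ->
  exists2 Q : 'M[R]_d, Q^T *m Q = 1%:M & frob (A - Q) <= C * delta.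
Proof.
elim: d => [|d [C C2 IH]].
  exists 2 => // A delta _ hA; exists A; first by apply/matrixP => -[].
  rewrite subrr frob0 mulr_ge0//; exact: le_trans (frob_ge0 _) hA.
(* After the reflection the corner is within $\delta$ of 1, the rest of its row is at most
   $2\delta$, and the remaining block has Gram defect at most $5\delta$: in total
   $\delta+2\delta+5C\delta$. *)
exists (5 * C + 3); first lra.
rewrite -[d.+1]/(1 + d)%N => A delta hd hA.
have delta0 : 0 <= delta by apply: le_trans hA; exact: frob_ge0.
have dhalf : delta <= 2^-1 by nra.
pose e : 'cV[R]_(1 + d) := col_mx 1%:M 0.
have e1 : sqn e = 1.
  by rewrite sqn_col_mx sqn_scalar expr1n mul1r -(frob_sqr 0) frob0 expr0n addr0.
have [G [GG Gr]] := householder (lsubmx A) e1.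
set al := frob (lsubmx A) in Gr.
pose B := G *m A.
have lB : lsubmx B = col_mx al%:M 0.
  by rewrite -mulmx_lsub Gr /e scale_col_mx scaler0 scalemx1.
pose s := ursubmx B; pose A' := drsubmx B.
have BE : B = block_mx al%:M s 0 A'.
  rewrite -[LHS]submxK; congr block_mx.
    have -> : ulsubmx B = usubmx (lsubmx B) by apply/matrixP => i j; rewrite !mxE.
    by rewrite lB col_mxKu.
  have -> : dlsubmx B = dsubmx (lsubmx B) by apply/matrixP => i j; rewrite !mxE.
  by rewrite lB col_mxKd.
have BB : B^T *m B = A^T *m A by rewrite trmx_mul mulmxA -(mulmxA _ G^T) GG mulmx1.
have gram : A^T *m A - 1%:M = block_mx (al ^+ 2 - 1)%:M (al *: s) (al *: s^T)
    (A'^T *m A' - 1%:M + s^T *m s).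
  rewrite -BB BE tr_block_mx mulmx_block tr_scalar_mx trmx0 !mul0mx !mulmx0 !addr0.
  rewrite -scalar_mxM mul_scalar_mx mul_mx_scalar -expr2.
  rewrite (@scalar_mx_block _ 1 d 1) opp_block_mx add_block_mx !oppr0 !addr0.
  rewrite -raddfB/=; congr block_mx.
  by rewrite [RHS]addrAC (addrC (s^T *m s)).
have [h1 h2 h3] := frob_block_mx (al ^+ 2 - 1)%:M (al *: s) (al *: s^T)
    (A'^T *m A' - 1%:M + s^T *m s).
rewrite -gram in h1 h2 h3.
have al0 : 0 <= al by exact: frob_ge0.
have al2 : `|al ^+ 2 - 1| <= delta.
  apply: le_trans (le_trans h1 hA).
  by have := le_entry_frob ((al ^+ 2 - 1)%:M : 'M[R]_1) 0 0; rewrite mxE eqxx mulr1n.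
have alhalf : 2^-1 <= al by move: al2; rewrite ler_norml => /andP[]; nra.
have al1 : `|al - 1| <= delta.
  apply: le_trans al2; rewrite (_ : al ^+ 2 - 1 = (al - 1) * (al + 1)); last by ring.
  by rewrite normrM ler_peMr// ger0_norm; lra.
have hs : frob s <= 2 * delta.
  have := le_trans h2 hA; rewrite frobZ ger0_norm//.
  by have := frob_ge0 s; nra.
have hA' : frob (A'^T *m A' - 1%:M) <= 5 * delta.
  have -> : A'^T *m A' - 1%:M = (A'^T *m A' - 1%:M + s^T *m s) - s^T *m s by rewrite addrK.
  apply: le_trans (frobB _ _) _.
  have := frobM s^T s; rewrite frob_tr; have := le_trans h3 hA.
  by have := frob_ge0 s; nra.
have [|Q' QQ' hQ'] := IH A' (5 * delta) _ hA'; first by lra.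
pose K : 'M[R]_(1 + d) := block_mx 1%:M 0 0 Q'.
have KK : K^T *m K = 1%:M.
  rewrite tr_block_mx mulmx_block !trmx0 !mul0mx !mulmx0 !addr0 add0r trmx1 mulmx1 QQ'.
  by rewrite -scalar_mx_block.
exists (G^T *m K).
  by rewrite trmx_mul trmxK mulmxA -(mulmxA _ G) (mulmx1C GG) mulmx1.
have -> : A - G^T *m K = G^T *m (B - K) by rewrite mulmxBr mulmxA GG mul1mx.
rewrite frob_orthl ?trmxK ?(mulmx1C GG)// BE.
rewrite opp_block_mx add_block_mx subrr subr0 -raddfB/=.
have -> : block_mx (al - 1)%:M s 0 (A' - Q') =
    block_mx (al - 1)%:M 0 0 0 + block_mx 0 s 0 0 + block_mx 0 0 0 (A' - Q').
  by rewrite !add_block_mx !add0r !addr0.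
have n0 m k : sqn (0 : 'M[R]_(m, k)) = 0 by rewrite -frob_sqr frob0 expr0n.
apply: le_trans (frobD _ _) _; apply: le_trans (lerD (frobD _ _) (lexx _)) _.
rewrite !frobE !sqn_block_mx !n0 !addr0 !add0r -!frobE.
have -> : frob ((al - 1)%:M : 'M[R]_1) = `|al - 1|.
  by rewrite frobE sqn_scalar mulr1 sqrtr_sqr.
by move: al1 hs hQ'; lra.
Qed.

(* [A^T B] is orthogonal of determinant -1, so it has the eigenvalue -1. *)
Lemma frob_opposite_det d (A B : 'M[R]_d) : SO R d A -> B^T *m B = 1%:M -> \det B = -1 ->
  2 <= frob (A - B).
Proof.
move=> SA BB dB; pose C := A^T *m B.
have CC : C^T *m C = 1%:M.
  by rewrite trmx_mul trmxK mulmxA -(mulmxA _ A) (mulmx1C (SO_orth SA)) mulmx1.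
have dC : \det C = -1 by rewrite det_mulmx dB; case: (SO_tr SA) => _ ->; rewrite mul1r.
have : \det (1%:M + C) == 0.
  have : \det (C^T *m (1%:M + C)) = \det (1%:M + C).
    by rewrite mulmxDr mulmx1 CC -[RHS]det_tr raddfD/= trmx1 addrC.
  by rewrite det_mulmx det_tr dC => h; apply/eqP; lra.
move=> /det0P[v vn0]; rewrite mulmxDr mulmx1 => /eqP; rewrite addr_eq0 => /eqP vC.
have -> : frob (A - B) = frob (1%:M - C).
  by rewrite -(frob_orthl (1%:M - C) (SO_orth SA)) mulmxBr mulmx1 mulmxA (mulmx1C (SO_orth SA)) mul1mx.
have := frobM v (1%:M - C).
have vC' : v *m C = - v by rewrite {2}vC opprK.
have -> : v *m (1%:M - C) = 2 *: v.
  by rewrite mulmxBr mulmx1 vC' opprK scaler_nat mulr2n.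
rewrite frobZ ger0_norm// mulrC ler_pM2l// lt0r frob_ge0 andbT.
by apply: contra vn0 => /eqP /frob_eq0 ->.
Qed.

End NearOrthogonal.

Section Rounding.
Variables (R : realType) (n d : nat) (Xs : 'M[R]_(\sum_(i < n) d, d)).
Hypothesis SXs : SOn R n d Xs.
Hypothesis n0 : (0 < n)%N.
Hypothesis d0 : (0 < d)%N.
Local Notation N := (\sum_(i < n) d)%N.
Local Notation cb := (submxcol (p_ := fun=> d)).

(** The constraint set is a product, so changing one block of the projection gives a competitor and
    minimality holds blockwise. The triangle inequality then doubles $\kappa$. *)
Lemma projection_close (Z Zt : 'M[R]_(N, d)) (Q : 'M[R]_d) kappa : SO R d Q ->
  (forall i, frob (cb Z i - cb Xs i *m Q) <= kappa) -> is_proj (SOn R n d) Z Zt ->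
  (forall i, frob (cb Zt i - cb Xs i *m Q) <= 2 * kappa) /\
  frob (Zt - Z) <= Num.sqrt n%:R * kappa.
Proof.
move=> SQ hZ [SZt hmin].
have SXQ i : SO R d (cb Xs i *m Q) by apply: SO_mul => //; exact: SXs.
have hblock i : frob (cb Z i - cb Zt i) <= frob (cb Z i - cb Xs i *m Q).
  pose Z' : 'M[R]_(N, d) := \mxcol_(j < n) (if j == i then cb Xs i *m Q else cb Zt j).
  have SZ' : SOn R n d Z'.
    move=> j; rewrite /block mxcolK; case: ifP => _ //; exact: SZt.
  have := hmin Z' SZ'; rewrite !frob_le !sqn_blocks.
  rewrite (bigD1 i)//= [X in _ <= X -> _](bigD1 i)//= !submxcolB mxcolK eqxx.
  rewrite [X in _ <= _ + X -> _](eq_bigr (fun j => sqn (cb (Z - Zt) j))) ?lerD2r//.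
  by move=> j /negbTE ji; rewrite !submxcolB mxcolK ji.
have k0 : 0 <= kappa by apply: le_trans (hZ (Ordinal n0)); exact: frob_ge0.
split=> [i|].
  have -> : cb Zt i - cb Xs i *m Q = (cb Z i - cb Xs i *m Q) - (cb Z i - cb Zt i).
    by rewrite opprB [RHS]addrC addrA subrK.
  apply: le_trans (frobB _ _) _.
  by have := hZ i; have := hblock i; lra.
rewrite frob_distC; apply: frob_blocks_le => // i; rewrite submxcolB.
exact: le_trans (hblock i) (hZ i).
Qed.

(** Each $X_iQ$ has determinant $-1$ and lies at distance at least 2 from every rotation, so
    rounding moves each block by at least $2-\kappa$. *)
Lemma projection_far (Z Zt : 'M[R]_(N, d)) (Q : 'M[R]_d) kappa :
  Q^T *m Q = 1%:M -> \det Q = -1 -> kappa <= 2 ->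
  (forall i, frob (cb Z i - cb Xs i *m Q) <= kappa) -> is_proj (SOn R n d) Z Zt ->
  Num.sqrt n%:R * (2 - kappa) <= frob (Zt - Z).
Proof.
move=> QQ dQ k2 hZ [SZt _].
have hi i : 2 - kappa <= frob (cb Zt i - cb Z i).
  have h2 : 2 <= frob (cb Zt i - cb Xs i *m Q).
    apply: frob_opposite_det; first exact: SZt.
      by rewrite trmx_mul mulmxA -(mulmxA _ (cb Xs i)^T) (SO_orth (SXs i)) mulmx1.
    by rewrite det_mulmx dQ; have [_ ->] := SXs i; rewrite mul1r.
  have := frobD (cb Zt i - cb Z i) (cb Z i - cb Xs i *m Q).
  by rewrite addrA subrK; have := hZ i; lra.
rewrite -(@ler_sqr R) ?nnegrE ?frob_ge0 ?mulr_ge0 ?subr_ge0// exprMn sqr_sqrtr// frob_sqr sqn_blocks.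
apply: le_trans (_ : \sum_(i < n) (2 - kappa) ^+ 2 <= _).
  by rewrite sumr_const card_ord mulr_natl.
apply: ler_sum => i _; rewrite submxcolB -frob_sqr.
by rewrite ler_sqr ?nnegrE ?frob_ge0 ?subr_ge0.
Qed.

Definition last_flip : 'M[R]_d := diag_mx (\row_(k < d) (if k.+1 == d then -1 else 1)).

Lemma flip_last_colE m (A : 'M[R]_(m, d)) : flip_last_col A = A *m last_flip.
Proof.
apply/matrixP => a k; rewrite mul_mx_diag !mxE.
by case: ifP => _; rewrite ?mulrN1 ?mulr1.
Qed.

Lemma last_flip_orth : last_flip^T *m last_flip = 1%:M.
Proof.
rewrite /last_flip tr_diag_mx mulmx_diag -diag_const_mx; congr diag_mx.
by apply/rowP => k; rewrite !mxE; case: ifP => _; rewrite ?mulrNN mulr1.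
Qed.

Lemma det_last_flip : \det last_flip = -1.
Proof.
have ltd : (d.-1 < d)%N by rewrite prednK.
rewrite det_diag (bigD1 (Ordinal ltd))//= mxE /= prednK// eqxx big1 ?mulr1// => k kd.
rewrite mxE; case: eqP => // kE; case/eqP: kd; apply: val_inj => /=.
exact: (congr1 predn kE).
Qed.

Lemma orth_mul k (A B : 'M[R]_k) : A^T *m A = 1%:M -> B^T *m B = 1%:M ->
  (A *m B)^T *m (A *m B) = 1%:M.
Proof. by move=> hA hB; rewrite trmx_mul mulmxA -(mulmxA _ A^T) hA mulmx1. Qed.

Lemma det_orth k (A : 'M[R]_k) : A^T *m A = 1%:M -> \det A = 1 \/ \det A = -1.
Proof.
move=> hA; have : (\det A) ^+ 2 = 1 by rewrite expr2 -{1}det_tr -det_mulmx hA det1.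
by move=> /eqP; rewrite sqrf_eq1 => /orP[/eqP ->|/eqP ->]; [left|right].
Qed.

(** Exactly one of [Q] and [Q *m last_flip] is a rotation. Rounding moves its candidate by at most
    $\sqrt n\,\kappa$ and the other by at least $\sqrt n(2-\kappa)$; $\kappa<1$ separates the two,
    so the test selects the right one. *)
Lemma spectral_rounding (Y : 'M[R]_N) (X0 : 'M[R]_(N, d)) kappa : kappa < 1 ->
  (forall U, top_eigenvectors Y U -> exists2 Q : 'M[R]_d, Q^T *m Q = 1%:M &
     forall i, frob (cb (Num.sqrt n%:R *: U) i - cb Xs i *m Q) <= kappa) ->
  is_SpectrIn Y X0 ->
  exists2 Q : 'M[R]_d, SO R d Q & forall i, frob (cb X0 i - cb Xs i *m Q) <= 2 * kappa.
Proof.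
move=> k1 hU [U [Phit [Psit [topU pPhi pPsi X0E]]]].
have [Q QQ hQ] := hU U topU.
have hQ' i : frob (cb (Num.sqrt n%:R *: flip_last_col U) i - cb Xs i *m (Q *m last_flip)) <= kappa.
  rewrite flip_last_colE scalemxAl -submxcol_mul mulmxA -mulmxBl.
  by rewrite frob_orthr ?last_flip_orth.
have QQ' := orth_mul QQ last_flip_orth.
have sn : 0 < Num.sqrt n%:R :> R by rewrite sqrtr_gt0 ltr0n.
have k2 : kappa <= 2 by lra.
have [dQ|dQ] := det_orth QQ.
  have SQ : SO R d Q by [].
  have dQ' : \det (Q *m last_flip) = -1 by rewrite det_mulmx dQ det_last_flip mul1r.
  have [h1 h2] := projection_close SQ hQ pPhi.
  have h3 := projection_far QQ' dQ' k2 hQ' pPsi.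
  exists Q => // i; rewrite X0E ifT//.
  apply: le_trans h2 (le_trans _ h3); rewrite ler_pM2l//; lra.
have dQ' : \det (Q *m last_flip) = 1 by rewrite det_mulmx dQ det_last_flip mulrNN mulr1.
have SQ : SO R d (Q *m last_flip) by [].
have [h1 h2] := projection_close SQ hQ' pPsi.
have h3 := projection_far QQ dQ k2 hQ pPhi.
exists (Q *m last_flip) => // i; rewrite X0E ifF//.
apply/negbTE; rewrite -ltNge; apply: le_lt_trans h2 (lt_le_trans _ h3).
by rewrite ltr_pM2l//; lra.
Qed.

Section Alignment.

Lemma continuous_prod (T : topologicalType) (I : finType) (f : I -> T -> R) :
  (forall i, continuous (f i)) -> continuous (fun x => \prod_i f i x).
Proof.
move=> cf; rewrite (_ : (fun x => _) = \prod_i f i); last first.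
  by apply/funext => x; rewrite fct_prodE.
elim/big_ind: _ => [x|g h cg ch x|i _]; [exact: cst_continuous | | exact: cf].
by apply: continuousM; [exact: cg | exact: ch].
Qed.

Lemma continuous_sqn (T : topologicalType) m k (f : T -> 'M[R]_(m, k)) :
  (forall i j, continuous (fun x => f x i j)) -> continuous (fun x => sqn (f x)).
Proof.
move=> cf; apply: continuous_sum => i; apply: continuous_sum => j x.
by apply: (@continuousM _ _ (fun x => f x i j) (fun x => f x i j)); exact: cf.
Qed.

Lemma continuous_det (T : topologicalType) k (f : T -> 'M[R]_k) :
  (forall i j, continuous (fun x => f x i j)) -> continuous (fun x => \det (f x)).
Proof.
move=> cf; apply: continuous_sum => s x.
have cp : continuous (fun x => \prod_i f x i (s i)).
  by apply: continuous_prod => i; exact: cf.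
exact: (continuousM (@cst_continuous _ _ ((-1) ^+ s : R) x) (cp x)).
Qed.

Lemma vec_mx_entry_continuous (i j : 'I_d) :
  continuous (fun v : 'rV[R]_(d * d) => (vec_mx v : 'M[R]_d) i j).
Proof.
rewrite (_ : (fun v => _) = (fun v : 'rV[R]_(d * d) => v 0 (mxvec_index i j))).
  exact: coord_continuous.
by apply/funext => v; rewrite mxE.
Qed.

(** Row vectors give access to the compact cube of [rV_compact], with side fixed by the entry bound
    $\sqrt d$. The nonnegative function [g] merges both defining equations into one closed
    condition. *)
Lemma SO_compact : compact [set v : 'rV[R]_(d * d) | SO R d (vec_mx v)].
Proof.
have boxc : compact [set v : 'rV[R]_(d * d) | forall i, `[- Num.sqrt d%:R, Num.sqrt d%:R]%classic (v ord0 i)].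
  apply: (@rV_compact R (d * d) (fun=> `[- Num.sqrt d%:R, Num.sqrt d%:R]%classic)).
  by move=> i; exact: segment_compact.
apply: subclosed_compact boxc _ => [|v SQ i]; last first.
  rewrite /= in_itv/= -ler_norml.
  case/mxvec_indexP: i => a b; have := le_entry_frob (vec_mx v : 'M[R]_d) a b.
  by rewrite mxE frobE (sqn_SO SQ).
pose M (v : 'rV[R]_(d * d)) : 'M[R]_d := vec_mx v.
pose g v := sqn ((M v)^T *m M v - 1%:M) + (\det (M v) - 1) ^+ 2.
have gE : [set v : 'rV[R]_(d * d) | SO R d (vec_mx v)] = g @^-1` [set x | x = 0].
  apply/seteqP; split=> v /=.
    by move=> [h1 h2]; rewrite /g /M h1 h2 !subrr -frob_sqr frob0 !expr0n addr0.
  have s0 := sqn_ge0 ((M v)^T *m M v - 1%:M); have d1 := sqr_ge0 (\det (M v) - 1).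
  rewrite /g => h.
  have hs : sqn ((M v)^T *m M v - 1%:M) = 0 by lra.
  have /eqP : (\det (M v) - 1) ^+ 2 = 0 by lra.
  rewrite sqrf_eq0 subr_eq0 => /eqP hd; split=> //.
  by apply/eqP; rewrite -subr_eq0; apply/eqP/frob_eq0; rewrite frobE hs sqrtr0.
have cM i j : continuous (fun v => M v i j) by exact: vec_mx_entry_continuous.
rewrite gE; suff cg : continuous g by apply: preimage_closed; [move=> v _; exact: cg | exact: closed_eq].
move=> v.
apply: (@continuousD _ _ _ (fun v => sqn ((M v)^T *m M v - 1%:M)) (fun v => (\det (M v) - 1) ^+ 2)).
  apply: continuous_sqn => i j.
  rewrite (_ : (fun x => _) = (fun x => (\sum_k M x k i * M x k j) - (1%:M : 'M[R]_d) i j)).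
    move=> x; apply: continuousB; last exact: cst_continuous.
    by apply: continuous_sum => k y; apply: continuousM; exact: cM.
  apply/funext => x; rewrite mxE [X in X + _]mxE [X in _ + X]mxE; congr (_ - _).
  by apply: eq_bigr => k _; rewrite [X in X * _]mxE.
have cd : {for v, continuous (fun v => \det (M v) - 1)}.
  by apply: continuousB; [exact: continuous_det | exact: cst_continuous].
exact: (continuousM cd cd).
Qed.

Lemma align_min (X Z : 'M[R]_(N, d)) : SO R d (align X Z) /\
  forall Q, SO R d Q -> frob (X - Z *m align X Z) <= frob (X - Z *m Q).
Proof.
rewrite /align; apply: (@xgetPex _ 1%:M [set Q | SO R d Q /\
    forall Q', SO R d Q' -> frob (X - Z *m Q) <= frob (X - Z *m Q')]).
pose A := [set v : 'rV[R]_(d * d) | SO R d (vec_mx v)].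
pose f (v : 'rV[R]_(d * d)) := sqn (X - Z *m vec_mx v).
have cf : continuous f.
  apply: continuous_sqn => i j.
  rewrite (_ : (fun x => _) = (fun x : 'rV[R]_(d * d) => X i j - \sum_k Z i k * vec_mx x k j)).
    move=> x; apply: continuousB; first exact: cst_continuous.
    apply: continuous_sum => k y; apply: continuousM; first exact: cst_continuous.
    exact: vec_mx_entry_continuous.
  by apply/funext => x; rewrite mxE [X in _ + X]mxE [in LHS]mxE.
have A0 : A !=set0.
  by exists (mxvec 1%:M); rewrite /A /= mxvecK; split; rewrite ?det1// trmx1 mulmx1.
have [c cA hc] := compact_EVT_min A0 SO_compact (continuous_subspaceT cf).
exists (vec_mx c); split; first by have := set_mem cA.
move=> Q SQ; rewrite frob_le; have := hc (mxvec Q); rewrite /f mxvecK; apply.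
by apply/mem_set; rewrite /A /= mxvecK.
Qed.

(** [dist_inf] is evaluated at the Frobenius minimiser, not at [Q]. Both fit [X] within $\sqrt
    n\,\kappa$, and [Xs] is $\sqrt n$ times an isometry, so they differ by at most $2\kappa$; adding
    $\kappa$ gives 3. *)
Lemma dist_bounds (X : 'M[R]_(N, d)) (Q : 'M[R]_d) kappa : SO R d Q ->
  (forall i, frob (cb X i - cb Xs i *m Q) <= kappa) ->
  dist X Xs <= Num.sqrt n%:R * kappa /\ dist_inf X Xs <= 3 * kappa.
Proof.
move=> SQ hQ; have [SA hA] := align_min X Xs.
have k0 : 0 <= kappa by apply: le_trans (hQ (Ordinal n0)); exact: frob_ge0.
have hXQ : frob (X - Xs *m Q) <= Num.sqrt n%:R * kappa.
  by apply: frob_blocks_le => // i; rewrite submxcolB -submxcol_mul.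
have hd : dist X Xs <= Num.sqrt n%:R * kappa by apply: le_trans hXQ; exact: hA.
split=> //.
have hAQ : frob (Q - align X Xs) <= 2 * kappa.
  have sn : 0 < Num.sqrt n%:R :> R by rewrite sqrtr_gt0 ltr0n.
  rewrite -(ler_pM2l sn) -(frob_SOn_mul SXs) mulmxBr.
  have -> : Xs *m Q - Xs *m align X Xs = (X - Xs *m align X Xs) - (X - Xs *m Q).
    by rewrite opprB [RHS]addrC addrA subrK.
  apply: le_trans (frobB _ _) _; rewrite mulrCA; move: hd; rewrite /dist; lra.
apply: bigmax_le => [|i _]; first by rewrite mulr_ge0.
have -> : block X i - block Xs i *m align X Xs =
    (block X i - block Xs i *m Q) + block Xs i *m (Q - align X Xs).
  by rewrite mulmxBr addrA subrK.
apply: le_trans (frobD _ _) _; rewrite (frob_orthl _ (SO_orth (SXs i))).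
by have := hQ i; rewrite /block; lra.
Qed.

End Alignment.
End Rounding.

(** * Deterministic error bound *)

Section Deterministic.
Variables (R : realType) (n d : nat) (Xs : 'M[R]_(\sum_(i < n) d, d)).
Hypothesis SXs : SOn R n d Xs.
Hypothesis n0 : (0 < n)%N.
Hypothesis d0 : (0 < d)%N.
Local Notation N := (\sum_(i < n) d)%N.
Local Notation cb := (submxcol (p_ := fun=> d)).

(** With $E=\Phi-XQ$, and since $\Phi$ and $X$ both have Gram matrix $nI$, $n(Q^\top Q-I)=E^\top
    E-\Phi^\top E-E^\top\Phi$; each of the three terms is at most $nd\kappa$. *)
Lemma almost_orthogonal (U : 'M[R]_(N, d)) (Q : 'M[R]_d) kappa : U^T *m U = 1%:M ->
  0 <= kappa <= 1 ->
  (forall i, frob (cb (Num.sqrt n%:R *: U) i - cb Xs i *m Q) <= kappa) ->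
  frob (Q^T *m Q - 1%:M) <= 3 * d%:R * kappa.
Proof.
move=> UU /andP[k0 k1] hQ.
set Phi := Num.sqrt n%:R *: U in hQ.
have npos : 0 < n%:R :> R by rewrite ltr0n.
have sn0 : 0 <= Num.sqrt n%:R :> R by [].
have snn : Num.sqrt n%:R * Num.sqrt n%:R = n%:R :> R by rewrite -expr2 sqr_sqrtr// ltW.
pose E := Phi - Xs *m Q.
have hE : frob E <= Num.sqrt n%:R * kappa.
  by apply: frob_blocks_le => // i; rewrite submxcolB -submxcol_mul.
have PP : Phi^T *m Phi = n%:R%:M.
  by rewrite /Phi [(_ *: U)^T]linearZ/= -scalemxAl -scalemxAr scalerA UU snn scalemx1.
have fPhi : frob Phi = Num.sqrt n%:R * Num.sqrt d%:R.
  by rewrite frobZ (frob_orth UU) ger0_norm.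
have XQ : Xs *m Q = Phi - E by rewrite subKr.
clearbody E.
have gram : n%:R *: (Q^T *m Q - 1%:M) = E^T *m E - Phi^T *m E - E^T *m Phi.
  have h : n%:R *: (Q^T *m Q) = (Phi - E)^T *m (Phi - E).
    by rewrite -XQ trmx_mul -mulmxA (mulmxA Xs^T) gram_SOn// mul_scalar_mx scalemxAr.
  rewrite scalerBr h scalemx1 -PP [(Phi - E)^T]raddfB/= mulmxBl !mulmxBr.
  by rewrite opprB [LHS]addrAC [X in X + _]addrAC subrr sub0r addrA [- _ + _]addrC.
have sd : 1 <= Num.sqrt d%:R :> R by rewrite -[leLHS]sqrtr1 ler_sqrt// ler1n.
have sdd : Num.sqrt d%:R <= d%:R :> R.
  by rewrite -[leRHS](@sqr_sqrtr _ d%:R)// expr2 ler_peMr// (le_trans ler01).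
suff hn : frob (n%:R *: (Q^T *m Q - 1%:M)) <= n%:R * (3 * d%:R * kappa).
  by move: hn; rewrite frobZ ger0_norm ?(ltW npos)// ler_pM2l.
rewrite gram.
apply: le_trans (frobB _ _) _; apply: le_trans (lerD (frobB _ _) (lexx _)) _.
have e0 := frob_ge0 E.
have h1 : frob (E^T *m E) <= n%:R * kappa.
  apply: le_trans (frobM _ _) _; rewrite frob_tr.
  apply: le_trans (ler_pM e0 e0 hE hE) _.
  by rewrite mulrACA snn ler_pM2l// ler_piMr.
have h2 : frob (Phi^T *m E) <= n%:R * (Num.sqrt d%:R * kappa).
  apply: le_trans (frobM _ _) _; rewrite frob_tr fPhi.
  apply: le_trans (_ : Num.sqrt n%:R * Num.sqrt d%:R * (Num.sqrt n%:R * kappa) <= _).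
    by rewrite ler_wpM2l ?mulr_ge0.
  by rewrite mulrACA snn.
have h3 : frob (E^T *m Phi) <= n%:R * (Num.sqrt d%:R * kappa).
  by rewrite -frob_tr trmx_mul trmxK.
have : n%:R * kappa <= n%:R * (d%:R * kappa).
  by rewrite ler_pM2l// ler_peMl//; exact: le_trans sdd.
have : n%:R * (Num.sqrt d%:R * kappa) <= n%:R * (d%:R * kappa).
  by rewrite ler_pM2l// ler_wpM2r.
by move: h1 h2 h3; lra.
Qed.

(** The smallness hypothesis serves three times: it gives $20t\le n\beta$, it allows [near] on the
    Gram defect $3dk_0$, and it keeps the rounding error below 1. Rounding costs a factor 2 and
    aligning a factor 3. *)
Lemma spectral_estimate (Y W : 'M[R]_N) (X0 : 'M[R]_(N, d)) (beta t C1 : R) :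
  (forall (A : 'M[R]_d) (delta : R), C1 * delta <= 1 -> frob (A^T *m A - 1%:M) <= delta ->
    exists2 Q : 'M[R]_d, Q^T *m Q = 1%:M & frob (A - Q) <= C1 * delta) ->
  0 <= C1 -> 0 < beta -> 0 <= t ->
  Y = beta *: (Xs *m Xs^T) + W - beta%:M ->
  (forall k (x : 'M[R]_(N, k)), frob (W *m x) <= t * frob x) ->
  (forall i k M, (k < n)%N -> 0 <= M -> (forall j, frob (cb (loo_iterate Xs i k W) j) <= M) ->
    frob (cb (W *m loo_iterate Xs i k W) i) <= t * M) ->
  (1 + 3 * d%:R * C1) * (42 * d%:R * (t / (n%:R * beta))) < 1 ->
  is_SpectrIn Y X0 ->
  dist X0 Xs <= Num.sqrt n%:R * (2 * ((1 + 3 * d%:R * C1) * (42 * d%:R * (t / (n%:R * beta)))))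
  /\ dist_inf X0 Xs <= 6 * ((1 + 3 * d%:R * C1) * (42 * d%:R * (t / (n%:R * beta)))).
Proof.
move=> near C10 beta0 t0 YE opW rowW small hX0.
have rho0 : 0 < n%:R * beta by rewrite mulr_gt0// ltr0n.
have d1 : 1 <= d%:R :> R by rewrite ler1n.
set k0 := 42 * d%:R * (t / (n%:R * beta)) in small *.
have tr0 : 0 <= t / (n%:R * beta) by rewrite divr_ge0// ltW.
have k00 : 0 <= k0 by rewrite /k0 mulr_ge0// mulr_ge0.
have dC : 0 <= 3 * d%:R * C1 by rewrite !mulr_ge0.
have k0k : k0 <= 1 by move: small; nra.
have rho_t : 20 * t <= n%:R * beta.
  have : 42 * (t / (n%:R * beta)) <= 1.
    apply: le_trans k0k; rewrite /k0 -!mulrA ler_pM2l// ler_peMl//.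
  by rewrite mulrA ler_pdivrMr// mul1r; lra.
have iterates k i : (k < n)%N ->
    frob (cb (power_iterate Xs k W) i) <= Num.sqrt d%:R * (5 * t) ^+ k.
  move=> kn; have [h _] := loo_bounds SXs t0 opW rowW (ltnW kn); exact: h.
have key U : top_eigenvectors Y U -> exists2 Q : 'M[R]_d, Q^T *m Q = 1%:M &
    forall i, frob (cb (Num.sqrt n%:R *: U) i - cb Xs i *m Q) <= (1 + 3 * d%:R * C1) * k0.
  move=> topU.
  have [UU [A hA]] := eigenspace_blocks SXs n0 d0 YE beta0 t0 opW rho_t iterates topU.
  have {}hA i : frob (cb (Num.sqrt n%:R *: U) i - cb Xs i *m A) <= k0 by rewrite /k0 mulrA.
  have hAA : frob (A^T *m A - 1%:M) <= 3 * d%:R * k0.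
    by apply: almost_orthogonal UU _ hA; rewrite k00.
  have [|Q QQ hQ] := near A _ _ hAA; first by move: small; lra.
  exists Q => // i.
  have -> : cb (Num.sqrt n%:R *: U) i - cb Xs i *m Q =
      (cb (Num.sqrt n%:R *: U) i - cb Xs i *m A) + cb Xs i *m (A - Q).
    by rewrite mulmxBr addrA subrK.
  apply: le_trans (frobD _ _) _; rewrite (frob_orthl _ (SO_orth (SXs i))).
  by have := hA i; move: hQ; lra.
have [Q SQ hQ] := spectral_rounding SXs n0 d0 small key hX0.
have [h1 h2] := dist_bounds SXs n0 SQ hQ.
by split=> //; apply: le_trans h2 _; lra.
Qed.

End Deterministic.

Section Scalars.
Variable R : realType.

Lemma ln2_ge : 2^-1 <= ln 2 :> R.
Proof.
have h : expR (2^-1 : R) <= 2 by apply: le_trans (expR_le_quad (lexx _)) _; lra.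
by rewrite -(expRK 2^-1) ler_ln ?posrE ?expR_gt0.
Qed.

(** Applied to $L=\log n$ it supplies the moment order. *)
Lemma pow2_between (L : R) : 1 <= L -> exists r : nat, L <= (2 ^ r)%:R <= 2 * L.
Proof.
move=> L1.
have ex : exists r : nat, L <= (2 ^ r)%:R.
  have L0 : 0 <= L by exact: le_trans L1.
  have /archi_boundP h := L0.
  exists (Num.bound L); apply: le_trans (ltW h) _.
  by rewrite ler_nat ltnW// ltn_expl.
have [r hr hmin] := ex_minnP ex.
exists r; rewrite hr/=; case: r hr hmin => [|r] _ hmin; first by rewrite expn0; lra.
have : ~~ (L <= (2 ^ r)%:R) by apply/negP => /hmin; rewrite ltnn.
by rewrite -ltNge expnS natrM; lra.
Qed.

Lemma expR_ln_natX (n k : nat) : (0 < n)%N ->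
  expR (- (k%:R * ln n%:R)) = (n%:R ^+ k)^-1 :> R.
Proof. by move=> n0; rewrite expRN expRM_natl lnK// posrE ltr0n. Qed.

End Scalars.

(** * Probability of the exceptional event *)

Lemma measurable_exists (disp : measure_display) (T : measurableType disp) (I : finType)
    (Q : I -> set T) :
  (forall i, measurable (Q i)) -> measurable [set x | exists i, Q i x].
Proof.
move=> mQ; rewrite (_ : [set x | _] = \bigcup_(i in setT) Q i); last first.
  by apply/seteqP; split=> x [i]; [exists i | exists i].
exact: fin_bigcup_measurable.
Qed.

Section Assembly.
Variables (R : realType) (n d : nat) (p q : R).
Variable Xs : 'M[R]_(\sum_(i < n) d, d).
Hypothesis d2 : (2 <= d)%N.
Hypotheses (p01 : 0 < p < 1) (q01 : 0 < q < 1).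
Hypothesis SXs : SOn R n d Xs.
Hypothesis n0 : (0 < n)%N.

Local Notation N := (\sum_(i < n) d)%N.
Local Notation pair := ('I_n * 'I_n)%type.
Local Notation wgt := (@outcome_weight R n d p q).

Let L : R := ln n%:R.
Let S : R := Num.sqrt (n%:R * q * L).
Hypothesis L1 : 1 <= L.
Hypothesis dense : 16 * d%:R * L <= n%:R * q.

Let q0 : 0 < q. Proof. by case/andP: q01. Qed.
Let p0 : 0 < p. Proof. by case/andP: p01. Qed.
Let npos : 0 < n%:R :> R. Proof. by rewrite ltr0n. Qed.
Let dge2 : 2 <= d%:R :> R. Proof. by rewrite ler_nat. Qed.
Let nq0 : 0 < n%:R * q. Proof. exact: mulr_gt0. Qed.
Let S0 : 0 < S. Proof. by rewrite sqrtr_gt0 mulr_gt0//; apply: lt_le_trans L1. Qed.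
Let S2 : S ^+ 2 = n%:R * q * L.
Proof. by rewrite sqr_sqrtr// mulr_ge0 ?(ltW nq0)// (le_trans _ L1). Qed.

(** Its square $16de^8$ makes the base of the $m$-th power in [prob_bad_norm] at most $e^{-4}$ when
    $m\le2L$; with $m\ge L$ the power is at most $n^{-4}$, which beats the prefactor $dn^2$. *)
Definition norm_factor : R := 4 * expR 4 * Num.sqrt d%:R.
(** With $s=L/S$ the exponent of [prob_bad_row] is $8dL-(8d+5)L=-5L$, that is $2n^{-5}$ for each of
    $n^2d^2$ events. *)
Definition row_factor : R := 8 * d%:R + 5.

Definition bad_event r (l : {ffun pair -> option bool}) : set (array_space R n d) :=
  [set O | bad_norm p q Xs r (norm_factor * S) l O \/
     exists x : 'I_n * 'I_n * ('I_d * 'I_d),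
       bad_row p q Xs (row_factor * S) x.1.1 x.1.2 x.2.1 x.2.2 l O].

Lemma measurable_bad_event r l : measurable (bad_event r l).
Proof.
apply: measurableU; first exact: measurable_bad_norm.
by apply: measurable_exists => x; exact: measurable_bad_row.
Qed.

Lemma prob_bad_event r (O : 'I_n -> 'I_n -> 'M[R]_d) : L <= (2 ^ r)%:R <= 2 * L ->
  (forall i j, SO R d (O i j)) ->
  \sum_w pw wgt w * (`[< bad_event r [ffun e => (w e).1] (twist (fun e => (w e).2) O) >])%:R
  <= 3 * d%:R ^+ 2 / n%:R.
Proof.
move=> /andP[mL m2L] SO_O.
have wgt0 e x : 0 <= wgt e x by exact: outcome_weight_ge0.
set m := (2 ^ r)%N in mL m2L.
have m0 : (0 < m)%N by rewrite expn_gt0.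
have mpos : 0 < m%:R :> R by rewrite ltr0n.
pose lb (w : {ffun pair -> outcome d}) : {ffun pair -> option bool} := [ffun e => (w e).1].
pose tw (w : {ffun pair -> outcome d}) := twist (fun e => (w e).2) O.
have split_bad : \sum_w pw wgt w * (`[< bad_event r (lb w) (tw w) >])%:R <=
    \sum_w pw wgt w * (`[< bad_norm p q Xs r (norm_factor * S) (lb w) (tw w) >])%:R +
    \sum_(x : 'I_n * 'I_n * ('I_d * 'I_d)) \sum_w pw wgt w *
      (`[< bad_row p q Xs (row_factor * S) x.1.1 x.1.2 x.2.1 x.2.2 (lb w) (tw w) >])%:R.
  rewrite exchange_big/= -big_split/=; apply: ler_sum => w _.
  rewrite -mulr_sumr -mulrDr ler_wpM2l ?pw_ge0//.
  have sum0 : 0 <= \sum_(x : 'I_n * 'I_n * ('I_d * 'I_d))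
    (`[< bad_row p q Xs (row_factor * S) x.1.1 x.1.2 x.2.1 x.2.2 (lb w) (tw w) >])%:R :> R.
    exact: sumr_ge0.
  case: asboolP => [[hb|[x hb]]|_]; last by rewrite addr_ge0.
    by rewrite asboolT// lerDl.
  rewrite (bigD1 x)//= (asboolT hb).
  rewrite addrCA lerDl addr_ge0//.
  exact: sumr_ge0.
apply: le_trans split_bad _.
have e4 : 0 < expR 4 :> R by exact: expR_gt0.
have normc : 0 < norm_factor * S.
  by rewrite !mulr_gt0// sqrtr_gt0; apply: lt_le_trans dge2.
(* This choice makes $m/\theta=nq$ and $4\theta qn=4m$; [dense] keeps it below $1/2$. *)
pose theta := m%:R / (n%:R * q).
have theta0 : 0 < theta by exact: divr_gt0.
have theta1 : theta <= 2^-1.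
  have : 32 * L <= n%:R * q.
    by apply: le_trans dense; rewrite ler_wpM2r ?(le_trans ler01)//; have := dge2; lra.
  by rewrite ler_pdivrMr//; lra.
have hnorm : \sum_w pw wgt w *
    (`[< bad_norm p q Xs r (norm_factor * S) (lb w) (tw w) >])%:R <= d%:R / n%:R.
  have ht : 0 < theta <= 2^-1 by rewrite theta0.
  apply: le_trans (prob_bad_norm p01 q01 SXs SO_O r normc ht) _.
  rewrite -/m.
  have -> : 4 * theta * q * n%:R = m%:R * 4 by rewrite /theta; field; rewrite !gt_eqF.
  have -> : m%:R / theta = n%:R * q by rewrite /theta; field; rewrite !gt_eqF.
  rewrite expRM_natl -exprMn -mulrA -expr_div_n.
  have -> : (norm_factor * S) ^+ 2 = 16 * d%:R * expR 4 ^+ 2 * (n%:R * q * L).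
    by rewrite exprMn S2 /norm_factor !exprMn sqr_sqrtr//; ring.
  have Lpos : 0 < L by exact: lt_le_trans L1.
  have ratio : 0 <= 8 * d%:R * m%:R * (n%:R * q) * expR 4 / (16 * d%:R * expR 4 ^+ 2 * (n%:R * q * L)) <= expR (-4).
    have -> : 8 * d%:R * m%:R * (n%:R * q) * expR 4 / (16 * d%:R * expR 4 ^+ 2 * (n%:R * q * L))
        = (m%:R / (2 * L)) * (expR 4)^-1.
      by field; rewrite !gt_eqF//; apply: lt_le_trans dge2.
    rewrite expRN; apply/andP; split.
      by rewrite !mulr_ge0 ?invr_ge0 ?mulr_ge0// ltW.
    by rewrite ler_piMl ?invr_ge0 ?(ltW e4)// ler_pdivrMr ?mulr_gt0// mul1r.
  apply: le_trans (_ : N%:R * n%:R * (n%:R ^+ 4)^-1 <= _).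
    rewrite ler_wpM2l ?mulr_ge0//.
    case/andP: ratio => ra rb.
    apply: le_trans (lerXn2r m ra (expR_ge0 _) rb) _.
    rewrite -expRM_natl -expR_ln_natX// ler_expR -/L.
    by rewrite mulrN lerN2 mulrC ler_pM2r.
  have -> : N%:R = n%:R * d%:R :> R by rewrite sum_nat_const card_ord natrM.
  have -> : n%:R * d%:R * n%:R / n%:R ^+ 4 = (d%:R / n%:R) * (n%:R)^-1 :> R.
    by field; rewrite gt_eqF.
  by rewrite ler_piMr ?divr_ge0// invf_le1// ler1n.
pose s := L / S.
have s0 : 0 < s by rewrite divr_gt0//; apply: lt_le_trans L1.
have s2 : n%:R * q * s ^+ 2 = L.
  rewrite /s expr_div_n S2; field; rewrite !gt_eqF//; exact: lt_le_trans L1.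
have sS : s * S = L by rewrite /s divfK// gt_eqF.
clearbody s.
have hs : s * (2 * Num.sqrt d%:R) <= 2^-1.
  have h0 : 0 <= s * (2 * Num.sqrt d%:R) by apply: mulr_ge0; rewrite ?(ltW s0)// mulr_ge0.
  rewrite -ler_sqr ?nnegrE// !exprMn sqr_sqrtr//.
  have : 16 * d%:R * s ^+ 2 <= 1.
    rewrite -(ler_pM2r (_ : 0 < L)); last exact: lt_le_trans L1.
    rewrite mul1r -{2}s2 mulrAC; apply: ler_wpM2r => //; exact: sqr_ge0.
  by rewrite (_ : 2^-1 ^+ 2 = 4^-1 :> R); [lra | field].
have hrow (x : 'I_n * 'I_n * ('I_d * 'I_d)) : \sum_w pw wgt w *
    (`[< bad_row p q Xs (row_factor * S) x.1.1 x.1.2 x.2.1 x.2.2 (lb w) (tw w) >])%:R <=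
    2 * (n%:R ^+ 5)^-1.
  apply: le_trans (prob_bad_row d2 p01 q01 SXs SO_O _ _ _ _ s0 _ hs) _.
    by rewrite mulr_ge0 ?(ltW S0)// addr_ge0// mulr_ge0.
  rewrite ler_pM2l// -expR_ln_natX// ler_expR -/L.
  have -> : s * (row_factor * S) = row_factor * L by rewrite mulrCA sS.
  have -> : 8 * n%:R * q * d%:R * s ^+ 2 = 8 * d%:R * L by rewrite -[in RHS]s2; ring.
  by rewrite /row_factor; lra.
apply: le_trans (lerD hnorm (ler_sum _ (fun x _ => hrow x))) _.
rewrite sumr_const !card_prod !card_ord -[X in _ + X]mulr_natl !natrM.
have -> : n%:R * n%:R * (d%:R * d%:R) * (2 * (n%:R ^+ 5)^-1) =
    2 * d%:R ^+ 2 / n%:R * ((n%:R ^+ 2)^-1) :> R by field; rewrite gt_eqF.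
have n1 : (n%:R ^+ 2)^-1 <= 1 :> R.
  by rewrite invf_le1 ?exprn_gt0// -natrX ler1n expn_gt0 n0.
apply: le_trans (_ : d%:R / n%:R + 2 * d%:R ^+ 2 / n%:R <= _).
  by rewrite lerD2l ler_piMr// divr_ge0// mulr_ge0// sqr_ge0.
rewrite -mulrDl ler_pM2r ?invr_gt0//; have := dge2; nra.
Qed.

End Assembly.

Lemma frob_entries_le (R : realType) m (A : 'M[R]_m) c : 0 <= c ->
  (forall a b, A a b ^+ 2 <= c ^+ 2) -> frob A <= m%:R * c.
Proof.
move=> c0 hA; rewrite frob_le_sqr ?mulr_ge0//.
apply: le_trans (ler_sum _ (fun a _ => ler_sum _ (fun b _ => hA a b))) _.
by rewrite !sumr_const card_ord -mulrnA exprMn -[leLHS]mulr_natl natrM expr2.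
Qed.

(** From $n\ge2$ only $\log n\ge1/2$ is known. With $C\ge36$ this already forces $n\ge18$, hence
    $n\ge2^3$ and $\log n\ge3/2$. *)
Lemma sample_size_bounds (R : realType) (d n : nat) (p q C : R) : (2 <= d)%N -> (2 <= n)%N ->
  0 < p < 1 -> 0 < q < 1 -> 16 * d%:R + 4 <= C -> C * (ln n%:R / n%:R) <= p ^+ 2 * q ->
  1 <= ln n%:R :> R /\ 16 * d%:R * ln n%:R <= n%:R * q.
Proof.
move=> d2 n2 /andP[p0 p1] /andP[q0 q1] hC h.
have n0 : 0 < n%:R :> R by rewrite ltr0n; apply: leq_trans n2.
have dge2 : 2 <= d%:R :> R by rewrite ler_nat.
have ln0 : 2^-1 <= ln n%:R :> R.
  by apply: le_trans (ln2_ge R) _; rewrite ler_ln ?posrE// ler_nat.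
have h1 : C * ln n%:R <= n%:R * (p ^+ 2 * q).
  by move: h; rewrite mulrA ler_pdivrMr// [n%:R * _]mulrC.
have pq : p ^+ 2 * q <= q by rewrite ler_piMl ?(ltW q0)// expr_le1// ltW.
have h2 : C * ln n%:R <= n%:R * q by apply: le_trans h1 _; rewrite ler_pM2l.
have h3 : 8 <= n%:R :> R.
  have : n%:R * q <= n%:R by rewrite ler_piMr// ltW.
  have : 36 * 2^-1 <= C * ln n%:R by apply: ler_pM => //; lra.
  by lra.
split.
  have : ln (2 ^+ 3) <= ln n%:R :> R.
    by rewrite ler_ln ?posrE ?exprn_gt0//; apply: le_trans h3; rewrite -natrX.
  by rewrite lnXn//; have := ln2_ge R; lra.
by apply: le_trans h2; rewrite ler_wpM2r//; lra.
Qed.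

Section Outcome.
Variables (R : realType) (n d : nat) (p q : R).
Variable Xs : 'M[R]_(\sum_(i < n) d, d).
Hypothesis d2 : (2 <= d)%N.
Hypotheses (p01 : 0 < p < 1) (q01 : 0 < q < 1).
Hypothesis SXs : SOn R n d Xs.

Local Notation cb := (submxcol (p_ := fun=> d)).
Local Notation pair := ('I_n * 'I_n)%type.
Let S : R := Num.sqrt (n%:R * q * ln n%:R).

Lemma rcm_matrix_seen (s : 'I_n -> 'I_n -> label) (O : 'I_n -> 'I_n -> 'M[R]_d) :
  rcm_matrix Xs s O = noisy_matrix Xs
    [ffun e : pair => if (e.1 < e.2)%N then option_of_label (s e.1 e.2) else None]
    (fun i j => if (i < j)%N then O i j else 1%:M).
Proof.
apply/eq_mxblockP => i j; rewrite /observation.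
by have [ij|ji|_] := ltngtP i j; rewrite ?ffunE/= ?ij ?ji ?option_of_labelK.
Qed.

(** One constant for both noise bounds; the factor $d$ passes from entries of a $d\times d$ block to
    its Frobenius norm. *)
Definition noise_factor : R := norm_factor R d + d%:R * row_factor R d.

Lemma good_event_bounds r (l : {ffun pair -> option bool}) (O : 'I_n -> 'I_n -> 'M[R]_d)
    (W := label_noise p q Xs l O) (t := noise_factor * S) :
  (forall i j, SO R d (O i j)) -> ~ bad_event p q Xs r l O ->
  (forall k (x : 'M[R]_(_, k)), frob (W *m x) <= t * frob x) /\
  (forall i k M, (k < n)%N -> 0 <= M -> (forall j, frob (cb (loo_iterate Xs i k W) j) <= M) ->
    frob (cb (W *m loo_iterate Xs i k W) i) <= t * M).
Proof.
move=> SO_O; move/not_orP => [hnorm hrow].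
have S0 : 0 <= S by exact: sqrtr_ge0.
have norm0 : 0 <= norm_factor R d by rewrite !mulr_ge0 ?expR_ge0.
have row0 : 0 <= row_factor R d by rewrite addr_ge0// mulr_ge0.
split=> [k x | i k M kn M0 hM].
  apply: le_trans (label_noise_norm d2 p01 q01 SXs x SO_O _ hnorm) _; first exact: mulr_ge0.
  by rewrite ler_wpM2r ?frob_ge0// ler_wpM2r// lerDl mulr_ge0.
apply: le_trans (_ : d%:R * (row_factor R d * S * M) <= _).
  apply: frob_entries_le => [|a b]; first by rewrite !mulr_ge0.
  have := hrow; move/forallNP/(_ (i, Ordinal kn, (a, b))) => /existsNP[j] /= /negP.
  rewrite -leNgt => hj; apply: le_trans hj _.
  by rewrite [leRHS]exprMn ler_wpM2l ?sqr_ge0// -frob_sqr ler_sqr ?nnegrE ?frob_ge0.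
by rewrite mulrA mulrA ler_wpM2r// ler_wpM2r// lerDr.
Qed.

End Outcome.

(** The first identity is the noise-to-signal ratio, the second passes from the blockwise to the
    global rate, and the third brings in $p^2q$. *)
Lemma rate_identities (R : realType) (n : nat) (p q L : R) : (0 < n)%N -> 0 < p -> 0 < q -> 0 <= L ->
  let rate := Num.sqrt L / (p * Num.sqrt (n%:R * q)) in
  [/\ Num.sqrt (n%:R * q * L) / (n%:R * (p * q)) = rate,
      Num.sqrt n%:R * rate = Num.sqrt L / (p * Num.sqrt q)
    & rate ^+ 2 = L / n%:R / (p ^+ 2 * q)].
Proof.
move=> n0 p0 q0 L0; have npos : 0 < n%:R :> R by rewrite ltr0n.
have nq0 : 0 < n%:R * q by exact: mulr_gt0.
have s0 : Num.sqrt (n%:R * q) != 0 by rewrite gt_eqF// sqrtr_gt0.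
have sn0 : Num.sqrt n%:R != 0 :> R by rewrite gt_eqF// sqrtr_gt0.
have sq0 : Num.sqrt q != 0 by rewrite gt_eqF// sqrtr_gt0.
split.
- rewrite sqrtrM ?(ltW nq0)//.
  have -> : n%:R * (p * q) = p * Num.sqrt (n%:R * q) ^+ 2 by rewrite sqr_sqrtr ?(ltW nq0)//; ring.
  by field; rewrite s0 gt_eqF.
- by rewrite sqrtrM ?(ltW npos)//; field; rewrite sq0 sn0 gt_eqF.
- by rewrite expr_div_n exprMn !sqr_sqrtr ?(ltW nq0)//; field; rewrite !gt_eqF.
Qed.

Theorem theorem2 (R : realType) (d : nat) (hd : (2 <= d)%N) :
  exists C C' C'' : R,
  [/\ 0 < C, 0 < C', 0 < C''
    & forall (n : nat) (p q : R),
        (2 <= n)%N -> 0 < p < 1 -> 0 < q < 1 ->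
        C * (ln n%:R / n%:R) <= p ^+ 2 * q ->
      forall (Xs : 'M[R]_(\sum_(i < n) d, d)), SOn R n d Xs ->
      forall (disp : measure_display) (T : measurableType disp)
             (P : probability T R)
             (Y : T -> 'M[R]_(\sum_(i < n) d))
             (X0 : T -> 'M[R]_(\sum_(i < n) d, d)),
        is_RCM P p q Xs Y ->
        (forall w, is_SpectrIn (Y w) (X0 w)) ->
      exists E : set T,
        [/\ measurable E,
            ((1 - C' / n%:R)%:E <= P E)%E
          & forall w, E w ->
              dist (X0 w) Xs <= C'' * (Num.sqrt (ln n%:R) / (p * Num.sqrt q))
              /\ dist_inf (X0 w) Xs <=
                   C'' * (Num.sqrt (ln n%:R) / (p * Num.sqrt (n%:R * q)))]].
Proof.
have dpos : 0 < d%:R :> R by rewrite ltr0n; apply: leq_trans hd.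
have [C1 C1ge2 near] := near_orthogonal R d.
pose G : R := (1 + 3 * d%:R * C1) * (42 * d%:R * noise_factor R d).
have G0 : 0 < G.
  rewrite !mulr_gt0 ?addr_gt0 ?mulr_gt0 ?expR_gt0 ?sqrtr_gt0//; first by lra.
  by rewrite addr_gt0// mulr_gt0.
(* The square forces [G * rate < 1], because $\mathrm{rate}^2\le1/C$; the other summands feed
   [sample_size_bounds]. The last constant is the larger of $2G$ for [dist] and $6G$ for
   [dist_inf]. *)
exists ((G + 1) ^+ 2 + 16 * d%:R + 4), (3 * d%:R ^+ 2), (6 * G).
have GG : 0 < (G + 1) ^+ 2 by rewrite exprn_gt0// addr_gt0.
have C0 : 0 < (G + 1) ^+ 2 + 16 * d%:R + 4 by rewrite !addr_gt0// mulr_gt0.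
split=> //; [by rewrite mulr_gt0// exprn_gt0 | exact: mulr_gt0 |].
move=> n p q n2 p01 q01 signal Xs SXs disp T P Y X0 [s [outlier [label_law haar_law indep YE]]] spectr.
have n0 : (0 < n)%N by exact: ltnW.
have npos : 0 < n%:R :> R by rewrite ltr0n.
have hC : 16 * d%:R + 4 <= (G + 1) ^+ 2 + 16 * d%:R + 4 by move: GG; lra.
have [L1 dense] := sample_size_bounds hd n2 p01 q01 hC signal.
have [p0 _] := andP p01; have [q0 _] := andP q01.
have Lpos : 0 < ln n%:R :> R by exact: lt_le_trans L1.
have [r hr] := pow2_between L1.
have [mbad pbad] := finite_transfer p01 q01 label_law haar_law indep
  (@measurable_bad_event _ _ _ p q Xs r)
  (fun O => prob_bad_event hd p01 q01 SXs n0 L1 dense hr (O := O)).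
set bad := [set x | _] in mbad pbad.
exists (~` bad); split; first exact: measurableC.
  by rewrite probability_setC// EFinB leeB.
move=> w good.
have SO_O i j : SO R d (seen_array outlier w i j) by exact: seen_array_SO haar_law w i j.
have [opW rowW] := good_event_bounds hd p01 q01 SXs SO_O good.
set l := seen_labels s w in opW rowW; set O := seen_array outlier w in opW rowW.
have [rateE rate_sqrt rate_sqr] := rate_identities n0 p0 q0 (ltW Lpos).
set rate := Num.sqrt (ln n%:R) / (p * Num.sqrt (n%:R * q)) in rateE rate_sqrt rate_sqr *.
have YE' : Y w = (p * q) *: (Xs *m Xs^T) + label_noise p q Xs l O - (p * q)%:M.
  have -> : label_noise p q Xs l O = Y w - (p * q) *: (Xs *m Xs^T - 1%:M).
    by rewrite YE rcm_matrix_seen.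
  by rewrite scalerBr scalemx1 opprB addrCA [X in _ + X - _]addrC subrK addrK.
have rate0 : 0 <= rate by rewrite divr_ge0 ?mulr_ge0 ?sqrtr_ge0 ?(ltW p0).
have Grate : G * rate < 1.
  suff : (G * rate) ^+ 2 < 1 by rewrite expr_lt1//; apply: mulr_ge0 => //; exact: ltW.
  rewrite exprMn rate_sqr.
  have hs : ln n%:R / n%:R / (p ^+ 2 * q) <= ((G + 1) ^+ 2 + 16 * d%:R + 4)^-1.
    rewrite ler_pdivrMr ?mulr_gt0 ?exprn_gt0// [leRHS]mulrC ler_pdivlMr//.
    by rewrite [leLHS]mulrC.
  apply: le_lt_trans (ler_wpM2l (sqr_ge0 _) hs) _.
  rewrite ltr_pdivrMr// mul1r; have := dpos; move: G0; nra.
have small : (1 + 3 * d%:R * C1) * (42 * d%:R *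
   (noise_factor R d * Num.sqrt (n%:R * q * ln n%:R) / (n%:R * (p * q)))) = G * rate.
  by rewrite -mulrA [in LHS]mulrA [in LHS]mulrA -rateE /G; ring.
have C10 : 0 <= C1 by exact: le_trans C1ge2.
have t0 : 0 <= noise_factor R d * Num.sqrt (n%:R * q * ln n%:R).
  by rewrite mulr_ge0// addr_ge0// mulr_ge0// ?mulr_ge0 ?expR_ge0// addr_ge0// mulr_ge0.
have [|h1 h2] := spectral_estimate SXs n0 (ltnW hd) near C10 (mulr_gt0 p0 q0) t0 YE' opW rowW _ (spectr w).
  by rewrite small.
rewrite small in h1 h2; split; last by rewrite -mulrA.
apply: le_trans h1 _; rewrite -rate_sqrt.
rewrite [leRHS](_ : _ = 3 * (Num.sqrt n%:R * (2 * (G * rate)))); last by ring.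
have three : 1 <= 3 :> R by rewrite ler1n.
have Gr0 : 0 <= G * rate by apply: mulr_ge0 => //; exact: ltW.
by apply: ler_peMl => //; apply: mulr_ge0 => //; exact: mulr_ge0.
Qed.
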